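(* Let $n \geq 1$ and let $P_n$ denote the path with $n+1$ vertices. Let $G^6_{110}$ be the graph with vertex set $\{v_1,\dots,v_6\}$ and edge set consisting of the six cycle edges $v_1v_2, v_2v_3, v_3v_4, v_4v_5, v_5v_6, v_6v_1$ together with the three chords $v_1v_3, v_1v_5, v_2v_6$ (9 edges). Let $G^6_{137}$ be the graph with vertex set $\{v_1,\dots,v_6\}$ and edge set consisting of the six cycle edges $v_1v_2, v_2v_3, v_3v_4, v_4v_5, v_5v_6, v_6v_1$ together with the four chords $v_1v_3, v_1v_5, v_2v_4, v_4v_6$ (10 edges; equivalently, $K_{2,4}$ with parts $\{v_1,v_4\}$ and $\{v_2,v_3,v_5,v_6\}$ plus the two edges $v_2v_3$ and $v_5v_6$). Then $cr(G^6_{110} \Box P_n) = 3n-1$ and $cr(G^6_{137} \Box P_n) = 4n$.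
   Context: The crossing number $cr(G)$ of a graph $G$ is the minimum number of edge crossings over all drawings of $G$ in the plane. The Cartesian product $G \Box H$ has vertex set $V(G)\times V(H)$, with $(u,u')$ adjacent to $(v,v')$ iff either $u=v$ and $u'v' \in E(H)$, or $u'=v'$ and $uv \in E(G)$. The names $G^6_{110}$, $G^6_{137}$ refer to Harary's indexing of six-vertex graphs; the graphs are as defined explicitly in the claim. *)

(* Defs.v *)
From HB Require Import structures.
From mathcomp Require Import all_boot all_order all_algebra.
From mathcomp Require Import all_classical all_reals all_analysis.
From mathcomp Require Import Rstruct Rstruct_topology.
Set Implicit Arguments. Unset Strict Implicit. Unset Printing Implicit Defensive.
Import Order.TTheory GRing.Theory Num.Theory.
Local Open Scope ring_scope.

Definition R := Rdefinitions.R.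
Definition point := (R * R)%type.

Record graph := Graph {
  gV : finType;
  gE : rel gV;
  gE_sym : symmetric gE;
  gE_irr : irreflexive gE }.

(* Edges, each listed once, as ordered pairs (u,v) with u before v in enum. *)
Definition dedge (G : graph) (p : gV G * gV G) : bool :=
  gE p.1 p.2 && (enum_rank p.1 < enum_rank p.2)%N.

Record drawing (G : graph) := Drawing {
  dpos : gV G -> point;
  darc : gV G * gV G -> R -> point;
  dpos_inj : injective dpos;
  darc_cont : forall p, dedge p ->
     continuous (fun t => (darc p t).1) /\ continuous (fun t => (darc p t).2);
  darc_end0 : forall p, dedge p -> darc p 0 = dpos p.1;
  darc_end1 : forall p, dedge p -> darc p 1 = dpos p.2;
  darc_inj : forall p, dedge p -> forall s t : R,
     0 <= s <= 1 -> 0 <= t <= 1 -> darc p s = darc p t -> s = t;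
  darc_novert : forall p, dedge p -> forall t : R, 0 < t < 1 ->
     forall w, darc p t <> dpos w }.

Definition crossings (G : graph) (D : drawing G) (p q : gV G * gV G)
  : point -> Prop :=
  fun z => exists s t : R, [/\ 0 < s < 1, 0 < t < 1,
                              darc D p s = z & darc D q t = z].

(* D has exactly k crossings: every pair of distinct edges crosses in finitely
   many points (enumerated without repetition by c p q), and the total number
   of crossings, summed over unordered pairs of distinct edges, is k. *)
Definition drawing_crossings (G : graph) (D : drawing G) (k : nat) : Prop :=
  exists c : gV G * gV G -> gV G * gV G -> seq point,
    (forall p q, dedge p -> dedge q -> p != q ->
       uniq (c p q) /\ (forall z, z \in c p q <-> crossings D p q z)) /\
    (\sum_(p | dedge p) \sum_(q | dedge q && (q != p)) size (c p q))%N
      = (k.*2)%N.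

Definition crossing_number_is (G : graph) (k : nat) : Prop :=
  (exists D : drawing G, drawing_crossings D k) /\
  (forall (D : drawing G) (m : nat), drawing_crossings D m -> (k <= m)%N).

Definition cart_rel (G H : graph) : rel (gV G * gV H) :=
  fun x y => ((x.1 == y.1) && gE x.2 y.2) || ((x.2 == y.2) && gE x.1 y.1).

Lemma cart_sym G H : symmetric (@cart_rel G H).
Proof.
move=> [a b] [c d]; rewrite /cart_rel /= (eq_sym a) (eq_sym b).
by rewrite (@gE_sym H b d) (@gE_sym G a c).
Qed.

Lemma cart_irr G H : irreflexive (@cart_rel G H).
Proof. by move=> [a b]; rewrite /cart_rel /= !gE_irr !andbF. Qed.

Definition cartesian (G H : graph) : graph :=
  Graph (@cart_sym G H) (@cart_irr G H).

Definition list_rel (m : nat) (l : seq (nat * nat)) : rel 'I_m :=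
  fun i j => (i != j) &&
    (((nat_of_ord i, nat_of_ord j) \in l) || ((nat_of_ord j, nat_of_ord i) \in l)).

Lemma list_rel_sym m l : symmetric (@list_rel m l).
Proof. by move=> i j; rewrite /list_rel eq_sym orbC. Qed.

Lemma list_rel_irr m l : irreflexive (@list_rel m l).
Proof. by move=> i; rewrite /list_rel eqxx. Qed.

Definition list_graph (m : nat) (l : seq (nat * nat)) : graph :=
  Graph (@list_rel_sym m l) (@list_rel_irr m l).

Definition path_graph (n : nat) : graph :=
  list_graph n.+1 [seq (i, i.+1) | i <- iota 0 n].

(* Vertices v1..v6 are 0..5. *)
Definition G6_110 : graph :=
  list_graph 6 [:: (0,1); (1,2); (2,3); (3,4); (4,5); (5,0);
                   (0,2); (0,4); (1,5)].

Definition G6_137 : graph :=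
  list_graph 6 [:: (0,1); (1,2); (2,3); (3,4); (4,5); (5,0);
                   (0,2); (0,4); (1,3); (3,5)].

(* Main.v *)
From Stdlib Require Import ZArith Reals.
From Stdlib Require Bool Ring.
From HB Require Import structures.
From mathcomp Require Import all_boot all_order all_algebra.
From mathcomp Require Import all_classical all_reals all_analysis.
From mathcomp Require Import Rstruct Rstruct_topology.
From mathcomp Require Import zify ring lra.
Require Import Defs.
Set Implicit Arguments. Unset Strict Implicit. Unset Printing Implicit Defensive.

(** The lower bounds rest on a count modulo 2. Replacing every arc by a fine inscribed
    polygon attaches a bit to each (edge, vertex) pair and to each pair of vertices so
    that, for two independent edges that do not cross, the bits at their ends sum to
    zero. These sums telescope along walks, so every subdivision of K33 in a drawing
    contains two crossing edges lying on paths with disjoint ends.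

    Call a vertex adjacent to all of v2, v3, v5, v6 a hub; the copies of these four form
    four lines across the levels. Three hub copies together with three of the four lines give a
    subdivision of K33, and so do certain walks around the rim v2 v3 v4 v5 v6 of a level
    of the first graph. Weighting these subdivisions so that no crossing is charged more
    than once yields 4n and 3n - 1.

    The upper bounds come from straight-line drawings in which level j is scaled by
    100^j: edges two or more levels apart are separated by a linear functional, and the
    remaining pairs reduce by scaling to finitely many. A drawing with at most k
    crossings suffices, by the lower bound. *)

(** * Crossings modulo 2 *)

(** Arcs are arbitrary continuous curves: they may touch, meet repeatedly, and cross adjacent edges.
    The topological input is that two independent edges without crossing are disjoint compact sets;
    nothing is asserted about the bits of a pair that does cross. The bits belong to the drawing and
    not to a pair of edges: this is why they cancel along walks, and why the sum over the 18
    independent pairs of K33 is 1 for every choice of bits in which [lt] changes under exchange of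
    its arguments.

    The second graph has two hubs per level, so its 2n + 2 hub copies form a chain, and each of the
    2n inner members yields two crossings. In the first graph the n + 1 hub copies yield only 2(n -
    1) in this way, so the rims have to contribute. The weighted inequalities then bound four times
    the number of crossings below by 12n - 7; integrality raises this to 3n - 1, and the summand
    that lifts the bound above 3n - 2 comes from a single subdivision at the bottom level. *)

Section DrawingParity.
Import Order.TTheory GRing.Theory Num.Theory numFieldNormedType.Exports.
Local Open Scope ring_scope.
Local Open Scope classical_set_scope.

(** * Incidence parity of disjoint segments and polylines *)

Section SegmentParity.
Variable F : realFieldType.
Implicit Types (p q r s v : F * F) (x y m : F).

(** This is the order of abscissas after an infinitesimal shear, so that points on a common vertical
    are treated like all others. *)
Definition lex p q := (p.1 < q.1) || ((p.1 == q.1) && (p.2 < q.2)).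

Definition orient p q r := (q.1 - p.1) * (r.2 - p.2) - (q.2 - p.2) * (r.1 - p.1).

(** The vertical ray going up from [v] meets the segment [rs]: [v] lies in the half-open [lex] range
    of the segment and on its lower side. The variant [underx] compares abscissas only. *)
Definition under v r s := (lex r v (+) lex s v) &&
  (if lex r s then orient r s v < 0 else orient s r v < 0).

Definition on_seg (p q : F * F) (a : F) : F * F :=
  (p.1 + a * (q.1 - p.1), p.2 + a * (q.2 - p.2)).

Definition seg_disjoint p q r s := forall a b,
  0 <= a <= 1 -> 0 <= b <= 1 -> on_seg p q a <> on_seg r s b.

Lemma lex_asym p q : p != q -> lex p q = ~~ lex q p.
Proof.
case: p q => [p1 p2] [q1 q2]; rewrite /lex /= xpair_eqE.
by case: (ltgtP p1 q1) => //= _; case: (ltgtP p2 q2).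
Qed.

Lemma affine_zero (c m x y : F) : x < y -> c + m * x < 0 -> 0 < c + m * y ->
  exists2 z, x <= z <= y & c + m * z = 0.
Proof.
move=> xy ux uy; have m0 : 0 < m by nra.
exists (- c / m); last by rewrite mulrC divfK ?addrN // gt_eqF.
by rewrite ler_pdivlMr // ler_pdivrMr //; apply/andP; split; lra.
Qed.

Lemma affine_same_sign (c m x y : F) : x < y ->
  (forall z, x <= z <= y -> c + m * z != 0) ->
  (0 < c + m * x) = (0 < c + m * y).
Proof.
move=> xy nz.
have nx : c + m * x != 0 by apply: nz; rewrite lexx ltW.
have ny : c + m * y != 0 by apply: nz; rewrite lexx ltW.
case: (ltgtP (c + m * x) 0) nx => // ux _; case: (ltgtP (c + m * y) 0) ny => // uy _.
  by have [z /nz/eqP] := affine_zero xy ux uy.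
have [||z /nz/eqP nz0 z0] := @affine_zero (- c) (- m) x y xy; try lra.
Qed.

Definition underx v r s := ((r.1 < v.1) (+) (s.1 < v.1)) &&
  (if r.1 < s.1 then orient r s v < 0 else orient s r v < 0).

(** Over the common range of abscissas the difference in height of the two lines is affine without
    zero, hence of constant sign. According to which ends bound that range, the incidences there
    cancel each other or match the interlacing terms. *)
Lemma segx_parity p q r s :
  p.1 < q.1 -> r.1 < s.1 -> p.1 < r.1 ->
  q.1 != r.1 -> q.1 != s.1 -> seg_disjoint p q r s ->
  underx p r s (+) underx q r s (+) underx r p q (+) underx s p q
  (+) (p.1 < r.1) (+) (p.1 < s.1) (+) (q.1 < r.1) (+) (q.1 < s.1) = false.
Proof.
move=> pq rs pr qr qs dis.
pose m1 := (q.2 - p.2) / (q.1 - p.1); pose m2 := (s.2 - r.2) / (s.1 - r.1).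
(* At abscissa [z] the line [pq] runs [c + (m1 - m2) * z] above the line [rs]. *)
pose c := p.2 - m1 * p.1 - r.2 + m2 * r.1.
have ps := lt_trans pr rs.
have nz z : p.1 <= z <= q.1 -> r.1 <= z <= s.1 -> c + (m1 - m2) * z != 0.
  move=> /andP[pz zq] /andP[rz zs]; apply/eqP => E.
  apply: (dis ((z - p.1) / (q.1 - p.1)) ((z - r.1) / (s.1 - r.1))).
  - by rewrite ler_pdivlMr ?ler_pdivrMr; try lra; apply/andP; split; lra.
  - by rewrite ler_pdivlMr ?ler_pdivrMr; try lra; apply/andP; split; lra.
  have E1 : (z - p.1) / (q.1 - p.1) * (q.2 - p.2) = m1 * (z - p.1) by rewrite /m1; ring.
  have E2 : (z - r.1) / (s.1 - r.1) * (s.2 - r.2) = m2 * (z - r.1) by rewrite /m2; ring.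
  rewrite /on_seg E1 E2 !divfK; try by rewrite subr_eq0 gt_eqF.
  by congr pair; [ring | rewrite /c in E; lra].
have o1 v : (orient p q v < 0) = (v.2 < p.2 + m1 * (v.1 - p.1)).
  have -> : orient p q v = (v.2 - (p.2 + m1 * (v.1 - p.1))) * (q.1 - p.1).
    by rewrite /orient /m1; field; rewrite subr_eq0 gt_eqF.
  by rewrite pmulr_llt0 ?subr_gt0 // subr_lt0.
have o2 v : (orient r s v < 0) = (v.2 < r.2 + m2 * (v.1 - r.1)).
  have -> : orient r s v = (v.2 - (r.2 + m2 * (v.1 - r.1))) * (s.1 - r.1).
    by rewrite /orient /m2; field; rewrite subr_eq0 gt_eqF.
  by rewrite pmulr_llt0 ?subr_gt0 // subr_lt0.
have r_pq : (orient p q r < 0) = (0 < c + (m1 - m2) * r.1).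
  by rewrite o1 -subr_gt0; congr (_ < _); rewrite /c; ring.
have s_pq : (orient p q s < 0) = (0 < c + (m1 - m2) * s.1).
  rewrite o1 -subr_gt0; congr (_ < _).
  have -> : s.2 = r.2 + m2 * (s.1 - r.1).
    by rewrite /m2 divfK ?subr_eq0 ?gt_eqF //; ring.
  by rewrite /c; ring.
have q_rs : (orient r s q < 0) = (c + (m1 - m2) * q.1 < 0).
  rewrite o2 -subr_lt0; congr (_ < _).
  have -> : q.2 = p.2 + m1 * (q.1 - p.1).
    by rewrite /m1 divfK ?subr_eq0 ?gt_eqF //; ring.
  by rewrite /c; ring.
rewrite /underx pq rs pr ps.
have -> : (r.1 < p.1) = false by apply/negbTE; rewrite -leNgt ltW.
have -> : (s.1 < p.1) = false by apply/negbTE; rewrite -leNgt ltW.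
rewrite r_pq s_pq q_rs.
case: (ltgtP q.1 r.1) qr => [q_r _|r_q _|//];
  case: (ltgtP q.1 s.1) qs => [q_s _|s_q _|//] //=.
- by have := lt_trans s_q (lt_trans q_r rs); rewrite ltxx.
- have -> : (0 < c + (m1 - m2) * r.1) = (0 < c + (m1 - m2) * q.1).
    apply: affine_same_sign => // z /andP[rz zq]; apply: nz; lra.
  have nq : c + (m1 - m2) * q.1 != 0 by apply: nz; rewrite ?lexx ?ltW.
  by case: (ltgtP (c + _) 0) nq.
- have -> : (0 < c + (m1 - m2) * r.1) = (0 < c + (m1 - m2) * s.1).
    apply: affine_same_sign => // z /andP[rz zs]; apply: nz; lra.
  by case: (0 < _).
Qed.

(** A small shear turns [lex] on finitely many points into a comparison of abscissas and keeps every
    [orient] and every intersection; it brings [seg_parity] to the case of distinct abscissas. *)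
Definition shear (e : F) p : F * F := (p.1 + e * p.2, p.2).

Lemma shear_lex p q : exists2 e0, 0 < e0 &
  forall e, 0 < e -> e < e0 -> ((shear e p).1 < (shear e q).1) = lex p q.
Proof.
rewrite /lex /shear /=; case: (ltgtP p.1 q.1) => [pq|qp|->] /=.
- have n0 : 0 < 1 + `|p.2 - q.2| by rewrite ltr_pwDl.
  exists ((q.1 - p.1) / (1 + `|p.2 - q.2|)); first by rewrite divr_gt0 ?subr_gt0.
  move=> e e0; rewrite ltr_pdivlMr // => H.
  have : e * (p.2 - q.2) <= e * `|p.2 - q.2| by rewrite ler_pM2l // ler_norm.
  by lra.
- have n0 : 0 < 1 + `|q.2 - p.2| by rewrite ltr_pwDl.
  exists ((p.1 - q.1) / (1 + `|q.2 - p.2|)); first by rewrite divr_gt0 ?subr_gt0.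
  move=> e e0; rewrite ltr_pdivlMr // => H.
  have : e * (q.2 - p.2) <= e * `|q.2 - p.2| by rewrite ler_pM2l // ler_norm.
  by lra.
- by exists 1 => // e e0 _; rewrite ltrD2l ltr_pM2l.
Qed.

Lemma shear_lex_seq (l : seq (F * F)) : exists2 e, 0 < e &
  forall p q, p \in l -> q \in l -> ((shear e p).1 < (shear e q).1) = lex p q.
Proof.
suff [e0 e00 H] : exists2 e0, 0 < e0 & forall e, 0 < e -> e < e0 ->
    forall pq, pq \in [seq (p, q) | p <- l, q <- l] ->
    ((shear e pq.1).1 < (shear e pq.2).1) = lex pq.1 pq.2.
  exists (e0 / 2) => [|p q pl ql]; first by lra.
  by apply: (H _ _ _ (p, q)); [lra|lra|apply/allpairsP; exists (p, q)].
elim: [seq _ | _ <- _, _ <- _] => [|[p q] s [e0 e00 IH]]; first by exists 1.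
have [e1 e10 H1] := shear_lex p q.
exists (Num.min e0 e1) => [|e eg0]; first by rewrite lt_min e00.
rewrite lt_min => /andP[l0 l1] pq; rewrite inE => /predU1P[-> /=|]; first exact: H1.
exact: IH.
Qed.

Lemma orient_shear e p q r : orient (shear e p) (shear e q) (shear e r) = orient p q r.
Proof. by rewrite /orient /shear /=; ring. Qed.

Lemma on_seg_shear e p q a : on_seg (shear e p) (shear e q) a = shear e (on_seg p q a).
Proof. by rewrite /on_seg /shear /=; congr pair; ring. Qed.

Lemma shear_inj e : injective (shear e).
Proof. by move=> [x y] [x' y'] [+ E]; rewrite E => /addIr ->. Qed.

Lemma underC v r s : r != s -> under v r s = under v s r.
Proof. by move=> rs; rewrite /under addbC (lex_asym rs); case: (lex s r). Qed.

Lemma seg_disjointC p q r s : seg_disjoint p q r s -> seg_disjoint q p r s.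
Proof.
move=> dis a b a01 b01 E; apply: (dis (1 - a) b) => //; first by lra.
by rewrite -E /on_seg; congr pair; ring.
Qed.

Lemma seg_disjoint_sym p q r s : seg_disjoint p q r s -> seg_disjoint r s p q.
Proof. by move=> dis a b a01 b01 /esym; apply: dis. Qed.

(* The left-hand side counts, modulo 2, the vertical incidences of two segments
   corrected by the interlacing of their endpoints; for segments in general
   position it is the parity of their number of crossings. *)
Lemma seg_parity p q r s : seg_disjoint p q r s ->
  under p r s (+) under q r s (+) under r p q (+) under s p q
  (+) lex p r (+) lex p s (+) lex q r (+) lex q s = false.
Proof.
have u0 v w : under v w w = false by rewrite /under addbb.
have [-> _|pq] := eqVneq p q.
  by rewrite !u0; case: (lex q r); case: (lex q s); case: (under _ _ _).
have [-> _|rs] := eqVneq r s.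
  by rewrite !u0; case: (lex p s); case: (lex q s); case: (under r _ _); case: (under s _ _).
wlog lpq : p q pq / lex p q.
  move=> W dis; have [|lqp] := boolP (lex p q); first by move/W; apply.
  have /W : lex q p by rewrite (lex_asym pq) negbK in lqp.
  rewrite eq_sym => /(_ pq (seg_disjointC dis)).
  by rewrite !(underC _ pq) => <-; rewrite -!addbA; do !bool_congr.
wlog lrs : r s rs / lex r s.
  move=> W dis; have [|lsr] := boolP (lex r s); first by move/W; apply.
  have /W : lex s r by rewrite (lex_asym rs) negbK in lsr.
  rewrite eq_sym => /(_ rs (seg_disjoint_sym (seg_disjointC (seg_disjoint_sym dis)))).
  by rewrite !(underC _ rs) => <-; rewrite -!addbA; do !bool_congr.
move=> dis.
have ends (x y : F * F) : x \in [:: p; q] -> y \in [:: r; s] -> x != y.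
  rewrite !inE => xpq yrs; apply/eqP => xy.
  have B (c : bool) : 0 <= (c%:R : F) <= 1 by case: c; rewrite ?lexx ?ler01.
  apply: (dis (x == q)%:R (y == s)%:R) => //.
  have S (u v : F * F) (c : bool) : on_seg u v c%:R = if c then v else u.
    by case: c; rewrite /on_seg ?mul0r ?mul1r ?addr0 ?(addrC _ (_ - _)) ?subrK
       -surjective_pairing.
  rewrite !S; have -> : (if x == q then q else p) = x.
    by case: (eqVneq x q) xpq => [//|_]; rewrite orbF => /eqP.
  by rewrite xy; case: (eqVneq y s) yrs => [//|_]; rewrite orbF => /eqP.
wlog lpr : p q r s pq rs lpq lrs dis ends / lex p r.
  move=> W; have [lpr|] : lex p r \/ ~~ lex p r; first by case: (lex p r); [left|right].
    exact: (W p q r s).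
  move=> nlpr; have lrp : lex r p.
    by move: nlpr; rewrite lex_asym ?negbK // ends ?inE ?eqxx.
  have ends' (x y : F * F) : x \in [:: r; s] -> y \in [:: p; q] -> x != y.
    by move=> xi yi; rewrite eq_sym; apply: ends.
  have := W r s p q rs pq lrs lpq (seg_disjoint_sym dis) ends' lrp.
  rewrite (@lex_asym p r) ?(@lex_asym p s) ?(@lex_asym q r) ?(@lex_asym q s);
    rewrite ?ends ?inE ?eqxx ?orbT //.
  by do 4!case: (lex _ _); do 4!case: (under _ _ _).
have [e e0 E] := shear_lex_seq [:: p; q; r; s].
have L (x y : F * F) : x \in [:: p; q; r; s] -> y \in [:: p; q; r; s] ->
    lex x y = ((shear e x).1 < (shear e y).1) by move=> *; rewrite E.
have D (x y : F * F) : x \in [:: p; q; r; s] -> y \in [:: p; q; r; s] -> x != y ->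
    (shear e x).1 != (shear e y).1.
  move=> xi yi xy; rewrite neq_lt -!L //; case: (boolP (lex x y)) => //.
  by rewrite (lex_asym xy) negbK.
have U (v x y : F * F) : v \in [:: p; q; r; s] -> x \in [:: p; q; r; s] ->
    y \in [:: p; q; r; s] -> under v x y = underx (shear e v) (shear e x) (shear e y).
  by move=> *; rewrite /under /underx !orient_shear -!L.
have {}L : {in [:: p; q; r; s] &, forall x y : F * F, lex x y = ((shear e x).1 < (shear e y).1)}
    by [].
rewrite !U ?L ?inE ?eqxx ?orbT //.
apply: segx_parity; rewrite -?L ?D ?ends ?inE ?eqxx ?orbT //.
by move=> a b a01 b01; rewrite !on_seg_shear => /shear_inj; apply: dis.
Qed.

Definition incidence (f : nat -> F * F) (n : nat) v :=
  \big[addb/false]_(0 <= k < n) under v (f k) (f k.+1).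

Lemma big_addb_telescope (h : nat -> bool) (n : nat) :
  \big[addb/false]_(0 <= k < n) (h k (+) h k.+1) = h 0%N (+) h n.
Proof.
elim: n => [|n IH]; first by rewrite big_geq ?addbb.
by rewrite big_nat_recr //= IH addbA addbK.
Qed.

(** In the sum of [seg_parity] over the sides of [g], whatever is attached to an inner vertex of [g]
    occurs twice. *)
Lemma seg_polyline_parity p q (g : nat -> F * F) (m : nat) :
  (forall l, (l < m)%N -> seg_disjoint p q (g l) (g l.+1)) ->
  incidence g m p (+) incidence g m q (+) under (g 0%N) p q (+) under (g m) p q
  (+) lex p (g 0%N) (+) lex p (g m) (+) lex q (g 0%N) (+) lex q (g m) = false.
Proof.
move=> dis; pose h l := under (g l) p q (+) lex p (g l) (+) lex q (g l).
have : \big[addb/false]_(0 <= l < m) (under p (g l) (g l.+1) (+) under q (g l) (g l.+1)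
    (+) (h l (+) h l.+1)) = false.
  rewrite big_nat; apply: big1 => l /andP[_ /dis/seg_parity] <-; rewrite /h.
  by do 4!case: (lex _ _); do 4!case: (under _ _ _).
rewrite big_split /= big_addb_telescope big_split /= -/(incidence g m p) -/(incidence g m q) /h =>
    <-.
by do 4!case: (lex _ _); do 2!case: (under _ _ _); do 2!case: (incidence _ _ _).
Qed.

Lemma polyline_parity (f g : nat -> F * F) (n m : nat) :
  (forall k l, (k < n)%N -> (l < m)%N -> seg_disjoint (f k) (f k.+1) (g l) (g l.+1)) ->
  incidence f n (g 0%N) (+) incidence f n (g m)
  (+) incidence g m (f 0%N) (+) incidence g m (f n)
  (+) lex (f 0%N) (g 0%N) (+) lex (f 0%N) (g m)
  (+) lex (f n) (g 0%N) (+) lex (f n) (g m) = false.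
Proof.
move=> dis; pose h k := incidence g m (f k) (+) lex (f k) (g 0%N) (+) lex (f k) (g m).
have : \big[addb/false]_(0 <= k < n) (under (g 0%N) (f k) (f k.+1)
    (+) under (g m) (f k) (f k.+1) (+) (h k (+) h k.+1)) = false.
  rewrite big_nat; apply: big1 => k /andP[_ kn]; rewrite -(seg_polyline_parity (dis k ^~ kn)) /h.
  by do 4!case: (lex _ _); do 2!case: (under _ _ _); do 2!case: (incidence _ _ _).
rewrite big_split /= big_addb_telescope big_split /= -/(incidence f n _) -/(incidence f n (g m))
    /h => <-.
by do 4!case: (lex _ _); do 4!case: (incidence _ _ _).
Qed.
End SegmentParity.

(** * From disjoint arcs to disjoint inscribed polygons *)

Definition seg_affine (phi : point -> R) :=
  forall p q a, phi (on_seg p q a) = phi p + a * (phi q - phi p).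

Lemma seg_disjoint_sep (phi : point -> R) (m : R) (p q r s : point) :
  seg_affine phi -> phi p < m -> phi q < m -> m < phi r -> m < phi s ->
  seg_disjoint p q r s.
Proof.
move=> aff pm qm mr ms a b /andP[a0 a1] /andP[b0 b1] E.
have := aff p q a; rewrite E aff => H.
have P : phi p + a * (phi q - phi p) < m.
  by have [pq|qp] := leP (phi p) (phi q);
    [apply: le_lt_trans qm | apply: le_lt_trans pm]; nra.
have Q : m < phi r + b * (phi s - phi r).
  by have [rs|sr] := leP (phi r) (phi s);
    [apply: (lt_le_trans mr) | apply: (lt_le_trans ms)]; nra.
by move: Q; rewrite H ltNge (ltW P).
Qed.

Section Sampling.
Variables f g : R -> point.

Let step (h : R -> point) (s : R) (N : nat) := h (s + N.+1%:R^-1).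

(** By continuity the middle value [m] still separates the short chords that start near [f s] and
    [g t]. The filter lets the parameters and the mesh vary together, which is the form that the
    compactness argument takes as input. *)
Lemma near_seg_disjoint (phi : point -> R) (s t : R) : seg_affine phi ->
  continuous (phi \o f) -> continuous (phi \o g) -> phi (f s) < phi (g t) ->
  \forall z \near (s, t) & N \near \oo,
    seg_disjoint (f z.1) (step f z.1 N) (g z.2) (step g z.2 N).
Proof.
move=> aff cf cg fg; pose m := (phi (f s) + phi (g t)) / 2.
have fm : phi (f s) < m by rewrite /m; lra.
have mg : m < phi (g t) by rewrite /m; lra.
pose F : set_system (R * R * nat) := filter_prod (nbhs (s, t)) \oo.
have FF : Filter F by exact: filter_prod_filter.
have c1 : (fun z : R * R * nat => z.1.1) @ F --> s.
  by apply: (@cvg_comp _ _ _ fst fst F (nbhs (s, t))); [exact: cvg_fst | exact: cvg_fst].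
have c2 : (fun z : R * R * nat => z.1.2) @ F --> t.
  by apply: (@cvg_comp _ _ _ fst snd F (nbhs (s, t))); [exact: cvg_fst | exact: cvg_snd].
have c0 : (fun z : R * R * nat => z.2.+1%:R^-1 : R) @ F --> (0 : R).
  by apply: (@cvg_comp _ _ _ snd harmonic F \oo); [exact: cvg_snd | exact: cvg_harmonic].
have c1' : (fun z : R * R * nat => z.1.1 + z.2.+1%:R^-1) @ F --> s.
  by rewrite -[X in _ --> X]addr0; exact: (@cvgD _ R^o _ _ FF _ _ _ _ c1 c0).
have c2' : (fun z : R * R * nat => z.1.2 + z.2.+1%:R^-1) @ F --> t.
  by rewrite -[X in _ --> X]addr0; exact: (@cvgD _ R^o _ _ FF _ _ _ _ c2 c0).
have f1 : \near F, phi (f F.1.1) < m.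
  by apply: (@cvgr_lt _ _ _ _ _ (phi (f s))) => //; exact: (cvg_comp _ _ c1 (cf s)).
have f2 : \near F, phi (step f F.1.1 F.2) < m.
  by apply: (@cvgr_lt _ _ _ _ _ (phi (f s))) => //; exact: (cvg_comp _ _ c1' (cf s)).
have g1 : \near F, m < phi (g F.1.2).
  by apply: (@cvgr_gt _ _ _ _ _ (phi (g t))) => //; exact: (cvg_comp _ _ c2 (cg t)).
have g2 : \near F, m < phi (step g F.1.2 F.2).
  by apply: (@cvgr_gt _ _ _ _ _ (phi (g t))) => //; exact: (cvg_comp _ _ c2' (cg t)).
have := @filterI _ F FF _ _ (@filterI _ F FF _ _ f1 f2) (@filterI _ F FF _ _ g1 g2).
apply: (@filterS _ F) => z [[a1 a2] [b1 b2]].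
exact: (seg_disjoint_sep aff a1 a2 b1 b2).
Qed.

Hypotheses (cf1 : continuous (fun t => (f t).1)) (cf2 : continuous (fun t => (f t).2)).
Hypotheses (cg1 : continuous (fun t => (g t).1)) (cg2 : continuous (fun t => (g t).2)).
Hypothesis fg_disjoint : forall s t, 0 <= s <= 1 -> 0 <= t <= 1 -> f s <> g t.

Let sample (h : R -> point) (N k : nat) := h (k%:R / N.+1%:R).

(** Distinct points differ in a coordinate, so the local statement applies to one of the projections
    up to sign; compactness of the square of parameters makes the mesh uniform. *)
Lemma sample_disjoint : \forall N \near \oo, forall k l, (k < N.+1)%N -> (l < N.+1)%N ->
  seg_disjoint (sample f N k) (sample f N k.+1) (sample g N l) (sample g N l.+1).
Proof.
pose P N (z : R * R) := seg_disjoint (f z.1) (step f z.1 N) (g z.2) (step g z.2 N).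
have K : compact (`[0, 1]%classic `*` `[0, 1]%classic : set (R * R)).
  by apply: compact_setX; exact: segment_compact.
have : \forall N \near \oo, (`[0, 1]%classic `*` `[0, 1]%classic : set (R * R)) `<=` P N.
  apply: (iffLR (compact_near_coveringP _) K) => -[s t] [] /=; rewrite !in_itv /= => s01 t01.
  have /eqP := fg_disjoint s01 t01; rewrite [f s]surjective_pairing [g t]surjective_pairing.
  have N1 : forall h : R -> point, continuous (fun t => (h t).1) -> continuous (fun t => - (h t).1).
    by move=> h ch x; exact: (@cvgN _ R^o _ _ _ _ _ (ch x)).
  have N2 : forall h : R -> point, continuous (fun t => (h t).2) -> continuous (fun t => - (h t).2).
    by move=> h ch x; exact: (@cvgN _ R^o _ _ _ _ _ (ch x)).
  rewrite xpair_eqE negb_and !neq_lt => /orP[]/orP[] lt.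
  - by apply: (@near_seg_disjoint fst).
  - apply: (@near_seg_disjoint (fun p => - p.1)); rewrite ?ltrN2 //; [|exact: N1|exact: N1].
    by move=> p q a /=; ring.
  - by apply: (@near_seg_disjoint snd).
  - apply: (@near_seg_disjoint (fun p => - p.2)); rewrite ?ltrN2 //; [|exact: N2|exact: N2].
    by move=> p q a /=; ring.
apply: filterS => N PN k l kN lN.
have E (j : nat) : j.+1%:R / N.+1%:R = j%:R / N.+1%:R + N.+1%:R^-1 :> R.
  by rewrite -natr1 mulrDl mul1r.
have B (j : nat) : (j < N.+1)%N -> 0 <= (j%:R / N.+1%:R : R) <= 1.
  by move=> jN; rewrite divr_ge0 //= ler_pdivrMr ?ltr0n // mul1r ler_nat ltnW.
rewrite /sample !E; apply: (PN (k%:R / N.+1%:R, l%:R / N.+1%:R)).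
by split; rewrite /= in_itv /= B.
Qed.

End Sampling.

Definition independent (T : eqType) (p q : T * T) :=
  [&& p.1 != q.1, p.1 != q.2, p.2 != q.1 & p.2 != q.2].

(** [crossings] sees only the interiors of arcs. An end of one arc inside the other is excluded by
    [darc_novert], and two coinciding ends by independence. *)
Lemma drawing_disjoint (G : graph) (D : drawing G) p q :
  dedge p -> dedge q -> independent p q -> (forall z, ~ crossings D p q z) ->
  forall s t : R, 0 <= s <= 1 -> 0 <= t <= 1 -> darc D p s <> darc D q t.
Proof.
move=> dp dq /and4P[n11 n12 n21 n22] nc s t s01 t01.
have ends (e : gV G * gV G) (u : R) : dedge e -> 0 <= u <= 1 ->
    0 < u < 1 \/ exists2 w, w \in [:: e.1; e.2] & darc D e u = dpos D w.
  move=> de /andP[]; rewrite le_eqVlt => /predU1P[<- _|u0].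
    by right; exists e.1; rewrite ?inE ?eqxx ?darc_end0.
  rewrite le_eqVlt => /predU1P[->|u1]; last by left; rewrite u0.
  by right; exists e.2; rewrite ?inE ?eqxx ?orbT ?darc_end1.
case: (ends p s dp s01) => [s_in|[v vp ->]]; case: (ends q t dq t01) => [t_in|[w wq ->]].
- by move=> E; apply: (nc (darc D p s)); exists s, t.
- exact: darc_novert.
- by move/esym; apply: darc_novert.
- move/(@dpos_inj _ D) => E; move: vp wq; rewrite E !inE.
  by case/orP => /eqP ->; rewrite ?(negPf n11) ?(negPf n12) ?(negPf n21) ?(negPf n22).
Qed.

(** There are finitely many pairs of edges, so one mesh [N] serves them all. [A p v] is the parity
    of the number of sides above [v] in the polygon inscribed in [p], and [lt] is the [lex] order of
    the vertices; the polygons start and end exactly at vertices. *)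
Theorem drawing_parity (G : graph) (D : drawing G) :
  exists (A : gV G * gV G -> gV G -> bool) (lt : rel (gV G)),
  (forall u v, u != v -> lt u v = ~~ lt v u) /\
  forall p q, dedge p -> dedge q -> independent p q ->
    (forall z, ~ crossings D p q z) ->
    A p q.1 (+) A p q.2 (+) A q p.1 (+) A q p.2
    (+) lt p.1 q.1 (+) lt p.1 q.2 (+) lt p.2 q.1 (+) lt p.2 q.2 = false.
Proof.
pose sample N (p : gV G * gV G) k := darc D p (k%:R / N.+1%:R).
pose disj N (p q : gV G * gV G) := forall k l, (k < N.+1)%N -> (l < N.+1)%N ->
  seg_disjoint (sample N p k) (sample N p k.+1) (sample N q l) (sample N q l.+1).
have near_disj : \forall N \near \oo, forall pq : (gV G * gV G) * (gV G * gV G),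
    dedge pq.1 -> dedge pq.2 -> independent pq.1 pq.2 ->
    (forall z, ~ crossings D pq.1 pq.2 z) -> disj N pq.1 pq.2.
  apply: filter_forall => -[p q] /=.
  have [dp|/negP ndp] := boolP (dedge p); last by apply: nearW.
  have [dq|/negP ndq] := boolP (dedge q); last by apply: nearW.
  have [ind|/negP nind] := boolP (independent p q); last by apply: nearW.
  have [nc|nnc] := pselect (forall z, ~ crossings D p q z); last by apply: nearW.
  have [cp1 cp2] := darc_cont D dp; have [cq1 cq2] := darc_cont D dq.
  apply: filterS (sample_disjoint cp1 cp2 cq1 cq2 (drawing_disjoint dp dq ind nc)) => N H _ _ _ _.
  exact: H.
have [N disjN] := filter_ex near_disj.
exists (fun p v => incidence (sample N p) N.+1 (dpos D v)), (fun u v => lex (dpos D u) (dpos D v)).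
split=> [u v uv|p q dp dq ind nc]; first by apply: lex_asym; rewrite (inj_eq (@dpos_inj _ D)).
have s0 (e : gV G * gV G) : dedge e -> dpos D e.1 = sample N e 0%N.
  by move=> de; rewrite /sample mul0r darc_end0.
have s1 (e : gV G * gV G) : dedge e -> dpos D e.2 = sample N e N.+1.
  by move=> de; rewrite /sample divff ?darc_end1 ?pnatr_eq0.
rewrite !s0 ?s1 //; apply: polyline_parity; exact: (disjN (p, q)).
Qed.
End DrawingParity.

(** * Parity of pairs of walks *)

Section WalkParity.
Import Bool Ring.
Variables (V : eqType) (A : V * V -> V -> bool) (lt : rel V).

Definition steps (w : seq V) : seq (V * V) := zip w (behead w).

Definition edge_parity (e f : V * V) :=
  A e f.1 (+) A e f.2 (+) A f e.1 (+) A f e.2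
  (+) lt e.1 f.1 (+) lt e.1 f.2 (+) lt e.2 f.1 (+) lt e.2 f.2.

Definition walk_parity (w w' : seq V) :=
  \big[addb/false]_(e <- steps w) \big[addb/false]_(f <- steps w') edge_parity e f.

Definition walk_incidence (w : seq V) (v : V) := \big[addb/false]_(e <- steps w) A e v.

Lemma steps_telescope (h : V -> bool) x s :
  \big[addb/false]_(e <- steps (x :: s)) (h e.1 (+) h e.2) = h x (+) h (last x s).
Proof.
elim: s x => [|y s IH] x; first by rewrite big_nil addbb.
by rewrite big_cons IH /= -addbA addKb.
Qed.

(** For a fixed edge of one walk, [edge_parity] is a coboundary along the other walk plus
    incidences, which are additive. Both sums therefore telescope, and only the ends of the walks
    remain. *)
Lemma walk_parityE x s y t : walk_parity (x :: s) (y :: t) =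
  walk_incidence (x :: s) y (+) walk_incidence (x :: s) (last y t)
  (+) walk_incidence (y :: t) x (+) walk_incidence (y :: t) (last x s)
  (+) lt x y (+) lt x (last y t) (+) lt (last x s) y (+) lt (last x s) (last y t).
Proof.
pose h e v := A e v (+) lt e.1 v (+) lt e.2 v.
have E e : \big[addb/false]_(f <- steps (y :: t)) edge_parity e f =
    (h e y (+) h e (last y t)) (+)
    (walk_incidence (y :: t) e.1 (+) walk_incidence (y :: t) e.2).
  rewrite -(steps_telescope (h e)) /walk_incidence -!big_split /=.
  apply: eq_bigr => f _; rewrite /edge_parity /h.
  by do 4!case: (lt _ _); do 4!case: (A _ _).
rewrite /walk_parity (eq_bigr _ (fun e _ => E e)) big_split steps_telescope /h /=.
pose k v u := lt u v.
have -> : \big[addb/false]_(e <- steps (x :: s))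
    (A e y (+) lt e.1 y (+) lt e.2 y (+) (A e (last y t) (+) lt e.1 (last y t) (+) lt e.2 (last y
        t)))
  = walk_incidence (x :: s) y (+) (k y x (+) k y (last x s)) (+)
    (walk_incidence (x :: s) (last y t) (+) (k (last y t) x (+) k (last y t) (last x s))).
  rewrite -!steps_telescope /walk_incidence -!big_split /=.
  by apply: eq_bigr => e _; rewrite /k !addbA.
rewrite /k; do 4!case: (lt _ _); do 4!case: (walk_incidence _ _); by [].
Qed.

(** The boolean [ring] works with [xorb]; sums and negations are rewritten into it. *)
Let addbE (a b : bool) : a (+) b = xorb a b. Proof. by case: a. Qed.

Let negbE (a : bool) : ~~ a = xorb true a. Proof. by case: a. Qed.

Lemma has_big_addb (T : Type) (f : T -> bool) (s : seq T) :
  \big[addb/false]_(p <- s) f p -> has f s.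
Proof. by elim: s => [|p s IH]; rewrite ?big_nil ?big_cons //=; case: (f p). Qed.

(* The incidence terms cancel since, in K33, exactly two edges at a vertex [v]
   are independent of an edge avoiding [v]; only the three comparisons between
   the leaves remain. *)
Lemma K33_parity (w00 w01 w02 w10 w11 w12 w20 w21 w22 : seq V) (h0 h1 h2 l0 l1 l2 : V) :
  l0 != l1 -> l0 != l2 -> l1 != l2 ->
  (forall u v, u != v -> lt u v = ~~ lt v u) ->
  all (fun p : seq V * (V * V) => if p.1 is x :: s then (x == p.2.1)
      && (last x s == p.2.2) else false)
    [:: (w00, (h0, l0)); (w01, (h0, l1)); (w02, (h0, l2));
        (w10, (h1, l0)); (w11, (h1, l1)); (w12, (h1, l2));
        (w20, (h2, l0)); (w21, (h2, l1)); (w22, (h2, l2))] ->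
  has (fun p => walk_parity p.1 p.2)
    [:: (w00, w11); (w00, w12); (w01, w10); (w01, w12); (w02, w10); (w02, w11);
        (w00, w21); (w00, w22); (w01, w20); (w01, w22); (w02, w20); (w02, w21);
        (w10, w21); (w10, w22); (w11, w20); (w11, w22); (w12, w20); (w12, w21)].
Proof.
move=> l01 l02 l12 asym ends; apply: has_big_addb; move: ends.
rewrite !big_cons big_nil /=.
case: w00 => [|? w00]; first by rewrite /= ?andbF.
case: w01 => [|? w01]; first by rewrite /= ?andbF.
case: w02 => [|? w02]; first by rewrite /= ?andbF.
case: w10 => [|? w10]; first by rewrite /= ?andbF.
case: w11 => [|? w11]; first by rewrite /= ?andbF.
case: w12 => [|? w12]; first by rewrite /= ?andbF.
case: w20 => [|? w20]; first by rewrite /= ?andbF.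
case: w21 => [|? w21]; first by rewrite /= ?andbF.
case: w22 => [|? w22]; first by rewrite /= ?andbF.
move=> ends; rewrite !walk_parityE.
do 9!(case/andP: ends => /andP[/eqP-> /eqP->] ends).
(* Each pair of leaves is compared three times in each order, which contributes 1; the three pairs
   of leaves together give 1. *)
rewrite (asym l1 l0) 1?eq_sym // (asym l2 l0) 1?eq_sym // (asym l2 l1) 1?eq_sym //.
rewrite /is_true !addbE !negbE.
do 3!(set B := lt l0 _; move: B); do !(set B := lt _ _; move: B).
do !(set B := walk_incidence _ _; move: B).
intros; ring.
Qed.

End WalkParity.

(** * Crossing pairs of edges in a drawing *)

Section EdgeCrossings.
Variables (G : graph) (D : drawing G).
Implicit Types e f : gV G * gV G.

(** Walks traverse edges in both directions, whereas the arcs of a drawing are indexed by the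
    direction in which [dedge] holds. *)
Definition edge_code e := if (enum_rank e.1 < enum_rank e.2)%N then e else (e.2, e.1).

Lemma edge_codeC u v : edge_code (u, v) = edge_code (v, u).
Proof.
rewrite /edge_code /=; case: ltngtP => // /val_inj/enum_rank_inj -> //.
Qed.

Lemma edge_code_dedge u v : gE u v -> dedge (edge_code (u, v)).
Proof.
move=> uv; rewrite /dedge /edge_code /=; case: ltngtP => /= [|vu|/val_inj/enum_rank_inj E].
- by rewrite uv.
- by rewrite gE_sym uv.
- by rewrite E gE_irr in uv.
Qed.

(** The lower bounds count crossing pairs of edges; a pair that meets several times is recorded
    once. *)
Definition cross e f : bool :=
  (edge_code e != edge_code f) && `[< exists z, crossings D (edge_code e) (edge_code f) z >].

Lemma cross_revl u v f : cross (u, v) f = cross (v, u) f.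
Proof. by rewrite /cross edge_codeC. Qed.

Lemma crossC e f : cross e f = cross f e.
Proof.
rewrite /cross eq_sym; congr andb; apply/asbool_equiv_eq.
by split=> -[z [s [t [? ? ? ?]]]]; exists z, t, s.
Qed.

Definition cross_walks (w w' : seq (gV G)) : nat :=
  \sum_(e <- steps w) \sum_(f <- steps w') cross e f.

(** A crossing pair has a nonempty list of points, so it contributes at least 1 to the count of the
    drawing. Both sides run over ordered pairs, hence the doubling. *)
Lemma sum_cross_le (T : Type) (l : seq T) (emb : T -> gV G * gV G) m :
  uniq [seq edge_code (emb x) | x <- l] -> all (fun x => gE (emb x).1 (emb x).2) l ->
  drawing_crossings D m ->
  \sum_(x <- l) \sum_(y <- l) cross (emb x) (emb y) <= m.*2.
Proof.
move=> U E [c [cP <-]]; pose F e f : nat := cross e f.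
have Fcode e f : F (edge_code e) (edge_code f) = F e f.
  suff idem e' : edge_code (edge_code e') = edge_code e' by rewrite /F /cross !idem.
  by rewrite {2}/edge_code; case: ifP => // _; rewrite -edge_codeC -surjective_pairing.
have -> : \sum_(x <- l) \sum_(y <- l) F (emb x) (emb y) =
    \sum_(e <- [seq edge_code (emb x) | x <- l]) \sum_(f <- [seq edge_code (emb x) | x <- l]) F e f.
  by rewrite big_map; apply: eq_bigr => x _; rewrite big_map; apply: eq_bigr => y _; rewrite Fcode.
set s := map _ _ in U *.
have sd e : e \in s -> dedge e.
  move=> es; have : all (@dedge G) s; last by move/allP; apply.
  rewrite all_map; apply: sub_all E => x /=; rewrite [emb x]surjective_pairing.
  exact: edge_code_dedge.
have sub (g : gV G * gV G -> nat) : \sum_(e <- s) g e <= \sum_(e | dedge e) g e.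
  rewrite big_uniq //= [leqRHS]big_mkcond [leqLHS]big_mkcond; apply: leq_sum => e _.
  by case: ifP => // /sd ->.
apply: leq_trans (leq_trans (sub _) _); first by apply: leq_sum => e _; exact: sub.
apply: leq_sum => e de; rewrite [leqRHS]big_mkcond [leqLHS]big_mkcond.
apply: leq_sum => f _; case df: (dedge f) => //=; rewrite /F /cross.
have code g : dedge g -> edge_code g = g by rewrite /edge_code => /andP[_ ->].
rewrite !code // eq_sym; case: eqVneq => //= fe.
case: asboolP => // -[z /(cP e f de df _).2 zc]; rewrite eq_sym in fe.
by have := zc fe; case: (c e f).
Qed.

Lemma cross_walks_parity (A : gV G * gV G -> gV G -> bool) lt w w' :
  (forall e f, gE e.1 e.2 -> gE f.1 f.2 -> independent e f ->
     cross e f = false -> edge_parity A lt e f = false) ->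
  sorted (@gE G) w -> sorted (@gE G) w' -> all (fun v => v \notin w') w ->
  cross_walks w w' = 0 -> walk_parity A lt w w' = false.
Proof.
move=> H sw sw' dis.
have step_in u v (s : seq (gV G)) : sorted (@gE G) s -> (u, v) \in steps s ->
    [/\ gE u v, u \in s & v \in s].
  elim: s => [|x [|y s] IH] //= /andP[xy ys]; rewrite inE => /predU1P[[-> ->]|uv].
    by rewrite !inE !eqxx orbT.
  by have [? us vs] := IH ys uv; split=> //; rewrite inE ?us ?vs orbT.
move=> Z; rewrite /walk_parity big_seq; apply: big1 => -[u v] uvw.
rewrite big_seq; apply: big1 => -[x y] xyw.
have [uv uw vw] := step_in _ _ _ sw uvw; have [xy xw yw] := step_in _ _ _ sw' xyw.
have ne a b : a \in w -> b \in w' -> a != b.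
  by move=> aw bw; apply: contraTneq bw => <-; exact: (allP dis).
apply: H => //=; first by rewrite /independent /= !ne.
move: Z; rewrite /cross_walks (big_rem _ uvw) /= (big_rem _ xyw) /=.
by case: (cross _ _).
Qed.

(** Were all 18 sums zero, each walk parity in [K33_parity] would vanish. Disjointness is asked
    exactly of the walks that stand for independent edges of K33; walks with a common end may
    overlap. *)
Lemma K33_cross (w00 w01 w02 w10 w11 w12 w20 w21 w22 : seq (gV G)) h0 h1 h2 l0 l1 l2 :
  [&& l0 != l1, l0 != l2 & l1 != l2] ->
  all (fun p : seq (gV G) * (gV G * gV G) => sorted (@gE G) p.1 &&
     if p.1 is x :: s then (x == p.2.1) && (last x s == p.2.2) else false)
    [:: (w00, (h0, l0)); (w01, (h0, l1)); (w02, (h0, l2));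
        (w10, (h1, l0)); (w11, (h1, l1)); (w12, (h1, l2));
        (w20, (h2, l0)); (w21, (h2, l1)); (w22, (h2, l2))] ->
  let pairs := [:: (w00, w11); (w00, w12); (w01, w10); (w01, w12); (w02, w10); (w02, w11);
        (w00, w21); (w00, w22); (w01, w20); (w01, w22); (w02, w20); (w02, w21);
        (w10, w21); (w10, w22); (w11, w20); (w11, w22); (w12, w20); (w12, w21)] in
  all (fun p => all (fun v => v \notin p.2) p.1) pairs ->
  0 < \sum_(p <- pairs) cross_walks p.1 p.2.
Proof.
move=> /and3P[l01 l02 l12] ends pairs dis.
have [A0 [lt [asym AP]]] := drawing_parity D; pose A e v := A0 (edge_code e) v.
have : has (fun p => walk_parity A lt p.1 p.2) pairs.
  by apply: (@K33_parity _ A lt _ _ _ _ _ _ _ _ _ _ _ _ _ _ _ l01 l02 l12 asym);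
      apply: sub_all ends => p /andP[].
case/hasP => p pp; apply: contraTltn; rewrite leqn0 sum_nat_seq_eq0 => /allP/(_ p pp)/= /eqP.
have sorted_pair : sorted (@gE G) p.1 /\ sorted (@gE G) p.2.
  move: ends; rewrite /= => /and5P[/andP[s00 _] /andP[s01 _] /andP[s02 _] /andP[s10 _]].
  case/and5P => /andP[s11 _] /andP[s12 _] /andP[s20 _] /andP[s21 _] /andP[/andP[s22 _] _].
  by move: pp; rewrite !inE; do !(case/orP; first by move/eqP => ->); move/eqP => ->.
move/(@cross_walks_parity A lt) => -> //; try by case: sorted_pair.
  2: exact: (allP dis).
  move=> [u v] [x y] /= uv xy /and4P[/= n1 n2 n3 n4] /negbT; rewrite /cross negb_and negbK.
  have E a b : edge_code (a, b) = (a, b) \/ edge_code (a, b) = (b, a).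
    by rewrite /edge_code; case: ifP; [left | right].
  have nc : edge_code (u, v) == edge_code (x, y) = false.
    apply/negbTE/eqP; case: (E u v) => ->; case: (E x y) => -> [c1 c2].
    - by rewrite c1 eqxx in n1.
    - by rewrite c1 eqxx in n2.
    - by rewrite c2 eqxx in n2.
    - by rewrite c1 eqxx in n4.
  rewrite nc /= => /asboolP nex.
  have := AP (edge_code (u, v)) (edge_code (x, y)).
  rewrite !edge_code_dedge // => /(_ isT isT) H.
  rewrite /edge_parity -[RHS]H; first last.
  - by move=> z ez; apply: nex; exists z.
  - by rewrite /independent; case: (E u v) => ->; case: (E x y) => -> /=; rewrite ?n1 ?n2 ?n3 ?n4.
  rewrite /A; case: (E u v) => Ee; case: (E x y) => Ef; rewrite !Ee !Ef /=;
  by do 4!case: (lt _ _); do 4!case: (A0 _ _).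
Qed.
End EdgeCrossings.

(** * Weighted counts of level pairs *)

Section Charging.
Variable N : nat.
Implicit Types (f A B : nat -> nat -> nat).

Definition rect f a b c d := \sum_(a <= j < b) \sum_(c <= k < d) f j k.

Definition weigh A f := \sum_(0 <= j < N) \sum_(0 <= k < N) A j k * f j k.

Lemma weighD A B f : weigh A f + weigh B f = weigh (fun j k => A j k + B j k) f.
Proof.
rewrite /weigh -big_split; apply: eq_bigr => j _ /=.
by rewrite -big_split; apply: eq_bigr => k _; rewrite mulnDl.
Qed.

Lemma weighM w A f : w * weigh A f = weigh (fun j k => w * A j k) f.
Proof.
rewrite /weigh big_distrr; apply: eq_bigr => j _ /=.
by rewrite big_distrr /=; apply: eq_bigr => k _; rewrite mulnA.
Qed.

Lemma weigh_sum a b (A : nat -> nat -> nat -> nat) f :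
  \sum_(a <= i < b) weigh (A i) f = weigh (fun j k => \sum_(a <= i < b) A i j k) f.
Proof.
rewrite /weigh exchange_big; apply: eq_bigr => j _ /=.
by rewrite exchange_big /=; apply: eq_bigr => k _; rewrite big_distrl.
Qed.

Lemma leq_weigh A B f : (forall j k, j < N -> k < N -> A j k <= B j k) ->
  weigh A f <= weigh B f.
Proof.
move=> AB; rewrite /weigh !big_mkord; apply: leq_sum => j _; rewrite !big_mkord.
by apply: leq_sum => k _; apply: leq_mul => //; apply: AB.
Qed.

Lemma sum_nat_widen (g : nat -> nat) a b : b <= N ->
  \sum_(a <= k < b) g k = \sum_(0 <= k < N) (a <= k < b) * g k.
Proof.
move=> bN; rewrite (big_nat_widen _ _ N) // (big_nat_widenl _ 0) // big_mkcond /=.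
by apply: eq_bigr => k _; rewrite andbC; case: (a <= k < b); rewrite ?mul1n.
Qed.

Lemma rectE f a b c d : b <= N -> d <= N ->
  rect f a b c d = weigh (fun j k => (a <= j < b) && (c <= k < d)) f.
Proof.
move=> bN dN; rewrite /rect /weigh (sum_nat_widen _ _ bN); apply: eq_bigr => j _.
rewrite (sum_nat_widen _ _ dN) big_distrr /=; apply: eq_bigr => k _.
by case: (a <= j < b); rewrite ?mul1n ?mul0n.
Qed.

(** Fixing a pair [(j, k)], each family of rectangles used below contains it for at most one index,
    named [i0]. Counting the charges of a pair thus becomes linear arithmetic. *)
Lemma sum_pick i0 a b (p : pred nat) : (forall i, a <= i < b -> p i -> i = i0) ->
  \sum_(a <= i < b) p i = (a <= i0 < b) && p i0.
Proof.
move=> H; case: (boolP ((a <= i0 < b) && p i0)) => [/andP[/andP[ai ib] pi]|np]; last first.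
  rewrite big_nat; apply: big1 => i ir; apply/eqP; rewrite eqb0; apply: contra np => pi.
  by rewrite -(H i ir pi) ir.
rewrite (big_cat_nat ai (ltnW ib)) //= [X in _ + X]big_ltn // pi.
rewrite !big_nat !big1 // => i ir; apply/eqP; rewrite eqb0; apply/negP => pii.
  by have := H i _ pii; lia.
by have := H i _ pii; lia.
Qed.

Lemma weigh0 f : 0 = weigh (fun _ _ => 0) f.
Proof. by symmetry; apply: big1 => j _; apply: big1. Qed.

(** This is weak duality: a combination of local counts is compared with the total coefficient by
    coefficient. *)
Lemma charge a b w (R : nat -> nat) R' (A : nat -> nat -> nat -> nat) A' B f :
  (forall i, a <= i < b -> R i = weigh (A i) f) -> R' = weigh A' f ->
  (forall j k, j < N -> k < N -> \sum_(a <= i < b) A i j k + A' j k <= w * B j k) ->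
  \sum_(a <= i < b) R i + R' <= w * weigh B f.
Proof.
move=> RA -> AB; rewrite (eq_big_nat _ _ RA) weigh_sum weighM weighD.
exact: leq_weigh.
Qed.

End Charging.

(** * Crossings forced by a chain of hubs *)

Section Chain.
(** Hubs are numbered from 0 to [m] along the lines. [SS] counts crossings between spokes of two
    hubs, [SL j k] those between a spoke at hub [j] and a rail following place [k], and [LL] those
    between two rails. *)
Variables (m : nat) (SS SL LL : nat -> nat -> nat).
Hypothesis m_gt0 : 0 < m.
Hypothesis K34 : forall l h r, l < h -> h < r -> r <= m ->
  2 <= rect SS l l.+1 h h.+1 + rect SS h h.+1 r r.+1 + rect SS l l.+1 r r.+1
     + (rect SL h h.+1 l h + rect SL r r.+1 l h)
     + (rect SL h h.+1 h r + rect SL l l.+1 h r)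
     + rect LL l h h r.

Let N := m.+1.
Let total := weigh N (fun j k => j < k) SS + weigh N (fun j k => k < m) SL
  + weigh N (fun j k => j < k < m) LL.

(* The triples [(h - 1, h, m)] and [(0, h, h + 1)], for [0 < h < m], charge no pair more
   than twice. *)
Lemma chain_crossings : 2 * m.-1 <= total.
Proof.
suff : \sum_(1 <= h < m) 4 <= 2 * total by rewrite sum_nat_const_nat; lia.
pose U h := rect SS h.-1 h h h.+1 + rect SS h h.+1 m m.+1 + rect SS h.-1 h m m.+1
     + (rect SS 0 1 h h.+1 + rect SS h h.+1 h.+1 h.+2 + rect SS 0 1 h.+1 h.+2).
pose V h := rect SL h h.+1 h.-1 h + rect SL m m.+1 h.-1 h + rect SL h h.+1 h m + rect SL h.-1 h h m
     + (rect SL h h.+1 0 h + rect SL h.+1 h.+2 0 h + rect SL h h.+1 h h.+1 + rect SL 0 1 h h.+1).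
pose W h := rect LL h.-1 h h m + rect LL 0 h h h.+1.
apply: (@leq_trans (\sum_(1 <= h < m) (U h + V h + W h))).
  rewrite big_nat [leqRHS]big_nat; apply: leq_sum => h /andP[h0 hm].
  have := @K34 h.-1 h m; have := @K34 0 h h.+1; rewrite /U /V /W prednK //; lia.
rewrite 2!big_split /= /total !mulnDr; apply: leq_add; first apply: leq_add.
- rewrite -[leqLHS]addn0; apply: (charge (A' := fun _ _ => 0) (A := fun h j k =>
      ((h.-1 <= j < h) && (h <= k < h.+1)) + ((h <= j < h.+1) && (m <= k < m.+1))
     + ((h.-1 <= j < h) && (m <= k < m.+1))
     + (((0 <= j < 1) && (h <= k < h.+1)) + ((h <= j < h.+1) && (h.+1 <= k < h.+2))
     + ((0 <= j < 1) && (h.+1 <= k < h.+2))))) => [h hm||j k jN kN]; last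
         rewrite addn0; try exact: weigh0.
    by rewrite -!weighD /U !(@rectE N) // /N; lia.
  rewrite !big_split /= (sum_pick (i0 := k)); last lia.
  rewrite (sum_pick (i0 := j)); last lia.
  rewrite (sum_pick (i0 := j.+1)); last lia.
  rewrite (sum_pick (i0 := k)); last lia.
  rewrite (sum_pick (i0 := j)); last lia.
  rewrite (sum_pick (i0 := k.-1)); last lia.
  by clear -jN kN; have [jk|jk] := ltnP j k; lia.
- rewrite -[leqLHS]addn0; apply: (charge (A' := fun _ _ => 0) (A := fun h j k =>
     ((h <= j < h.+1) && (h.-1 <= k < h)) + ((m <= j < m.+1) && (h.-1 <= k < h))
     + ((h <= j < h.+1) && (h <= k < m)) + ((h.-1 <= j < h) && (h <= k < m))
     + (((h <= j < h.+1) && (0 <= k < h)) + ((h.+1 <= j < h.+2) && (0 <= k < h))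
     + ((h <= j < h.+1) && (h <= k < h.+1)) + ((0 <= j < 1) && (h
         <= k < h.+1))))) => [h hm||j k jN kN]; last rewrite addn0; try exact: weigh0.
    by rewrite -!weighD /V !(@rectE N) // /N; lia.
  rewrite !big_split /= (sum_pick (i0 := j)); last lia.
  rewrite (sum_pick (i0 := k.+1)); last lia.
  rewrite (sum_pick (i0 := j)); last lia.
  rewrite (sum_pick (i0 := j.+1)); last lia.
  rewrite (sum_pick (i0 := j)); last lia.
  rewrite (sum_pick (i0 := j.-1)); last lia.
  rewrite (sum_pick (i0 := j)); last lia.
  rewrite (sum_pick (i0 := k)); last lia.
  by clear -jN kN; have [km|km] := ltnP k m; have [jk|jk|jk] := ltngtP j k; lia.
- rewrite -[leqLHS]addn0; apply: (charge (A' := fun _ _ => 0) (A := fun h j k =>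
     ((h.-1 <= j < h) && (h <= k < m)) + ((0 <= j < h) && (h
         <= k < h.+1)))) => [h hm||j k jN kN]; last rewrite addn0; try exact: weigh0.
    by rewrite -!weighD /W !(@rectE N) // /N; lia.
  rewrite !big_split /= (sum_pick (i0 := j.+1)); last lia.
  rewrite (sum_pick (i0 := k)); last lia.
  lia.
Qed.
End Chain.

(* The weights come from an optimal solution of the dual linear program. *)
Section WheelCharges.
Variable n : nat.
Hypothesis n_gt0 : 0 < n.
Let N := n.+1.

Lemma charge_SSa SSa : \sum_(1 <= i < n) (2 * (rect SSa i.-1 i i i.+1 + rect SSa i i.+1 n n.+1
    + rect SSa i.-1 i n n.+1 + rect SSa 0 1 i i.+1 + rect SSa i i.+1 i.+1 i.+2))
    + (2 * rect SSa 0 1 n n.+1) <= 4 * weigh N (fun j k => (j < k)) SSa.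
Proof.
apply: (charge (A := fun i j k => 2 * (((i.-1 <= j < i) && (i <= k < i.+1)) + ((i <= j < i.+1)
    && (n <= k < n.+1)) + ((i.-1 <= j < i) && (n <= k < n.+1)) + ((0 <= j < 1) && (i <= k < i.+1))
    + ((i <= j < i.+1) && (i.+1 <= k < i.+2)))) (A' := fun j k => 2 * ((0 <= j < 1) && (n
    <= k < n.+1)))).
- by move=> i ir; rewrite -weighM -!weighD !(@rectE N) // /N; lia.
- by rewrite -!weighD -?weigh0 !(@rectE N) // /N; lia.
move=> j k jN kN; rewrite -big_distrr /= !big_split /=.
rewrite (sum_pick (i0 := k)); last lia.
rewrite (sum_pick (i0 := j)); last lia.
rewrite (sum_pick (i0 := j.+1)); last lia.
rewrite (sum_pick (i0 := k)); last lia.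
rewrite (sum_pick (i0 := j)); last lia.
by rewrite /N in jN kN; lia.
Qed.

Lemma charge_SSo SSo : \sum_(1 <= i < n) (2 * (rect SSo i.-1 i i i.+1 + rect SSo i i.+1 n n.+1
    + rect SSo i.-1 i n n.+1 + rect SSo 0 1 i.+1 i.+2))
    + 0 <= 4 * weigh N (fun j k => (j < k)) SSo.
Proof.
apply: (charge (A := fun i j k => 2 * (((i.-1 <= j < i) && (i <= k < i.+1)) + ((i <= j < i.+1)
    && (n <= k < n.+1)) + ((i.-1 <= j < i) && (n <= k < n.+1)) + ((0 <= j < 1) && (i.+1
    <= k < i.+2)))) (A' := fun j k => 0)).
- by move=> i ir; rewrite -weighM -!weighD !(@rectE N) // /N; lia.
- by rewrite -weigh0.
move=> j k jN kN; rewrite -big_distrr /= !big_split /=.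
rewrite (sum_pick (i0 := k)); last lia.
rewrite (sum_pick (i0 := j)); last lia.
rewrite (sum_pick (i0 := j.+1)); last lia.
rewrite (sum_pick (i0 := k.-1)); last lia.
by rewrite /N in jN kN; lia.
Qed.

Lemma charge_SLa SLa : \sum_(1 <= i < n) (2 * (rect SLa i i.+1 i.-1 i + rect SLa n n.+1 i.-1 i
    + rect SLa i i.+1 i n + rect SLa i.-1 i i n + rect SLa i i.+1 0 i + rect SLa i i.+1 i i.+1))
    + (2 * rect SLa n n.+1 0 n + 1 * rect SLa 0 1 0 1) <= 4 * weigh N (fun j k => (k < n)) SLa.
Proof.
apply: (charge (A := fun i j k => 2 * (((i <= j < i.+1) && (i.-1 <= k < i)) + ((n <= j < n.+1)
    && (i.-1 <= k < i)) + ((i <= j < i.+1) && (i <= k < n)) + ((i.-1 <= j < i) && (i <= k < n))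
    + ((i <= j < i.+1) && (0 <= k < i)) + ((i <= j < i.+1) && (i <= k < i.+1))))
    (A' := fun j k => 2 * ((n <= j < n.+1) && (0 <= k < n)) + 1 * ((0 <= j < 1) && (0 <= k < 1)))).
- by move=> i ir; rewrite -weighM -!weighD !(@rectE N) // /N; lia.
- by rewrite -!weighD -?weigh0 !(@rectE N) // /N; lia.
move=> j k jN kN; rewrite -big_distrr /= !big_split /=.
rewrite (sum_pick (i0 := j)); last lia.
rewrite (sum_pick (i0 := k.+1)); last lia.
rewrite (sum_pick (i0 := j)); last lia.
rewrite (sum_pick (i0 := j.+1)); last lia.
rewrite (sum_pick (i0 := j)); last lia.
rewrite (sum_pick (i0 := j)); last lia.
by rewrite /N in jN kN; lia.
Qed.

Lemma charge_SLo SLo : \sum_(1 <= i < n) (2 * (rect SLo i i.+1 i.-1 i + rect SLo n n.+1 i.-1 i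
    + rect SLo i i.+1 i n + rect SLo i.-1 i i n + rect SLo i.+1 i.+2 0 i + rect SLo 0 1 i i.+1))
    + 0 <= 4 * weigh N (fun j k => (k < n)) SLo.
Proof.
apply: (charge (A := fun i j k => 2 * (((i <= j < i.+1) && (i.-1 <= k < i)) + ((n <= j < n.+1)
    && (i.-1 <= k < i)) + ((i <= j < i.+1) && (i <= k < n)) + ((i.-1 <= j < i) && (i <= k < n))
    + ((i.+1 <= j < i.+2) && (0 <= k < i)) + ((0 <= j < 1) && (i <= k < i.+1))))
    (A' := fun j k => 0)).
- by move=> i ir; rewrite -weighM -!weighD !(@rectE N) // /N; lia.
- by rewrite -weigh0.
move=> j k jN kN; rewrite -big_distrr /= !big_split /=.
rewrite (sum_pick (i0 := j)); last lia.
rewrite (sum_pick (i0 := k.+1)); last lia.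
rewrite (sum_pick (i0 := j)); last lia.
rewrite (sum_pick (i0 := j.+1)); last lia.
rewrite (sum_pick (i0 := j.-1)); last lia.
rewrite (sum_pick (i0 := k)); last lia.
by rewrite /N in jN kN; lia.
Qed.

Lemma charge_LLa LLa : \sum_(1 <= i < n) (2 * (rect LLa i.-1 i i n))
    + 0 <= 4 * weigh N (fun j k => (j < k < n)) LLa.
Proof.
apply: (charge (A := fun i j k => 2 * (((i.-1 <= j < i) && (i <= k < n)))) (A' := fun j k => 0)).
- by move=> i ir; rewrite -weighM !(@rectE N) // /N; lia.
- by rewrite -weigh0.
move=> j k jN kN; rewrite -big_distrr /=.
rewrite (sum_pick (i0 := j.+1)); last lia.
by rewrite /N in jN kN; lia.
Qed.

Lemma charge_LLo LLo : \sum_(1 <= i < n) (2 * (rect LLo i.-1 i i n + rect LLo 0 i i i.+1))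
    + 0 <= 4 * weigh N (fun j k => (j < k < n)) LLo.
Proof.
apply: (charge (A := fun i j k => 2 * (((i.-1 <= j < i) && (i <= k < n)) + ((0 <= j < i) && (i
    <= k < i.+1)))) (A' := fun j k => 0)).
- by move=> i ir; rewrite -weighM -!weighD !(@rectE N) // /N; lia.
- by rewrite -weigh0.
move=> j k jN kN; rewrite -big_distrr /= !big_split /=.
rewrite (sum_pick (i0 := j.+1)); last lia.
rewrite (sum_pick (i0 := k)); last lia.
by rewrite /N in jN kN; lia.
Qed.

Lemma charge_ZS ZS : \sum_(1 <= i < n) (2 * (rect ZS 0 i i.+1 i.+2 + rect ZS i i.+1 0 1))
    + 0 <= 4 * weigh N (fun j k => (j < n)) ZS.
Proof.
apply: (charge (A := fun i j k => 2 * (((0 <= j < i) && (i.+1 <= k < i.+2)) + ((i <= j < i.+1)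
    && (0 <= k < 1)))) (A' := fun j k => 0)).
- by move=> i ir; rewrite -weighM -!weighD !(@rectE N) // /N; lia.
- by rewrite -weigh0.
move=> j k jN kN; rewrite -big_distrr /= !big_split /=.
rewrite (sum_pick (i0 := k.-1)); last lia.
rewrite (sum_pick (i0 := j)); last lia.
by rewrite /N in jN kN; lia.
Qed.

Lemma charge_ZL ZL : \sum_(1 <= i < n) (2 * (rect ZL 0 i i i.+1 + rect ZL i i.+1 0 i))
    + 0 <= 4 * weigh N (fun j k => ((j < n) && (k < n))) ZL.
Proof.
apply: (charge (A := fun i j k => 2 * (((0 <= j < i) && (i <= k < i.+1)) + ((i <= j < i.+1) && (0
    <= k < i)))) (A' := fun j k => 0)).
- by move=> i ir; rewrite -weighM -!weighD !(@rectE N) // /N; lia.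
- by rewrite -weigh0.
move=> j k jN kN; rewrite -big_distrr /= !big_split /=.
rewrite (sum_pick (i0 := k)); last lia.
rewrite (sum_pick (i0 := j)); last lia.
by rewrite /N in jN kN; lia.
Qed.

Lemma charge_RZ RZ : \sum_(1 <= i < n) (2 * (rect RZ i i.+1 0 i + rect RZ i i.+1 i i.+1
    + rect RZ i i.+1 0 i.+1))
    + (4 * rect RZ n n.+1 0 n + 1 * rect RZ 0 1 0 1) <= 4 * weigh N (fun j k => (k < n)) RZ.
Proof.
apply: (charge (A := fun i j k => 2 * (((i <= j < i.+1) && (0 <= k < i)) + ((i <= j < i.+1) && (i
    <= k < i.+1)) + ((i <= j < i.+1) && (0 <= k < i.+1)))) (A' := fun j k => 4 * ((n <= j < n.+1)
    && (0 <= k < n)) + 1 * ((0 <= j < 1) && (0 <= k < 1)))).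
- by move=> i ir; rewrite -weighM -!weighD !(@rectE N) // /N; lia.
- by rewrite -!weighD -?weigh0 !(@rectE N) // /N; lia.
move=> j k jN kN; rewrite -big_distrr /= !big_split /=.
rewrite (sum_pick (i0 := j)); last lia.
rewrite (sum_pick (i0 := j)); last lia.
rewrite (sum_pick (i0 := j)); last lia.
by rewrite /N in jN kN; lia.
Qed.

End WheelCharges.
(* In the names below S stands for spokes at a hub, L for the rails along the four lines,
   Z for the rails along the hub line and R for rims; the suffixes a and o restrict to
   pairs of adjacent and of opposite lines. *)
Section WheelChain.
Variables (n : nat) (SSa SSo SLa SLo LLa LLo ZS ZL RZ : nat -> nat -> nat).
Variables (RS RL RR : nat -> nat) (RR01 : nat).
Hypothesis n_gt0 : 0 < n.

(** The hub copies involved lie at levels [i - 1, i, n] in [K_star], [0, i] in [K_left], [i, i + 1]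
    in [K_right] and [0, i, i + 1] in [K_middle]; the last three also use the rim of level [i].
    [K_first] uses the rim of level 0 and a part of level 1. *)
Hypothesis K_star : forall i, 0 < i < n ->
  4 <= 2 * (rect SSa i.-1 i i i.+1 + rect SSa i i.+1 n n.+1 + rect SSa i.-1 i n n.+1)
     + 2 * (rect SSo i.-1 i i i.+1 + rect SSo i i.+1 n n.+1 + rect SSo i.-1 i n n.+1)
     + 2 * (rect SLa i i.+1 i.-1 i + rect SLa n n.+1 i.-1 i + rect SLa i i.+1 i n
         + rect SLa i.-1 i i n)
     + 2 * (rect SLo i i.+1 i.-1 i + rect SLo n n.+1 i.-1 i + rect SLo i i.+1 i n
         + rect SLo i.-1 i i n)
     + 2 * rect LLa i.-1 i i n + 2 * rect LLo i.-1 i i n.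
Hypothesis K_left : forall i, 0 < i <= n ->
  2 <= rect SSa 0 1 i i.+1 + rect SLa i i.+1 0 i + 2 * rect RZ i i.+1 0 i
     + RS i + RL i + 2 * RR i.
Hypothesis K_right : forall i, 0 < i < n ->
  2 <= rect SSa i i.+1 i.+1 i.+2 + rect SLa i i.+1 i i.+1 + 2 * rect RZ i i.+1 i i.+1
     + RS i + RL i + 2 * RR i.
Hypothesis K_middle : forall i, 0 < i < n ->
  4 <= rect SSa 0 1 i i.+1 + rect SSa i i.+1 i.+1 i.+2
     + (rect SLa i i.+1 0 i + rect SLa i i.+1 i i.+1)
     + 2 * rect SSo 0 1 i.+1 i.+2 + 2 * (rect SLo i.+1 i.+2 0 i + rect SLo 0 1 i i.+1)
     + 2 * rect LLo 0 i i i.+1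
     + 2 * (rect ZS 0 i i.+1 i.+2 + rect ZS i i.+1 0 1)
     + 2 * (rect ZL 0 i i i.+1 + rect ZL i i.+1 0 i)
     + 2 * rect RZ i i.+1 0 i.+1 + RS i + RL i.
Hypothesis K_first :
  1 <= rect SLa 0 1 0 1 + rect RZ 0 1 0 1 + RS 0 + RS 1 + RL 0 + RR 0 + RR01.

Let N := n.+1.
Let total := weigh N (fun j k => j < k) SSa + weigh N (fun j k => j < k) SSo
  + weigh N (fun j k => k < n) SLa + weigh N (fun j k => k < n) SLo
  + weigh N (fun j k => j < k < n) LLa + weigh N (fun j k => j < k < n) LLo
  + weigh N (fun j k => j < n) ZS + weigh N (fun j k => (j < n) && (k < n)) ZL
  + weigh N (fun j k => k < n) RZ
  + \sum_(0 <= i < N) RS i + \sum_(0 <= i < N) RL i + \sum_(0 <= i < N) RR i + RR01.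

(** For each [i] with [0 < i < n] the four families contribute 4, 2, 4 and 2; [K_left] at [n], taken
    twice, adds 4 and [K_first] adds 1. No term of [total] is charged more than four times, so four
    times the total is at least [12 * n - 7 = 4 * (3 * n - 2) + 1], and the last 1 forces
    [3 * n - 1]. *)
Lemma wheel_crossings : (3 * n).-1 <= total.
Proof.
pose cSSa i := 2 * (rect SSa i.-1 i i i.+1 + rect SSa i i.+1 n n.+1 + rect SSa i.-1 i n n.+1
    + rect SSa 0 1 i i.+1 + rect SSa i i.+1 i.+1 i.+2).
pose cSSo i := 2 * (rect SSo i.-1 i i i.+1 + rect SSo i i.+1 n n.+1 + rect SSo i.-1 i n n.+1
    + rect SSo 0 1 i.+1 i.+2).
pose cSLa i := 2 * (rect SLa i i.+1 i.-1 i + rect SLa n n.+1 i.-1 i + rect SLa i i.+1 i n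
    + rect SLa i.-1 i i n + rect SLa i i.+1 0 i + rect SLa i i.+1 i i.+1).
pose cSLo i := 2 * (rect SLo i i.+1 i.-1 i + rect SLo n n.+1 i.-1 i + rect SLo i i.+1 i n
    + rect SLo i.-1 i i n + rect SLo i.+1 i.+2 0 i + rect SLo 0 1 i i.+1).
pose cLLa i := 2 * (rect LLa i.-1 i i n).
pose cLLo i := 2 * (rect LLo i.-1 i i n + rect LLo 0 i i i.+1).
pose cZS i := 2 * (rect ZS 0 i i.+1 i.+2 + rect ZS i i.+1 0 1).
pose cZL i := 2 * (rect ZL 0 i i i.+1 + rect ZL i i.+1 0 i).
pose cRZ i := 2 * (rect RZ i i.+1 0 i + rect RZ i i.+1 i i.+1 + rect RZ i i.+1 0 i.+1).
have sum_le : \sum_(1 <= i < n) 12 <= \sum_(1 <= i < n) cSSa i + \sum_(1 <= i < n) cSSo i +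
    \sum_(1 <= i < n) cSLa i + \sum_(1 <= i < n) cSLo i + \sum_(1 <= i < n) cLLa i + \sum_(1
    <= i < n) cLLo i + \sum_(1 <= i < n) cZS i + \sum_(1 <= i < n) cZL i + \sum_(1 <= i < n) cRZ i
    + 3 * (\sum_(1 <= i < n) RS i) + 3 * (\sum_(1 <= i < n) RL i) + 4 * (\sum_(1 <= i < n) RR i).
  rewrite !big_distrr -!big_split big_nat [leqRHS]big_nat; apply: leq_sum => i ir /=.
  have left_i : 0 < i <= n by lia.
  apply: leq_trans (leq_add (leq_add (K_star ir) (K_right ir)) (leq_add (K_middle ir) (K_left
      left_i))) _.
  rewrite /cSSa /cSSo /cSLa /cSLo /cLLa /cLLo /cZS /cZL /cRZ.
  by rewrite leq_eqVlt; apply/orP; left; apply/eqP; ring.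
have := K_first; have := K_left (i := n); rewrite n_gt0 leqnn => /(_ isT).
have := charge_SSa n_gt0 SSa; rewrite -[\sum_(_ <= _ < _) _]/(\sum_(1 <= i < n) cSSa i).
have := charge_SSo n_gt0 SSo; rewrite -[\sum_(_ <= _ < _) _]/(\sum_(1 <= i < n) cSSo i).
have := charge_SLa n_gt0 SLa; rewrite -[\sum_(_ <= _ < _) _]/(\sum_(1 <= i < n) cSLa i).
have := charge_SLo n_gt0 SLo; rewrite -[\sum_(_ <= _ < _) _]/(\sum_(1 <= i < n) cSLo i).
have := charge_LLa n_gt0 LLa; rewrite -[\sum_(_ <= _ < _) _]/(\sum_(1 <= i < n) cLLa i).
have := charge_LLo n_gt0 LLo; rewrite -[\sum_(_ <= _ < _) _]/(\sum_(1 <= i < n) cLLo i).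
have := charge_ZS n_gt0 ZS; rewrite -[\sum_(_ <= _ < _) _]/(\sum_(1 <= i < n) cZS i).
have := charge_ZL n_gt0 ZL; rewrite -[\sum_(_ <= _ < _) _]/(\sum_(1 <= i < n) cZL i).
have := charge_RZ n_gt0 RZ; rewrite -[\sum_(_ <= _ < _) _]/(\sum_(1 <= i < n) cRZ i).
have splitN (g : nat -> nat) : \sum_(0 <= i < N) g i = g 0 + \sum_(1 <= i < n) g i + g n.
  by rewrite /N big_nat_recr //= big_ltn.
rewrite /total !splitN -/N.
(* [K_first] charges [RS 1] once more; for [n = 1] this term is [RS n] and lies outside the inner
   sum. *)
have RS1 : RS 1 <= \sum_(1 <= i < n) RS i + RS n.
  by have [n1|n1] := leqP n 1; [have -> : n = 1 by lia | rewrite big_ltn //]; lia.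
move: sum_le RS1 n_gt0; rewrite sum_nat_const_nat.
clearbody cSSa cSSo cSLa cSLo cLLa cLLo cZS cZL cRZ.
move: (rect SSa) (rect SLa) (rect RZ); clear; lia.
Qed.
End WheelChain.

(** * Subdivisions of K33 in prisms *)

Notation vtx := (nat * nat)%type.

Section Prism.
Variables (l6 : seq (nat * nat)) (n : nat).
Hypothesis l6_ok : all (fun e => [&& e.1 < 6, e.2 < 6 & e.1 != e.2]) l6.
Let G := cartesian (list_graph 6 l6) (path_graph n).
Variable D : drawing G.

(** Vertices are written as pairs of naturals, first the vertex of the six-vertex graph and then the
    level, so that walks can be checked by computation and arithmetic. As [inord] sends indices out
    of range to 0, injectivity is restricted to [valid] pairs. *)
Definition vx (p : vtx) : gV G := (inord p.1 : 'I_6, inord p.2 : 'I_n.+1).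
Definition valid (p : vtx) := (p.1 < 6) && (p.2 <= n).
Definition adj (p q : vtx) :=
  (p.2 == q.2) && (((p.1, q.1) \in l6) || ((q.1, p.1) \in l6))
  || (p.1 == q.1) && ((q.2 == p.2.+1) || (p.2 == q.2.+1)).

Lemma vx_inj p q : valid p -> valid q -> vx p = vx q -> p = q.
Proof.
case: p q => [p1 p2] [q1 q2] /andP[/= a b] /andP[/= c d] [] /(congr1 val) + /(congr1 val).
by rewrite /= !inordK ?ltnS // => -> ->.
Qed.

Lemma adj_gE p q : valid p -> valid q -> adj p q -> gE (vx p) (vx q).
Proof.
case: p q => [p1 p2] [q1 q2] /andP[/= p1v p2v] /andP[/= q1v q2v].
rewrite /adj /= /cart_rel /= /list_rel -!val_eqE /= !inordK ?ltnS //.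
case/orP => /andP[/eqP <-].
- by rewrite eqxx => E; rewrite E orbC andbT; case/orP: E => /(allP l6_ok)/and3P[_ _ /=];
    rewrite // eq_sym => ->.
- have mem k : k < n -> (k, k.+1) \in [seq (i, i.+1) | i <- iota 0 n].
    by move=> kn; apply/mapP; exists k => //; rewrite mem_iota.
  case/orP => /eqP E; apply/orP; left; rewrite eqxx E /= mem ?orbT ?andbT; lia.
Qed.

Definition crossn (e f : vtx * vtx) : nat :=
  cross D (vx e.1, vx e.2) (vx f.1, vx f.2).

Lemma crossn_revl u v f : crossn (u, v) f = crossn (v, u) f.
Proof. by rewrite /crossn /= cross_revl. Qed.

Lemma crossnC e f : crossn e f = crossn f e.
Proof. by rewrite /crossn crossC. Qed.

Lemma crossn_revr u v e : crossn e (u, v) = crossn e (v, u).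
Proof. by rewrite crossnC crossn_revl crossnC. Qed.

Definition cwalk (w w' : seq vtx) : nat :=
  \sum_(e <- steps w) \sum_(f <- steps w') crossn e f.

Lemma steps_map (T U : Type) (h : T -> U) (w : seq T) :
  zip (map h w) (behead (map h w)) = [seq (h e.1, h e.2) | e <- zip w (behead w)].
Proof. by elim: w => [|x [|y w] IH] //=; rewrite IH. Qed.

Lemma cwalkE w w' : cwalk w w' = cross_walks D (map vx w) (map vx w').
Proof.
rewrite /cwalk /cross_walks /steps !steps_map !big_map; apply: eq_bigr => e _.
by rewrite big_map.
Qed.

Definition is_walk (p : seq vtx * (vtx * vtx)) :=
  [&& all valid p.1, sorted adj p.1 &
     if p.1 is x :: s then (x == p.2.1) && (last x s == p.2.2) else false].

Definition disjoint (w w' : seq vtx) := all (fun v => v \notin w') w.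

Arguments is_walk : simpl never.
Arguments disjoint : simpl never.
Arguments cwalk : simpl never.

Lemma K33_walks (w00 w01 w02 w10 w11 w12 w20 w21 w22 : seq vtx) h0 h1 h2 l0 l1 l2 :
  [&& l0 != l1, l0 != l2 & l1 != l2] ->
  all is_walk
    [:: (w00, (h0, l0)); (w01, (h0, l1)); (w02, (h0, l2));
        (w10, (h1, l0)); (w11, (h1, l1)); (w12, (h1, l2));
        (w20, (h2, l0)); (w21, (h2, l1)); (w22, (h2, l2))] ->
  let pairs := [:: (w00, w11); (w00, w12); (w01, w10); (w01, w12); (w02, w10); (w02, w11);
        (w00, w21); (w00, w22); (w01, w20); (w01, w22); (w02, w20); (w02, w21);
        (w10, w21); (w10, w22); (w11, w20); (w11, w22); (w12, w20); (w12, w21)] in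
  all (fun p => disjoint p.1 p.2) pairs ->
  0 < \sum_(p <- pairs) cwalk p.1 p.2.
Proof.
move=> lv ok pairs dis.
have wv w a b : is_walk (w, (a, b)) -> [/\ all valid w, valid a & valid b].
  case/and3P => /= aw _; case: w aw => // x s aw /andP[/eqP<- /eqP<-].
  by split=> //; apply: (allP aw); rewrite ?mem_head ?mem_last.
have sorted_vx w : all valid w -> sorted adj w -> sorted (@gE G) (map vx w).
  case: w => //= x s /andP[]; elim: s x => //= y s IH x xv /andP[yv sv] /andP[xy ys].
  by apply/andP; split; [exact: adj_gE | exact: IH].
have trans w a b : is_walk (w, (a, b)) -> sorted (@gE G) (map vx w) &&
    if map vx w is x :: s then (x == vx a) && (last x s == vx b) else false.
  move=> /and3P[/= aw sw ab]; rewrite sorted_vx //=.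
  by case: w aw sw ab => // x s _ _ /andP[/eqP-> /eqP <-]; rewrite /= last_map !eqxx.
move: (ok); rewrite /= => /and5P[a00 a01 a02 a10 /and5P[a11 a12 a20 a21 /andP[a22 _]]].
have [v00 vh0 vl0] := wv _ _ _ a00; have [v01 _ vl1] := wv _ _ _ a01.
have [v02 _ vl2] := wv _ _ _ a02; have [v10 vh1 _] := wv _ _ _ a10.
have [v11 _ _] := wv _ _ _ a11; have [v12 _ _] := wv _ _ _ a12.
have [v20 vh2 _] := wv _ _ _ a20; have [v21 _ _] := wv _ _ _ a21.
have [v22 _ _] := wv _ _ _ a22.
have K := @K33_cross G D (map vx w00) (map vx w01) (map vx w02) (map vx w10) (map vx w11)
  (map vx w12) (map vx w20) (map vx w21) (map vx w22)
  (vx h0) (vx h1) (vx h2) (vx l0) (vx l1) (vx l2).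
cbv zeta in K; rewrite !big_cons !big_nil /= -!cwalkE in K.
rewrite /pairs !big_cons !big_nil; apply: K.
- by case/and3P: lv => n1 n2 n3; apply/and3P; split; [move: n1|move: n2|move: n3];
    apply: contra_neq; apply: vx_inj.
- by rewrite /= !(trans _ _ _ a00, trans _ _ _ a01, trans _ _ _ a02, trans _ _ _ a10,
    trans _ _ _ a11, trans _ _ _ a12, trans _ _ _ a20, trans _ _ _ a21, trans _ _ _ a22).
have dis_vx w w' : all valid w -> all valid w' -> disjoint w w' ->
    all (fun v => v \notin map vx w') (map vx w).
  move=> aw aw' /allP d; rewrite all_map; apply/allP => v vw /=.
  apply/mapP => -[v' vw' /vx_inj E]; move: (d v vw); rewrite E ?vw' //.
    by apply: (allP aw).
  by apply: (allP aw').
move: dis; rewrite /=; do 18!(case/andP => ?); move=> _.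
by rewrite !dis_vx.
Qed.
End Prism.
Arguments is_walk : simpl never.
Arguments disjoint : simpl never.
Arguments cwalk : simpl never.

(** * Stars at three hub copies *)

Section Rays.
Variables (l6 : seq (nat * nat)) (n : nat).
Hypothesis l6_ok : all (fun e => [&& e.1 < 6, e.2 < 6 & e.1 != e.2]) l6.
Variable D : drawing (cartesian (list_graph 6 l6) (path_graph n)).

Definition up t i d : seq vtx := [seq (t, k) | k <- iota i d.+1].
Definition line t i j := if i <= j then up t i (j - i) else rev (up t j (i - j)).
Definition ray h l t i : seq vtx := (h, l) :: line t l i.
Definition spoke h t j : vtx * vtx := ((h, j), (t, j)).
Definition rail t k : vtx * vtx := ((t, k), (t, k.+1)).

Lemma steps_rev (T : Type) (w : seq T) :
  zip (rev w) (behead (rev w)) = rev [seq (e.2, e.1) | e <- zip w (behead w)].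
Proof.
elim: w => [|x [|y w] IH] //; rewrite rev_cons.
have zr (s : seq T) a b : zip (rcons (rcons s a) b) (behead (rcons (rcons s a) b)) =
    rcons (zip (rcons s a) (behead (rcons s a))) (a, b).
  by elim: s => [|c [|d s] IHs] //; move: IHs => /= ->.
by rewrite rev_cons zr -rev_cons IH /= rev_cons.
Qed.

Section Flip.
Variable F : vtx * vtx -> nat.
Hypothesis F_flip : forall u v, F (u, v) = F (v, u).

Lemma sum_steps_rev w : \sum_(e <- steps (rev w)) F e = \sum_(e <- steps w) F e.
Proof.
rewrite /steps steps_rev (perm_big _ (permEl (perm_rev _))) /= big_map.
by apply: eq_bigr => -[u v] _; rewrite F_flip.
Qed.

Lemma sum_steps_up t i d : \sum_(e <- steps (up t i d)) F e = \sum_(i <= k < i + d) F (rail t k).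
Proof.
elim: d i => [|d IH] i; first by rewrite addn0 /up /= !big_geq // big_nil.
rewrite big_ltn ?addnS ?ltnS ?leq_addr // -addSn -IH.
by rewrite /up /= /steps /= big_cons.
Qed.

Lemma sum_steps_line t i j : \sum_(e <- steps (line t i j)) F e =
  \sum_(minn i j <= k < maxn i j) F (rail t k).
Proof.
rewrite /line; case: leqP => ij; rewrite ?sum_steps_rev sum_steps_up subnKC //.
exact: ltnW.
Qed.

Lemma lineE t i j : line t i j = (t, i) :: behead (line t i j).
Proof.
rewrite /line; case: leqP => ij //; rewrite /up -addn1 iotaD map_cat rev_cat /=.
by rewrite subnKC // ltnW.
Qed.

Lemma sum_steps_ray h l t i : \sum_(e <- steps (ray h l t i)) F e =
  F (spoke h t l) + \sum_(minn l i <= k < maxn l i) F (rail t k).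
Proof. by rewrite -sum_steps_line /ray lineE /steps /= big_cons. Qed.
End Flip.

Lemma mem_line v t i j : (v \in line t i j) = (v.1 == t) && (minn i j <= v.2 <= maxn i j).
Proof.
suff mem_up a d : (v \in up t a d) = (v.1 == t) && (a <= v.2 <= a + d).
  by rewrite /line; case: leqP => ij; rewrite ?mem_rev mem_up subnKC // ltnW.
apply/mapP/andP => [[k + ->]|[/eqP <- r]].
  by rewrite mem_iota addnS ltnS.
by exists v.2; [rewrite mem_iota addnS ltnS | rewrite -surjective_pairing].
Qed.

Lemma mem_ray v h l t i : (v \in ray h l t i) =
  (v == (h, l)) || (v.1 == t) && (minn l i <= v.2 <= maxn l i).
Proof. by rewrite inE mem_line. Qed.

Definition linked (h t : nat) := ((h, t) \in l6) || ((t, h) \in l6).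

Lemma linked_lt h t : linked h t -> (h < 6) && (t < 6).
Proof. by case/orP => /(allP l6_ok)/and3P[/= -> ->]. Qed.

Lemma adjC p q : adj l6 p q = adj l6 q p.
Proof.
rewrite /adj [p.2 == _]eq_sym [p.1 == _]eq_sym; congr orb; congr andb; exact: orbC.
Qed.

Lemma is_walk_rev w a b : is_walk l6 n (w, (a, b)) -> is_walk l6 n (rev w, (b, a)).
Proof.
case/and3P => /= aw sw ab; rewrite /is_walk /= all_rev aw rev_sorted.
rewrite (eq_sorted (e' := adj l6)) => [|p q]; last by rewrite adjC.
rewrite sw /=; case: w {aw sw} ab => // x s /andP[/eqP -> /eqP <-].
case: (lastP s) => [|s' y]; first by rewrite /= !eqxx.
by rewrite rev_cons rev_rcons last_rcons /= last_rcons !eqxx.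
Qed.

Lemma is_walk_line t i j : t < 6 -> i <= n -> j <= n ->
  is_walk l6 n (line t i j, ((t, i), (t, j))).
Proof.
move=> t6; suff up_ok a d : a + d <= n -> is_walk l6 n (up t a d, ((t, a), (t, a + d))).
  move=> iN jN; rewrite /line; case: leqP => ij.
    by have := up_ok i (j - i); rewrite subnKC //; apply.
  have := up_ok j (i - j); rewrite subnKC ?(ltnW ij) // => /(_ iN).
  exact: is_walk_rev.
move=> adN; apply/and3P; split => /=.
- apply/andP; split; first by rewrite /valid /= t6; lia.
  by apply/allP => v /mapP[k + ->]; rewrite mem_iota /valid /= t6; lia.
- elim: d a {adN} => //= d IH a; rewrite {1}/adj /= !eqxx orbT /=; exact: IH.
- rewrite eqxx /=; elim: d a {adN} => [|d IH] a /=; first by rewrite addn0.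
  by rewrite -addSnnS.
Qed.

Lemma is_walk_ray h l t i : linked h t -> l <= n -> i <= n ->
  is_walk l6 n (ray h l t i, ((h, l), (t, i))).
Proof.
move=> ht lN iN; have /andP[h6 t6] := linked_lt ht.
have := is_walk_line t6 lN iN; rewrite /is_walk /ray lineE.
case/and3P => /= -> -> /andP[_ ->]; rewrite eqxx /valid /= h6 lN /= andbT.
by rewrite /adj /= eqxx -/(linked h t) ht.
Qed.

Definition crossD := crossn D.

Lemma crossDC e f : crossD e f = crossD f e.
Proof. exact: crossnC. Qed.

Lemma cwalk_sum_flip w' u v :
  \sum_(f <- steps w') crossn D (u, v) f = \sum_(f <- steps w') crossn D (v, u) f.
Proof. by apply: eq_bigr => f _; rewrite crossn_revl. Qed.

Lemma cwalkC w w' : cwalk D w w' = cwalk D w' w.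
Proof.
by rewrite /cwalk exchange_big; apply: eq_bigr => f _; apply: eq_bigr => e _; rewrite crossnC.
Qed.

Lemma cwalk_revl w w' : cwalk D (rev w) w' = cwalk D w w'.
Proof. by apply: sum_steps_rev => u v; apply: cwalk_sum_flip. Qed.

Lemma cwalk_revr w w' : cwalk D w (rev w') = cwalk D w w'.
Proof. by rewrite cwalkC cwalk_revl cwalkC. Qed.

Lemma cwalk_rayl h l t i w : cwalk D (ray h l t i) w =
  \sum_(f <- steps w) crossD (spoke h t l) f
  + \sum_(minn l i <= k < maxn l i) \sum_(f <- steps w) crossD (rail t k) f.
Proof. by apply: sum_steps_ray => u v; apply: cwalk_sum_flip. Qed.

Lemma cwalk_linel t i j w : cwalk D (line t i j) w =
  \sum_(minn i j <= k < maxn i j) \sum_(f <- steps w) crossD (rail t k) f.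
Proof. by apply: sum_steps_line => u v; apply: cwalk_sum_flip. Qed.

Lemma cross_ray e h l t i : \sum_(f <- steps (ray h l t i)) crossD e f =
  crossD e (spoke h t l) + \sum_(minn l i <= k < maxn l i) crossD e (rail t k).
Proof. by apply: sum_steps_ray => u v; apply: crossn_revr. Qed.

Definition ss h h' t u j k := crossD (spoke h t j) (spoke h' u k).
Definition sl h t u j k := crossD (spoke h t j) (rail u k).
Definition ll t u j k := crossD (rail t j) (rail u k).

Lemma rect1 f a b : rect f a a.+1 b b.+1 = f a b.
Proof. by rewrite /rect !big_nat1. Qed.

Lemma rect_row f a c d : rect f a a.+1 c d = \sum_(c <= k < d) f a k.
Proof. by rewrite /rect big_nat1. Qed.

Lemma cwalk_rays h h' l i r t u : l <= i -> i <= r ->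
  cwalk D (ray h l t i) (ray h' r u i) =
  rect (ss h h' t u) l l.+1 r r.+1 + rect (sl h t u) l l.+1 i r
  + rect (sl h' u t) r r.+1 l i + rect (ll t u) l i i r.
Proof.
move=> li ir; rewrite cwalk_rayl cross_ray rect1 !rect_row.
rewrite (minn_idPl li) (maxn_idPr li) (minn_idPr ir) (maxn_idPl ir).
rewrite -!addnA; congr (_ + (_ + _)); rewrite /rect -big_split.
by apply: eq_bigr => k _; rewrite cross_ray (minn_idPr ir) (maxn_idPl ir) /sl crossDC.
Qed.

Definition star_pair h1 h2 h3 l i r t u :=
  cwalk D (ray h1 l t i) (ray h2 i u i) + cwalk D (ray h1 l t i) (ray h3 r u i)
  + cwalk D (ray h2 i t i) (ray h3 r u i).

(** The K33 has the three hub copies on one side and the vertices of level [i] on the lines [a],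
    [b], [c] on the other. Rays from different hub copies to different lines are disjoint, since the
    hubs lie on none of these lines. *)
Lemma star_K33 h1 h2 h3 l i r a b c : l <= i -> i <= r -> r <= n ->
  (h1, l) != (h2, i) -> (h1, l) != (h3, r) -> (h2, i) != (h3, r) ->
  uniq [:: a; b; c] ->
  all (fun h => all (linked h) [:: a; b; c] && (h \notin [:: a; b; c])) [:: h1; h2; h3] ->
  let Q := star_pair h1 h2 h3 l i r in
  0 < Q a b + Q a c + Q b a + Q b c + Q c a + Q c b.
Proof.
move=> li ir rn n12 n13 n23 abc ok; cbv zeta; set Q := star_pair h1 h2 h3 l i r.
have lk h t : h \in [:: h1; h2; h3] -> t \in [:: a; b; c] ->
    linked h t /\ h != t.
  move=> hh tt; have /andP[/allP/(_ t tt) -> hn] := allP ok h hh; split=> //.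
  by apply: contraNneq hn => ->.
have dis h h' j k t u : h \in [:: h1; h2; h3] -> h' \in [:: h1; h2; h3] ->
    t \in [:: a; b; c] -> u \in [:: a; b; c] -> (h, j) != (h', k) -> t != u ->
    disjoint (ray h j t i) (ray h' k u i).
  move=> hh hh' tt uu hjk tu; apply/allP => -[x y]; rewrite !mem_ray !xpair_eqE /=.
  have [_ ] := lk _ _ hh uu; have [_] := lk _ _ hh' tt.
  move: hjk; rewrite xpair_eqE; lia.
have := @K33_walks l6 n l6_ok D (ray h1 l a i) (ray h1 l b i) (ray h1 l c i)
  (ray h2 i a i) (ray h2 i b i) (ray h2 i c i) (ray h3 r a i) (ray h3 r b i) (ray h3 r c i)
  (h1, l) (h2, i) (h3, r) (a, i) (b, i) (c, i).
have [ab ac bc] : [/\ a != b, a != c & b != c].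
  by move: abc; rewrite /= !inE negb_or !andbT => /andP[/andP[-> ->] ->].
rewrite !xpair_eqE !eqxx !andbT ab ac bc => /(_ isT).
have iN := leq_trans ir rn; have lN := leq_trans li iN.
rewrite /= !is_walk_ray //; try by apply: (fun h t hh tt => (lk h t hh tt).1);
    rewrite !inE eqxx ?orbT.
rewrite !dis ?inE ?eqxx ?orbT //; try by rewrite eq_sym.
move=> /(_ isT isT); rewrite !big_cons big_nil /= /Q /star_pair; lia.
Qed.

Definition agg (P : seq (nat * nat)) (F : nat -> nat -> nat -> nat -> nat) j k :=
  \sum_(p <- P) F p.1 p.2 j k.

Lemma rect_agg P F a b c d :
  rect (agg P F) a b c d = \sum_(p <- P) rect (F p.1 p.2) a b c d.
Proof.
rewrite /rect /agg [RHS]exchange_big /=; apply: eq_bigr => j _.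
by rewrite exchange_big.
Qed.

Lemma rect_nilr f a b c : rect f a b c c = 0.
Proof. by apply: big1 => j _; rewrite big_geq. Qed.

Lemma rect_nill f a c d : rect f a a c d = 0.
Proof. by rewrite /rect big_geq. Qed.

Definition flipped (P : seq (nat * nat)) := [seq (p.2, p.1) | p <- P].

Definition star_sum h1 h2 h3 l i r P :=
  rect (agg P (ss h1 h2)) l l.+1 i i.+1 + rect (agg P (ss h2 h3)) i i.+1 r r.+1
  + rect (agg P (ss h1 h3)) l l.+1 r r.+1
  + (rect (agg P (sl h2)) i i.+1 l i + rect (agg P (sl h3)) r r.+1 l i
  + rect (agg P (sl h2)) i i.+1 i r + rect (agg P (sl h1)) l l.+1 i r)
  + rect (agg P ll) l i i r.

(** Exchanging the two lines of each pair permutes [P], and brings the crossings of a rail with a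
    spoke into the order that [sl] uses. *)
Lemma star_sumE h1 h2 h3 l i r P : l <= i -> i <= r -> perm_eq (flipped P) P ->
  \sum_(p <- P) star_pair h1 h2 h3 l i r p.1 p.2 = star_sum h1 h2 h3 l i r P.
Proof.
move=> li ir PP.
have E p : star_pair h1 h2 h3 l i r p.1 p.2 =
    rect (ss h1 h2 p.1 p.2) l l.+1 i i.+1 + rect (ss h2 h3 p.1 p.2) i i.+1 r r.+1
    + rect (ss h1 h3 p.1 p.2) l l.+1 r r.+1
    + (rect (sl h2 p.2 p.1) i i.+1 l i + rect (sl h3 p.2 p.1) r r.+1 l i
    + rect (sl h2 p.1 p.2) i i.+1 i r + rect (sl h1 p.1 p.2) l l.+1 i r)
    + rect (ll p.1 p.2) l i i r.
  rewrite /star_pair !cwalk_rays // !rect_nilr !rect_nill; move: ss sl ll => f g h; clear; lia.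
rewrite (eq_bigr _ (fun p _ => E p)) /star_sum; move: ss sl ll => f g h {E}.
have flip k a b c d : rect (agg P (g k)) a b c d = \sum_(p <- P) rect (g k p.2 p.1) a b c d.
  by rewrite rect_agg -(perm_big _ PP) /= big_map.
by rewrite !big_split (flip h3) [X in _ + (X + _ + _ + _)](flip h2) !rect_agg.
Qed.

Definition adjacent_lines : seq (nat * nat) :=
  [:: (1, 2); (2, 1); (2, 4); (4, 2); (4, 5); (5, 4); (5, 1); (1, 5)].
Definition opposite_lines : seq (nat * nat) := [:: (1, 4); (4, 1); (2, 5); (5, 2)].

(* Each ordered pair of distinct lines survives the omission of two of the four lines. *)
Lemma star_K34 h1 h2 h3 l i r : l <= i -> i <= r -> r <= n ->
  (h1, l) != (h2, i) -> (h1, l) != (h3, r) -> (h2, i) != (h3, r) ->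
  all (fun h => all (linked h) [:: 1; 2; 4; 5] && (h \notin [:: 1; 2; 4; 5])) [:: h1; h2; h3] ->
  2 <= star_sum h1 h2 h3 l i r adjacent_lines + star_sum h1 h2 h3 l i r opposite_lines.
Proof.
move=> li ir rn n12 n13 n23 ok.
rewrite -!star_sumE // /adjacent_lines /opposite_lines !big_cons !big_nil.
have K a b c : uniq [:: a; b; c] -> all (mem [:: 1; 2; 4; 5]) [:: a; b; c] ->
    0 < star_pair h1 h2 h3 l i r a b + star_pair h1 h2 h3 l i r a c
      + star_pair h1 h2 h3 l i r b a + star_pair h1 h2 h3 l i r b c
      + star_pair h1 h2 h3 l i r c a + star_pair h1 h2 h3 l i r c b.
  move=> abc sub; apply: star_K33 => //; apply: sub_all ok => h /andP[/allP lk hn].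
  apply/andP; split; first by apply/allP => t /(allP sub); exact: lk.
  by apply: contra hn => /(allP sub).
have := K 1 2 4 isT isT; have := K 1 2 5 isT isT; have := K 1 4 5 isT isT.
by have := K 2 4 5 isT isT; rewrite /=; lia.
Qed.
End Rays.

(** * Subdivisions of K33 through the rim of a level *)

Definition edges110 : seq (nat * nat) :=
  [:: (0,1); (1,2); (2,3); (3,4); (4,5); (5,0); (0,2); (0,4); (1,5)].

Section Wheel.
Variable n : nat.
Hypothesis n_gt0 : 0 < n.
Variable D : drawing (cartesian (list_graph 6 edges110) (path_graph n)).

Let ok110 : all (fun e => [&& e.1 < 6, e.2 < 6 & e.1 != e.2]) edges110 := isT.

(** The side between 2 and 4 passes through vertex 3, which no spoke reaches, so the five rim
    vertices form a cycle of four sides. *)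
Definition rim i t u : seq vtx :=
  if (t == 2) && (u == 4) || (t == 4) && (u == 2) then [:: (t, i); (3, i); (u, i)]
  else [:: (t, i); (u, i)].

Definition sides := [:: (1, 2); (2, 4); (4, 5); (5, 1)].
Definition side t u := if (t, u) \in sides then (t, u) else (u, t).

Definition rs (p : nat * nat) t i j :=
  \sum_(e <- steps (rim i p.1 p.2)) crossD D e (spoke 0 t j).
Definition rl (p : nat * nat) t i k :=
  \sum_(e <- steps (rim i p.1 p.2)) crossD D e (rail t k).
Definition rr (p q : nat * nat) i j := cwalk D (rim i p.1 p.2) (rim j q.1 q.2).

Lemma rim_rev i t u : rev (rim i t u) = rim i u t.
Proof. by rewrite /rim orbC andbC [(t == 2) && _]andbC; case: ifP. Qed.

Lemma cwalk_side w i t u :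
  cwalk D w (rim i t u) = cwalk D w (rim i (side t u).1 (side t u).2).
Proof. by rewrite /side; case: ifP => //= _; rewrite -rim_rev cwalk_revr. Qed.

Lemma cwalk_rims i j t u t' u' :
  cwalk D (rim i t u) (rim j t' u') = rr (side t u) (side t' u') i j.
Proof. by rewrite cwalk_side cwalkC cwalk_side cwalkC. Qed.

Lemma cwalk_ray_rim l t i j x y : l <= i -> cwalk D (ray 0 l t i) (rim j x y) =
  rs (side x y) t j l + \sum_(l <= k < i) rl (side x y) t j k.
Proof.
move=> li; rewrite cwalk_side cwalkC /cwalk exchange_big.
rewrite (@sum_steps_ray (fun f => \sum_(e <- steps (rim j (side x y).1 (side x y).2)) crossn D e
    f)).
  by rewrite (minn_idPl li) (maxn_idPr li).
by move=> u v; apply: eq_bigr => e _; apply: crossn_revr.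
Qed.

Lemma cwalk_rayr_rim r t i j x y : i <= r -> cwalk D (ray 0 r t i) (rim j x y) =
  rs (side x y) t j r + \sum_(i <= k < r) rl (side x y) t j k.
Proof.
move=> li; rewrite cwalk_side cwalkC /cwalk exchange_big.
rewrite (@sum_steps_ray (fun f => \sum_(e <- steps (rim j (side x y).1 (side x y).2)) crossn D e
    f)).
  by rewrite (minn_idPr li) (maxn_idPl li).
by move=> u v; apply: eq_bigr => e _; apply: crossn_revr.
Qed.

Lemma cwalk_line_rim l r j x y : l <= r -> cwalk D (line 0 l r) (rim j x y) =
  \sum_(l <= k < r) rl (side x y) 0 j k.
Proof.
move=> lr; rewrite cwalk_side cwalkC /cwalk exchange_big.
rewrite (@sum_steps_line (fun f => \sum_(e <- steps (rim j (side x y).1 (side x y).2)) crossn D e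
    f)).
  by rewrite (minn_idPl lr) (maxn_idPr lr).
by move=> u v; apply: eq_bigr => e _; apply: crossn_revr.
Qed.

Lemma is_walk_rim i p : i <= n -> p \in sides ++ flipped sides ->
  is_walk edges110 n (rim i p.1 p.2, ((p.1, i), (p.2, i))).
Proof.
move=> iN; rewrite !inE /is_walk.
by do 7?[case/orP]; move=> /eqP-> /=; rewrite /valid /adj /= iN !eqxx.
Qed.

Definition spoke_lines := [:: 1; 2; 4; 5].

Definition RS i := \sum_(p <- sides) \sum_(t <- spoke_lines) \sum_(0 <= j < n.+1) rs p t i j.
Definition RL i := \sum_(p <- sides) \sum_(t <- spoke_lines) \sum_(0 <= k < n) rl p t i k.
Definition RZ i k := \sum_(p <- sides) rl p 0 i k.
(** Only opposite sides occur: adjacent sides share an end and never stand for independent edges of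
    K33. *)
Definition RR i := rr (1, 2) (4, 5) i i + rr (2, 4) (5, 1) i i.

Lemma sum_two_le (g : nat -> nat) m a b : a < b -> b < m -> g a + g b <= \sum_(0 <= j < m) g j.
Proof.
move=> ab bm; rewrite big_mkord (bigD1 (Ordinal bm)) //= (bigD1 (Ordinal (ltn_trans ab bm))) /=.
  lia.
by rewrite -val_eqE /= neq_ltn ab.
Qed.

Lemma sum_parts_le (g : nat -> nat) m a b c : a <= b -> b <= c -> c <= m ->
  \sum_(a <= j < b) g j + \sum_(b <= j < c) g j <= \sum_(0 <= j < m) g j.
Proof.
move=> ab bc cm; rewrite -big_cat_nat // (sum_nat_widen _ _ cm) [leqRHS]big_nat.
rewrite big_nat; apply: leq_sum => j _; case: (_ <= _ < _); lia.
Qed.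

Lemma RS_ge i l r : l < r -> r <= n ->
  \sum_(p <- sides) \sum_(t <- spoke_lines) (rs p t i l + rs p t i r) <= RS i.
Proof. by move=> lr rn; apply: leq_sum => p _; apply: leq_sum => t _; apply: sum_two_le. Qed.

Lemma RL_ge i l m r : l <= m -> m <= r -> r <= n ->
  \sum_(p <- sides) \sum_(t <- spoke_lines)
    (\sum_(l <= k < m) rl p t i k + \sum_(m <= k < r) rl p t i k) <= RL i.
Proof. by move=> lm mr rn; apply: leq_sum => p _; apply: leq_sum => t _; apply: sum_parts_le. Qed.

Lemma RZ_sum i l r : rect RZ i i.+1 l r = \sum_(p <- sides) \sum_(l <= k < r) rl p 0 i k.
Proof. by rewrite rect_row exchange_big. Qed.

Definition rotations := [:: (1, 2, 4, 5); (2, 4, 5, 1); (4, 5, 1, 2); (5, 1, 2, 4)].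

Definition rim_lines t u :=
  if (t == 2) && (u == 4) || (t == 4) && (u == 2) then [:: t; 3; u] else [:: t; u].

Lemma mem_rim v i t u : (v \in rim i t u) = (v.1 \in rim_lines t u) && (v.2 == i).
Proof.
rewrite /rim /rim_lines; case: v => x y; case: ifP => _; rewrite !inE !xpair_eqE /=;
by rewrite ?andb_orl.
Qed.

Lemma disjointP (w w' : seq vtx) : (forall v, v \in w -> v \in w' -> False) -> disjoint w w'.
Proof. by move=> H; apply/allP => v vw; apply/negP; apply: H. Qed.

Lemma disjointC w w' : disjoint w w' = disjoint w' w.
Proof.
by apply/idP/idP => /allP d; apply: disjointP => v vw vw'; have := d _ vw'; rewrite vw.
Qed.

Lemma disjoint_revl w w' : disjoint (rev w) w' = disjoint w w'.
Proof. by rewrite /disjoint all_rev. Qed.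

Lemma disjoint_revr w w' : disjoint w (rev w') = disjoint w w'.
Proof. by rewrite disjointC disjoint_revl disjointC. Qed.

Lemma disjoint_line_rim l r j t u : 0 \notin rim_lines t u -> disjoint (line 0 l r) (rim j t u).
Proof.
move=> tu; apply: disjointP => v; rewrite mem_line mem_rim => /andP[/eqP -> _].
by rewrite (negPf tu).
Qed.

Lemma disjoint_ray_rim l s i j t u : 0 \notin rim_lines t u -> s \notin rim_lines t u ->
  disjoint (ray 0 l s i) (rim j t u).
Proof.
move=> tu stu; apply: disjointP => -[x y]; rewrite mem_ray mem_rim xpair_eqE /=.
by case/orP => /andP[/eqP -> _]; rewrite ?(negPf tu) ?(negPf stu).
Qed.

Lemma disjoint_rim_ray l s i j t u : 0 \notin rim_lines t u -> s \notin rim_lines t u ->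
  disjoint (rim j t u) (ray 0 l s i).
Proof. by move=> *; rewrite disjointC disjoint_ray_rim. Qed.

Lemma disjoint_rims i t u t' u' : ~~ has (mem (rim_lines t u)) (rim_lines t' u') ->
  disjoint (rim i t u) (rim i t' u').
Proof.
move=> h; apply: disjointP => v; rewrite !mem_rim => /andP[v1 _] /andP[v2 _].
by case/hasP: h; exists v.1.
Qed.

Lemma disjoint_rays l r i t u : l != r -> 0 < t -> 0 < u -> t != u ->
  disjoint (ray 0 l t i) (ray 0 r u i).
Proof.
move=> lr t0 u0 tu; apply: disjointP => -[x y]; rewrite !mem_ray !xpair_eqE /=; lia.
Qed.

Lemma disjoint_line_ray i l r u : minn i l <= i <= maxn i l -> 0 < u ->
   ~~ (minn i l <= r <= maxn i l) -> disjoint (line 0 i l) (ray 0 r u i).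
Proof.
by move=> il u0 nr; apply: disjointP => -[x y]; rewrite mem_line mem_ray xpair_eqE /=; lia.
Qed.

(** The rim of level [i] is a cycle [a, b, c, d]; rays join [b, d] to the hub copy [(0, l)] and
    [a, c] to [(0, r)], and the hub line joins these two. The parts of the K33 are [(0, l), a, c]
    and [(0, r), b, d]. *)
Lemma hub_K33 l i r a b c d : l <= i -> i <= r -> l < r -> r <= n ->
  (a, b, c, d) \in rotations ->
  let w := line 0 l r in
  let x t := ray 0 l t i in let y t := ray 0 r t i in
  0 < cwalk D w (rim i a b) + cwalk D w (rim i a d) + cwalk D w (rim i c b) + cwalk D w (rim i c d)
    + (cwalk D (x b) (y a) + cwalk D (x b) (y c) + cwalk D (x d) (y a) + cwalk D (x d) (y c))
    + (cwalk D (x b) (rim i a d) + cwalk D (x b) (rim i c d)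
       + cwalk D (x d) (rim i a b) + cwalk D (x d) (rim i c b))
    + (cwalk D (y a) (rim i c b) + cwalk D (y a) (rim i c d)
       + cwalk D (y c) (rim i a b) + cwalk D (y c) (rim i a d))
    + (cwalk D (rim i a b) (rim i c d) + cwalk D (rim i a d) (rim i c b)).
Proof.
move=> li ir lr rn rot; cbv zeta.
have iN := leq_trans ir rn; have lN := leq_trans li iN.
have := @K33_walks edges110 n ok110 D (line 0 l r) (ray 0 l b i) (ray 0 l d i)
  (rev (ray 0 r a i)) (rim i a b) (rim i a d) (rev (ray 0 r c i)) (rim i c b) (rim i c d)
  (0, l) (a, i) (c, i) (0, r) (b, i) (d, i).
have W t u : (t, u) \in sides ++ flipped sides -> is_walk edges110 n (rim i t u, ((t, i), (u, i))).
  exact: (@is_walk_rim i (t, u)).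
have nlr : l != r by rewrite neq_ltn lr.
have rays t u : 0 < t -> 0 < u -> t != u -> disjoint (ray 0 l t i) (ray 0 r u i).
  exact: disjoint_rays.
rewrite /= !big_cons big_nil /= !cwalk_revr !cwalk_revl !disjoint_revl !disjoint_revr.
move: rot; rewrite !inE => /or4P[] /eqP[-> -> -> ->];
rewrite !is_walk_rev ?is_walk_ray ?is_walk_line ?W // ?disjoint_rim_ray // ?disjoint_line_rim //
  ?disjoint_ray_rim // ?disjoint_rims // ?rays // !xpair_eqE /= ?andbF => /(_ isT isT isT);
rewrite ![cwalk D (rim _ _ _) (ray _ _ _ _)]cwalkC; lia.
Qed.

(** Here the hub copy of level [i] is itself a branch vertex, joined to the outer two by the hub
    line. The parts are [a, c, (0, i)] and [b, (0, l), (0, r)]. *)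
Lemma middle_K33 l i r a b c d : l < i -> i < r -> r <= n -> (a, b, c, d) \in rotations ->
  let x t := ray 0 l t i in let y t := ray 0 r t i in let s := ray 0 i b i in
  let zx := line 0 i l in let zy := line 0 i r in
  0 < cwalk D (x a) (y c) + cwalk D (x c) (y a)
    + (cwalk D (x a) s + cwalk D (x c) s + cwalk D s (y a) + cwalk D s (y c))
    + (cwalk D zx (y a) + cwalk D zx (y c) + cwalk D zy (x a) + cwalk D zy (x c))
    + (cwalk D (x a) (rim i c b) + cwalk D (x c) (rim i a b)
       + cwalk D (y a) (rim i c b) + cwalk D (y c) (rim i a b))
    + (cwalk D zx (rim i a b) + cwalk D zx (rim i c b)
       + cwalk D zy (rim i a b) + cwalk D zy (rim i c b)).
Proof.
move=> li ir rn rot; cbv zeta.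
have iN := leq_trans (ltnW ir) rn; have lN := leq_trans (ltnW li) iN.
have := @K33_walks edges110 n ok110 D (rim i a b) (rev (ray 0 l a i)) (rev (ray 0 r a i))
  (rim i c b) (rev (ray 0 l c i)) (rev (ray 0 r c i))
  (ray 0 i b i) (line 0 i l) (line 0 i r) (a, i) (c, i) (0, i) (b, i) (0, l) (0, r).
have W t u : (t, u) \in sides ++ flipped sides -> is_walk edges110 n (rim i t u, ((t, i), (u, i))).
  exact: (@is_walk_rim i (t, u)).
have nlr : l != r by rewrite neq_ltn (ltn_trans li ir).
have nil : i != l by rewrite neq_ltn li orbT.
have nir : i != r by rewrite neq_ltn ir.
have nli : l != i by rewrite eq_sym.
have nri : r != i by rewrite eq_sym.
have nrl : r != l by rewrite eq_sym.
have rays t u j k : j != k -> 0 < t -> 0 < u -> t != u ->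
  disjoint (ray 0 j t i) (ray 0 k u i) by move=> *; apply: disjoint_rays.
have zx t : 0 < t -> disjoint (line 0 i l) (ray 0 r t i).
  by move=> t0; apply: disjoint_line_ray => //; lia.
have zy t : 0 < t -> disjoint (line 0 i r) (ray 0 l t i).
  by move=> t0; apply: disjoint_line_ray => //; lia.
have zx' t : 0 < t -> disjoint (ray 0 r t i) (line 0 i l) by rewrite disjointC; apply: zx.
have zy' t : 0 < t -> disjoint (ray 0 l t i) (line 0 i r) by rewrite disjointC; apply: zy.
have zr t u : 0 \notin rim_lines t u -> disjoint (rim i t u) (line 0 i l).
  by rewrite disjointC; apply: disjoint_line_rim.
have zr' t u : 0 \notin rim_lines t u -> disjoint (rim i t u) (line 0 i r).
  by rewrite disjointC; apply: disjoint_line_rim.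
rewrite /= !big_cons big_nil /= !cwalk_revr !cwalk_revl !disjoint_revl !disjoint_revr.
move: rot; rewrite !inE => /or4P[] /eqP[-> -> -> _];
rewrite !is_walk_rev ?is_walk_ray ?is_walk_line ?W // ?disjoint_rim_ray //
  ?disjoint_ray_rim // ?zx // ?zy // ?zx' // ?zy' // ?zr // ?zr' // ?rays //
  !xpair_eqE /= nlr => /(_ isT isT isT);
rewrite ![cwalk D (rim _ _ _) (ray _ _ _ _)]cwalkC ![cwalk D (rim _ _ _) (line _ _ _)]cwalkC;
rewrite ![cwalk D (ray _ _ _ _) (line _ _ _)]cwalkC
   ![cwalk D (ray 0 r _ _) (ray 0 i _ _)]cwalkC ![cwalk D (ray 0 r _ _) (ray 0 l _ _)]cwalkC; lia.
Qed.

(** At level 0 the neighbours of 1 are 0, 2 and 5; each also reaches [(1, 1)] through its copy at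
    level 1, so [(1, 1)] acts as a twin of [(1, 0)]. With [(4, 0)], joined to 2 through 3, these
    form the second part. *)
Lemma first_K33 :
  0 < cwalk D [:: (0, 0); (0, 1); (1, 1)] (rim 0 2 1)
    + cwalk D [:: (0, 0); (0, 1); (1, 1)] (rim 0 2 4)
    + cwalk D [:: (0, 0); (0, 1); (1, 1)] (rim 0 5 1)
    + cwalk D [:: (0, 0); (0, 1); (1, 1)] (rim 0 5 4)
    + (cwalk D (ray 0 0 1 0) [:: (2, 0); (2, 1); (1, 1)]
        + cwalk D (ray 0 0 1 0) [:: (5, 0); (5, 1); (1, 1)]
    + cwalk D (ray 0 0 4 0) [:: (2, 0); (2, 1); (1, 1)]
        + cwalk D (ray 0 0 4 0) [:: (5, 0); (5, 1); (1, 1)])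
    + (cwalk D (ray 0 0 1 0) (rim 0 2 4) + cwalk D (ray 0 0 1 0) (rim 0 5 4)
    + cwalk D (ray 0 0 4 0) (rim 0 2 1) + cwalk D (ray 0 0 4 0) (rim 0 5 1))
    + (cwalk D [:: (2, 0); (2, 1); (1, 1)] (rim 0 5 1)
        + cwalk D [:: (2, 0); (2, 1); (1, 1)] (rim 0 5 4)
    + cwalk D [:: (5, 0); (5, 1); (1, 1)] (rim 0 2 1)
        + cwalk D [:: (5, 0); (5, 1); (1, 1)] (rim 0 2 4))
    + (cwalk D (rim 0 2 1) (rim 0 5 4) + cwalk D (rim 0 2 4) (rim 0 5 1)).
Proof.
have K := @K33_walks edges110 n ok110 D [:: (0, 0); (0, 1); (1, 1)] (ray 0 0 1 0) (ray 0 0 4 0)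
  [:: (2, 0); (2, 1); (1, 1)] (rim 0 2 1) (rim 0 2 4)
  [:: (5, 0); (5, 1); (1, 1)] (rim 0 5 1) (rim 0 5 4) (0, 0) (2, 0) (5, 0) (1, 1) (1, 0) (4, 0).
have W t u : (t, u) \in sides ++ flipped sides -> is_walk edges110 n (rim 0 t u, ((t, 0), (u, 0))).
  exact: (@is_walk_rim 0 (t, u)).
have W1 t : t \in [:: 0; 2; 5] -> is_walk edges110 n ([:: (t, 0); (t, 1); (1, 1)], ((t, 0), (1,
    1))).
  by rewrite !inE /is_walk => /or3P[] /eqP-> /=; rewrite /valid /= n_gt0 /adj /= !eqxx.
apply: leq_trans (K isT _ isT) _.
  by cbn [all]; rewrite !W ?is_walk_ray ?W1.
rewrite !big_cons big_nil; cbn [fst snd].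
rewrite ![cwalk D (rim _ _ _) [:: (5, 0); (5, 1); (1, 1)]]cwalkC; lia.
Qed.
End Wheel.

(** Two rotations are summed, and they exchange the two parts on the rim: each ordered pair of
    adjacent lines occurs once, and each side meets the hub line twice. *)
Lemma hub_arith (W XY : nat -> nat -> nat) (XR YR : nat -> nat -> nat -> nat)
    (C : nat -> nat -> nat -> nat -> nat) :
  (forall t u, W t u = W u t) ->
  (forall s t u, XR s t u = XR s u t) -> (forall s t u, YR s t u = YR s u t) ->
  (forall t u t' u', C t u t' u' = C u t t' u') -> (forall t u t' u', C t u t' u' = C t' u' t u) ->
  (forall a b c d, (a, b, c, d) \in rotations ->
    0 < W a b + W a d + W c b + W c d
    + (XY b a + XY b c + XY d a + XY d c)
    + (XR b a d + XR b c d + XR d a b + XR d c b)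
    + (YR a c b + YR a c d + YR c a b + YR c a d)
    + (C a b c d + C a d c b)) ->
  2 <= \sum_(p <- adjacent_lines) XY p.1 p.2 + 2 * \sum_(p <- sides) W p.1 p.2
    + \sum_(p <- sides) \sum_(t <- spoke_lines) (XR t p.1 p.2 + YR t p.1 p.2)
    + 2 * (C 1 2 4 5 + C 2 4 5 1).
Proof.
move=> Wc Xc Yc Cc Cs K; have := K 1 2 4 5 isT; have := K 2 4 5 1 isT.
rewrite (Wc 1 5) (Wc 4 2) (Wc 2 1) (Wc 5 4) !(Xc _ 1 5) !(Xc _ 4 2) !(Xc _ 2 1) !(Xc _ 5 4).
rewrite !(Yc _ 1 5) !(Yc _ 4 2) !(Yc _ 2 1) !(Yc _ 5 4).
have -> : C 1 5 4 2 = C 2 4 5 1 by rewrite Cs Cc (Cs _ _ 1) (Cc 1) Cs.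
have -> : C 2 1 5 4 = C 1 2 4 5 by rewrite Cc Cs Cc Cs.
rewrite /adjacent_lines /sides /spoke_lines !big_cons !big_nil /=; lia.
Qed.

(** All four rotations are summed. Each ordered pair of opposite lines then occurs twice, and each
    ordered pair of adjacent lines once in [XS] and once in [SY]. *)
Lemma middle_arith (ZX ZY XS SY XY : nat -> nat -> nat) (ZXY ZYX : nat -> nat) (XR YR
    : nat -> nat -> nat -> nat) :
  (forall t u, ZX t u = ZX u t) -> (forall t u, ZY t u = ZY u t) ->
  (forall s t u, XR s t u = XR s u t) -> (forall s t u, YR s t u = YR s u t) ->
  (forall a b c d, (a, b, c, d) \in rotations ->
    0 < XY a c + XY c a + (XS a b + XS c b + SY b a + SY b c)
    + (ZXY a + ZXY c + ZYX a + ZYX c)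
    + (XR a c b + XR c a b + YR a c b + YR c a b)
    + (ZX a b + ZX c b + ZY a b + ZY c b)) ->
  4 <= 2 * \sum_(p <- opposite_lines) XY p.1 p.2
    + \sum_(p <- adjacent_lines) (XS p.1 p.2 + SY p.1 p.2)
    + 2 * \sum_(t <- spoke_lines) (ZXY t + ZYX t)
    + 2 * \sum_(p <- sides) (ZX p.1 p.2 + ZY p.1 p.2)
    + \sum_(p <- sides) \sum_(t <- spoke_lines) (XR t p.1 p.2 + YR t p.1 p.2).
Proof.
move=> Zc Zc' Xc Yc K; have := K 1 2 4 5 isT; have := K 2 4 5 1 isT.
have := K 4 5 1 2 isT; have := K 5 1 2 4 isT.
rewrite (Zc 1 5) (Zc 4 2) (Zc 2 1) (Zc 5 4) !(Xc _ 1 5) !(Xc _ 4 2) !(Xc _ 2 1) !(Xc _ 5 4).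
rewrite (Zc' 1 5) (Zc' 4 2) (Zc' 2 1) (Zc' 5 4).
rewrite !(Yc _ 1 5) !(Yc _ 4 2) !(Yc _ 2 1) !(Yc _ 5 4).
rewrite /adjacent_lines /opposite_lines /sides /spoke_lines !big_cons !big_nil /=; lia.
Qed.

Section WheelCount.
Variable n : nat.
Hypothesis n_gt0 : 0 < n.
Variable D : drawing (cartesian (list_graph 6 edges110) (path_graph n)).

Let SSa := agg adjacent_lines (ss D 0 0).
Let SSo := agg opposite_lines (ss D 0 0).
Let SLa := agg adjacent_lines (sl D 0).
Let SLo := agg opposite_lines (sl D 0).
Let LLa := agg adjacent_lines (ll D).
Let LLo := agg opposite_lines (ll D).
Let zs t k j := crossD D (rail 0 k) (spoke 0 t j).
Let ZS k j := \sum_(t <- spoke_lines) zs t k j.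
Let ZL k j := \sum_(t <- spoke_lines) ll D 0 t k j.

Lemma rect_sum_seq (T : Type) (s : seq T) (F : T -> nat -> nat -> nat) a b c d :
  rect (fun j k => \sum_(x <- s) F x j k) a b c d = \sum_(x <- s) rect (F x) a b c d.
Proof.
rewrite /rect [RHS]exchange_big /=; apply: eq_bigr => j _.
by rewrite exchange_big.
Qed.

Lemma cwalk_rim_swap w i t u : cwalk D w (rim i t u) = cwalk D w (rim i u t).
Proof. by rewrite -rim_rev cwalk_revr. Qed.

Lemma side_id p : p \in sides -> side p.1 p.2 = p.
Proof. by rewrite /side -surjective_pairing => ->. Qed.

Lemma agg_rays P l i r : perm_eq (flipped P) P -> l <= i -> i <= r ->
  \sum_(p <- P) cwalk D (ray 0 l p.1 i) (ray 0 r p.2 i) =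
  rect (agg P (ss D 0 0)) l l.+1 r r.+1 + rect (agg P (sl D 0)) l l.+1 i r
  + rect (agg P (sl D 0)) r r.+1 l i + rect (agg P (ll D)) l i i r.
Proof.
move=> PP li ir; have flip a b c d : rect (agg P (sl D 0)) a b c d =
    \sum_(p <- P) rect (sl D 0 p.2 p.1) a b c d.
  by rewrite rect_agg -(perm_big _ PP) /= big_map.
rewrite [X in _ + X + _]flip !rect_agg -!big_split.
by apply: eq_bigr => p _; rewrite cwalk_rays.
Qed.

(** On one line the rays from levels [l] and [r] use rails on different sides of [i] and, because
    [l < r], different spokes; so nothing is counted twice within [RS] and [RL]. *)
Lemma ray_rims l i r : l <= i -> i <= r -> l < r -> r <= n ->
  \sum_(p <- sides) \sum_(t <- spoke_lines)
    (cwalk D (ray 0 l t i) (rim i p.1 p.2) + cwalk D (ray 0 r t i) (rim i p.1 p.2))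
  <= RS D i + RL D i.
Proof.
move=> li ir lr rn; apply: leq_trans (leq_add (RS_ge n_gt0 D i lr rn) (RL_ge n_gt0 D i li ir rn)).
rewrite -big_split big_seq [leqRHS]big_seq; apply: leq_sum => p ps /=.
rewrite -big_split; apply: leq_sum => t _ /=.
by rewrite cwalk_ray_rim // cwalk_rayr_rim // side_id //; lia.
Qed.

Lemma hub_agg l i r : l <= i -> i <= r -> l < r -> r <= n ->
  2 <= rect SSa l l.+1 r r.+1 + rect SLa l l.+1 i r + rect SLa r r.+1 l i + rect LLa l i i r
     + 2 * rect (RZ D) i i.+1 l r + (RS D i + RL D i) + 2 * RR D i.
Proof.
move=> li ir lr rn.
pose W t u := cwalk D (line 0 l r) (rim i t u).
pose XY t u := cwalk D (ray 0 l t i) (ray 0 r u i).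
pose XR s t u := cwalk D (ray 0 l s i) (rim i t u).
pose YR s t u := cwalk D (ray 0 r s i) (rim i t u).
pose C t u t' u' := cwalk D (rim i t u) (rim i t' u').
have := @hub_arith W XY XR YR C.
have -> : \sum_(p <- sides) W p.1 p.2 = rect (RZ D) i i.+1 l r.
  rewrite RZ_sum big_seq [RHS]big_seq; apply: eq_bigr => p ps.
  by rewrite /W cwalk_line_rim ?(ltnW lr) // side_id.
rewrite /XY agg_rays // => H; apply: leq_trans (H _ _ _ _ _ _) _.
- by move=> t u; apply: cwalk_rim_swap.
- by move=> s t u; apply: cwalk_rim_swap.
- by move=> s t u; apply: cwalk_rim_swap.
- by move=> t u t' u'; rewrite /C cwalkC cwalk_rim_swap cwalkC.
- by move=> t u t' u'; apply: cwalkC.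
- by move=> a b c d; apply: hub_K33.
by rewrite leq_add2r leq_add2l; apply: ray_rims.
Qed.

Lemma cwalk_lineE i j w : cwalk D (line 0 i j) w =
  \sum_(minn i j <= k < maxn i j) \sum_(f <- steps w) crossD D (rail 0 k) f.
Proof. exact: cwalk_linel. Qed.

Lemma cwalk_line_rays i j r t :
  cwalk D (line 0 i j) (ray 0 r t i) =
  rect (zs t) (minn i j) (maxn i j) r r.+1
  + rect (ll D 0 t) (minn i j) (maxn i j) (minn i r) (maxn i r).
Proof.
rewrite cwalk_lineE /rect -big_split; apply: eq_bigr => k _.
by rewrite cross_ray big_nat1 minnC maxnC.
Qed.

Lemma cwalk_line_rim' i j x y : cwalk D (line 0 i j) (rim i x y) =
  \sum_(minn i j <= k < maxn i j) rl D (side x y) 0 i k.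
Proof.
rewrite cwalk_side cwalk_lineE; apply: eq_bigr => k _; apply: eq_bigr => e _.
exact: crossDC.
Qed.

Lemma middle_agg l i r : l < i -> i < r -> r <= n ->
  4 <= 2 * (rect SSo l l.+1 r r.+1 + rect SLo l l.+1 i r + rect SLo r r.+1 l i + rect LLo l i i r)
     + (rect SSa l l.+1 i i.+1 + rect SLa i i.+1 l i + (rect SSa i i.+1 r r.+1
         + rect SLa i i.+1 i r))
     + 2 * (rect ZS l i r r.+1 + rect ZL l i i r + (rect ZS i r l l.+1 + rect ZL i r l i))
     + 2 * rect (RZ D) i i.+1 l r + (RS D i + RL D i).
Proof.
move=> li ir rn; have lr := ltn_trans li ir.
have [wl wr] := (ltnW li, ltnW ir).
have mM : (minn i l = l) * (maxn i l = i) * (minn i r = i) * (maxn i r = r).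
  by rewrite (minn_idPr wl) (maxn_idPl wl) (minn_idPl wr) (maxn_idPr wr).
pose XY t u := cwalk D (ray 0 l t i) (ray 0 r u i).
pose XS t u := cwalk D (ray 0 l t i) (ray 0 i u i).
pose SY t u := cwalk D (ray 0 i t i) (ray 0 r u i).
pose ZX t u := cwalk D (line 0 i l) (rim i t u).
pose ZY t u := cwalk D (line 0 i r) (rim i t u).
pose ZXY t := cwalk D (line 0 i l) (ray 0 r t i).
pose ZYX t := cwalk D (line 0 i r) (ray 0 l t i).
pose XR s t u := cwalk D (ray 0 l s i) (rim i t u).
pose YR s t u := cwalk D (ray 0 r s i) (rim i t u).
have := @middle_arith ZX ZY XS SY XY ZXY ZYX XR YR.
have -> : \sum_(p <- sides) (ZX p.1 p.2 + ZY p.1 p.2) = rect (RZ D) i i.+1 l r.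
  rewrite RZ_sum big_seq [RHS]big_seq; apply: eq_bigr => p ps.
  by rewrite /ZX /ZY !cwalk_line_rim' !mM !side_id // -big_cat_nat.
have -> : \sum_(t <- spoke_lines) (ZXY t + ZYX t) =
    rect ZS l i r r.+1 + rect ZL l i i r + (rect ZS i r l l.+1 + rect ZL i r l i).
  by rewrite !rect_sum_seq -!big_split; apply: eq_bigr => t _;
      rewrite /ZXY /ZYX !cwalk_line_rays !mM.
rewrite /XY agg_rays // big_split /XS /SY !agg_rays // !rect_nilr !rect_nill !addn0 => H.
apply: leq_trans (H _ _ _ _ _) _.
- by move=> t u; apply: cwalk_rim_swap.
- by move=> t u; apply: cwalk_rim_swap.
- by move=> s t u; apply: cwalk_rim_swap.
- by move=> s t u; apply: cwalk_rim_swap.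
- move=> a b c d rot; have := middle_K33 n_gt0 D li ir rn rot; rewrite /=.
  by rewrite /XY /XS /SY /ZXY /ZYX /XR /YR /ZX /ZY; lia.
by rewrite leq_add2l; apply: ray_rims.
Qed.

(** In [first_K33] the edges from [(2, 1)] and [(5, 1)] to [(1, 1)] are sides of the rim of level 1;
    their crossings with the rim of level 0 are counted here. *)
Definition RR01 := \sum_(p <- sides) \sum_(q <- sides) rr D p q 1 0.

Lemma cwalk_steps2 x y z w : cwalk D [:: x; y; z] w =
  \sum_(f <- steps w) crossD D (x, y) f + \sum_(f <- steps w) crossD D (y, z) f.
Proof. by rewrite /cwalk /= !big_cons big_nil addn0. Qed.

Lemma rs_flip p t i j : \sum_(f <- steps (rim i p.1 p.2)) crossD D (spoke 0 t j) f = rs D p t i j.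
Proof. by apply: eq_bigr => f _; apply: crossDC. Qed.

Lemma rl_flip p t i k : \sum_(f <- steps (rim i p.1 p.2)) crossD D (rail t k) f = rl D p t i k.
Proof. by apply: eq_bigr => f _; apply: crossDC. Qed.

Lemma first_hub_rim p : cwalk D [:: (0, 0); (0, 1); (1, 1)] (rim 0 p.1 p.2) =
  rl D p 0 0 0 + rs D p 1 0 1.
Proof. by rewrite cwalk_steps2 -/(rail 0 0) -/(spoke 0 1 1) rl_flip rs_flip. Qed.

Lemma first_path_rim t p : t \in [:: 2; 5] -> cwalk D [:: (t, 0); (t, 1); (1, 1)] (rim 0 p.1 p.2) =
  rl D p t 0 0 + rr D (side t 1) p 1 0.
Proof.
move=> t25; rewrite cwalk_steps2 -/(rail t 0) rl_flip /rr; congr addn.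
rewrite [RHS]cwalkC -cwalk_side cwalkC; move: t25; rewrite !inE => /orP[] /eqP->;
by rewrite /cwalk /= big_cons big_nil addn0.
Qed.

Lemma first_ray_path s t : t \in [:: 2; 5] -> cwalk D (ray 0 0 s 0) [:: (t, 0); (t, 1); (1, 1)] =
  sl D 0 s t 0 0 + rs D (side t 1) s 1 0.
Proof.
move=> t25; rewrite cwalkC cwalk_steps2 -/(rail t 0); congr addn.
  by rewrite /ray /line /up /= big_cons big_nil addn0 crossDC.
rewrite -rs_flip; transitivity (cwalk D (ray 0 0 s 0) (rim 1 t 1)).
  rewrite cwalkC /cwalk; move: t25; rewrite !inE => /orP[] /eqP->;
  by rewrite /= [RHS]big_cons big_nil addn0.
by rewrite cwalk_side /cwalk /ray /line /up /= big_cons big_nil addn0.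
Qed.

Lemma first_ray_rim s p : cwalk D (ray 0 0 s 0) (rim 0 p.1 p.2) = rs D p s 0 0.
Proof. by rewrite /cwalk /ray /line /up /= big_cons big_nil addn0 rs_flip. Qed.

Lemma RL_ge0 i : \sum_(p <- sides) \sum_(t <- spoke_lines) rl D p t i 0 <= RL D i.
Proof.
by apply: leq_sum => p _; apply: leq_sum => t _; rewrite big_ltn // leq_addr.
Qed.

Lemma first_agg :
  1 <= rect SLa 0 1 0 1 + rect (RZ D) 0 1 0 1 + RS D 0 + RS D 1 + RL D 0 + RR D 0 + RR01.
Proof.
have E1 : cwalk D (rim 0 2 1) (rim 0 5 4) = rr D (1, 2) (4, 5) 0 0 by exact: cwalk_rims.
have E2 : cwalk D (rim 0 2 4) (rim 0 5 1) = rr D (2, 4) (5, 1) 0 0 by exact: cwalk_rims.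
have A p : cwalk D [:: (0, 0); (0, 1); (1, 1)] (rim 0 p.1 p.2) = rl D p 0 0 0 + rs D p 1 0 1.
  exact: first_hub_rim.
have B t p := @first_path_rim t p; have C s p := @first_ray_rim s p.
have := first_K33 n_gt0 D; rewrite E1 E2.
rewrite ![cwalk D _ (rim 0 2 1)]cwalk_rim_swap ![cwalk D _ (rim 0 5 4)]cwalk_rim_swap.
rewrite !(first_ray_path _ (t := 2)) // !(first_ray_path _ (t := 5)) //.
rewrite (A (1, 2)) (A (2, 4)) (A (5, 1)) (A (4, 5)).
rewrite (B 5 (1, 2)) // (B 5 (2, 4)) // (B 2 (5, 1)) // (B 2 (4, 5)) //.
rewrite (C 4 (1, 2)) (C 1 (2, 4)) (C 4 (5, 1)) (C 1 (4, 5)).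
have -> : side 2 1 = (1, 2) by []. have -> : side 5 1 = (5, 1) by [].
have := RS_ge n_gt0 D 0 (l := 0) (r := 1) isT n_gt0.
have := RS_ge n_gt0 D 1 (l := 0) (r := 1) isT n_gt0.
have := RL_ge0 0; rewrite !rect1 /SLa /agg /RZ /RR /RR01.
move: (RS D) (RL D) (sl D 0) (rs D) (rl D) (rr D) => fRS fRL fsl frs frl frr.
rewrite /adjacent_lines /sides /spoke_lines !big_cons !big_nil /=; clear; lia.
Qed.
End WheelCount.

(** * Sums over all pairs of edges of a prism *)

Section PrismTotal.
Variables (l6 : seq (nat * nat)) (n : nat).
Hypothesis l6_ok : all (fun e => [&& e.1 < 6, e.2 < 6 & e.1 != e.2]) l6.
Hypothesis l6_uniq : uniq (l6 ++ flipped l6).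
Variable D : drawing (cartesian (list_graph 6 l6) (path_graph n)).

Definition vert (e : nat * nat) j : vtx * vtx := ((e.1, j), (e.2, j)).

Definition prism_edges : seq (vtx * vtx) :=
  [seq vert e j | j <- index_iota 0 n.+1, e <- l6] ++
  [seq rail t k | k <- index_iota 0 n, t <- index_iota 0 6].

Lemma edge_code_eq (G : graph) (e f : gV G * gV G) :
  edge_code e = edge_code f -> e = f \/ e = (f.2, f.1).
Proof.
case: e f => [u v] [x y]; rewrite /edge_code /=.
by do 2!case: ifP => _; case=> -> ->; [left | right | right | left].
Qed.

Lemma prism_edgesP x : x \in prism_edges ->
  (exists2 e, e \in l6 & exists2 j, j <= n & x = vert e j) \/
  (exists2 t, t < 6 & exists2 k, k < n & x = rail t k).
Proof.
rewrite mem_cat => /orP[] /allpairsPdep[a [b [aI bI ->]]]; move: aI; rewrite mem_index_iota => aI.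
  by left; exists b => //; exists a.
by right; move: bI; rewrite mem_index_iota => bI; exists b => //; exists a.
Qed.

Lemma prism_edges_valid x : x \in prism_edges -> [/\ valid n x.1, valid n x.2 & adj l6 x.1 x.2].
Proof.
case/prism_edgesP => [[e el [j jn ->]]|[t t6 [k kn ->]]]; rewrite /valid /adj /=.
  have /and3P[-> -> _] := allP l6_ok e el; rewrite jn eqxx -surjective_pairing el.
  by split.
by rewrite t6 kn (ltnW kn) !eqxx orbT.
Qed.

Lemma prism_edges_flip x : x \in prism_edges -> (x.2, x.1) \notin prism_edges.
Proof.
move=> xU; apply/negP => yU.
case/prism_edgesP: xU yU => [[e el [j jn ->]]|[t t6 [k kn ->]]] /prism_edgesP[] [] /=.
- move=> f fl [i _ [E1 _ E2 _]]; move: l6_uniq; rewrite cat_uniq => /and3P[_ /hasP[]].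
  by exists e => //; apply/mapP; exists f => //; rewrite -E1 -E2 -surjective_pairing.
- by move=> t t6 [k kn [_ E1 _ E2]]; lia.
- by move=> e el [j jn [_ E1 _ E2]]; lia.
- by move=> u u6 [m mn [_ E1 _ E2]]; lia.
Qed.

Lemma prism_edges_uniq : uniq prism_edges.
Proof.
rewrite cat_uniq; apply/and3P; split.
- apply: allpairs_uniq; rewrite ?iota_uniq //.
    by move: l6_uniq; rewrite cat_uniq => /and3P[].
  by move=> [j e] [j' e'] _ _ /= [E1 -> E2]; rewrite [e]surjective_pairing E1 E2
      -surjective_pairing.
- apply/hasPn => x /allpairsPdep[k [t [_ _ ->]]]; apply/negP => /allpairsPdep[j [e [_ _ []]]].
  by move=> _ -> _ E; lia.
- apply: allpairs_uniq; rewrite ?iota_uniq // => -[k t] [k' t'] _ _ /=.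
  by case=> -> ->.
Qed.

Lemma prism_cross_le m : drawing_crossings D m ->
  \sum_(x <- prism_edges) \sum_(y <- prism_edges) crossD D x y <= m.*2.
Proof.
move=> Dm; pose emb (x : vtx * vtx) := (vx l6 n x.1, vx l6 n x.2).
apply: (@sum_cross_le _ D _ prism_edges emb) => //.
  rewrite map_inj_in_uniq ?prism_edges_uniq // => x y xU yU.
  have [x1 x2 _] := prism_edges_valid xU; have [y1 y2 _] := prism_edges_valid yU.
  case/edge_code_eq => E; have /= := congr1 fst E; have /= := congr1 snd E.
    move=> /(vx_inj x2 y2) E2 /(vx_inj x1 y1) E1.
    by rewrite [x]surjective_pairing E1 E2 -surjective_pairing.
  move=> /(vx_inj x2 y1) E2 /(vx_inj x1 y2) E1.
  by move: (prism_edges_flip yU); rewrite -E1 -E2 -surjective_pairing xU.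
apply/allP => x /prism_edges_valid[x1 x2 a]; exact: adj_gE.
Qed.

Definition vv j k := \sum_(e <- l6) \sum_(f <- l6) crossD D (vert e j) (vert f k).
Definition vr j k := \sum_(e <- l6) \sum_(0 <= t < 6) crossD D (vert e j) (rail t k).
Definition hh j k := \sum_(0 <= t < 6) \sum_(0 <= u < 6) crossD D (rail t j) (rail u k).

Let N := n.+1.

Lemma sum_weigh2 (F : nat -> nat -> nat) a b : a <= N -> b <= N ->
  \sum_(0 <= j < a) \sum_(0 <= k < b) F j k = weigh N (fun j k => (j < a) && (k < b)) F.
Proof. by move=> aN bN; rewrite -[LHS]/(rect F 0 a 0 b) (rectE (N := N)). Qed.

(** Ordered pairs of edges are split by type, an edge within a level or a rail. The mixed type
    occurs in both orders, hence its factor 2. *)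
Lemma prism_total m : drawing_crossings D m ->
  weigh N (fun _ _ => 1) vv + 2 * weigh N (fun _ k => k < n) vr
  + weigh N (fun j k => (j < n) && (k < n)) hh <= 2 * m.
Proof.
move/prism_cross_le; rewrite -mul2n; apply: leq_trans.
set V := [seq vert e j | j <- index_iota 0 n.+1, e <- l6].
set H := [seq rail t k | k <- index_iota 0 n, t <- index_iota 0 6].
have -> : weigh N (fun _ _ => 1) vv = \sum_(x <- V) \sum_(y <- V) crossD D x y.
  rewrite big_allpairs_dep; apply: eq_bigr => j _.
  under [RHS]eq_bigr => e _ do rewrite big_allpairs_dep.
  by rewrite [RHS]exchange_big; apply: eq_bigr => k _; rewrite mul1n.
have -> : weigh N (fun _ k => k < n) vr = \sum_(x <- V) \sum_(y <- H) crossD D x y.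
  transitivity (\sum_(0 <= j < N) \sum_(0 <= k < n) vr j k).
    rewrite sum_weigh2 //; apply/eqP; rewrite eqn_leq.
    by rewrite !leq_weigh // => j k -> _; case: (k < n).
  rewrite big_allpairs_dep; apply: eq_bigr => j _.
  under [RHS]eq_bigr => e _ do rewrite big_allpairs_dep.
  by rewrite [RHS]exchange_big.
have -> : weigh N (fun j k => (j < n) && (k < n)) hh = \sum_(x <- H) \sum_(y <- H) crossD D x y.
  rewrite -sum_weigh2 // big_allpairs_dep; apply: eq_bigr => j _.
  under [RHS]eq_bigr => t _ do rewrite big_allpairs_dep.
  by rewrite [RHS]exchange_big.
have HV : \sum_(x <- H) \sum_(y <- V) crossD D x y = \sum_(x <- V) \sum_(y <- H) crossD D x y.
  by rewrite exchange_big; apply: eq_bigr => x _; apply: eq_bigr => y _; apply: crossDC.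
have split_sum A : \sum_(x <- A) \sum_(y <- V ++ H) crossD D x y =
    \sum_(x <- A) \sum_(y <- V) crossD D x y + \sum_(x <- A) \sum_(y <- H) crossD D x y.
  by rewrite -big_split; apply: eq_bigr => x _; rewrite big_cat.
by rewrite /prism_edges -/V -/H [leqRHS]big_cat /= !split_sum HV; lia.
Qed.
End PrismTotal.

(** * Lower bound for the first graph *)

Section WheelTotal.
Variable n : nat.
Hypothesis n_gt0 : 0 < n.
Variable D : drawing (cartesian (list_graph 6 edges110) (path_graph n)).
Let N := n.+1.

Let SSa := agg adjacent_lines (ss D 0 0).
Let SSo := agg opposite_lines (ss D 0 0).
Let SLa := agg adjacent_lines (sl D 0).
Let SLo := agg opposite_lines (sl D 0).
Let LLa := agg adjacent_lines (ll D).
Let LLo := agg opposite_lines (ll D).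
Let ZS k j := \sum_(t <- spoke_lines) crossD D (rail 0 k) (spoke 0 t j).
Let ZL k j := \sum_(t <- spoke_lines) ll D 0 t k j.

Let spokes j k := \sum_(t <- spoke_lines) \sum_(u <- spoke_lines) ss D 0 0 t u j k.
Let rim_spokes i j := \sum_(p <- sides) \sum_(t <- spoke_lines) rs D p t i j.
Let rims i j := \sum_(p <- sides) \sum_(q <- sides) rr D p q i j.
Let rim_rails i k := \sum_(p <- sides) \sum_(t <- spoke_lines) rl D p t i k.

Lemma sum_edges110 (F : vtx * vtx -> nat) j : (forall u v, F (u, v) = F (v, u)) ->
  \sum_(e <- edges110) F (vert e j) =
  \sum_(t <- spoke_lines) F (spoke 0 t j)
  + \sum_(p <- sides) \sum_(f <- steps (rim j p.1 p.2)) F f.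
Proof.
move=> Fc; rewrite /edges110 /spoke_lines /sides /= !big_cons !big_nil /= /vert /spoke /=.
by rewrite (Fc (5, j) (0, j)) (Fc (1, j) (5, j)); lia.
Qed.

Lemma vvE j k : vv D j k = spokes j k + rim_spokes j k + rim_spokes k j + rims j k.
Proof.
pose G e := \sum_(f <- edges110) crossD D e (vert f k).
have E e : G e = \sum_(t <- spoke_lines) crossD D e (spoke 0 t k)
    + \sum_(p <- sides) \sum_(f <- steps (rim k p.1 p.2)) crossD D e f.
  by apply: sum_edges110 => u v; apply: crossn_revr.
rewrite -[LHS]/(\sum_(e <- edges110) G (vert e j)) sum_edges110; last first.
  by move=> u v; apply: eq_bigr => f _; apply: crossn_revl.
rewrite (eq_bigr _ (fun t _ => E (spoke 0 t j))) big_split /=.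
under [X in _ + X]eq_bigr => p _ do rewrite (eq_bigr _ (fun e _ => E e)) big_split /=.
rewrite big_split /=.
have -> : \sum_(t <- spoke_lines) \sum_(p <- sides) \sum_(f <- steps (rim k p.1 p.2))
    crossD D (spoke 0 t j) f = rim_spokes k j.
  rewrite /rim_spokes exchange_big; apply: eq_bigr => p _; apply: eq_bigr => t _.
  by apply: eq_bigr => e _; apply: crossDC.
have -> : \sum_(p <- sides) \sum_(e <- steps (rim j p.1 p.2)) \sum_(t <- spoke_lines)
    crossD D e (spoke 0 t k) = rim_spokes j k.
  by apply: eq_bigr => p _; rewrite exchange_big.
have -> : \sum_(p <- sides) \sum_(e <- steps (rim j p.1 p.2)) \sum_(q <- sides)
    \sum_(f <- steps (rim k q.1 q.2)) crossD D e f = rims j k.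
  by apply: eq_bigr => p _; rewrite exchange_big.
by rewrite -[X in X + _ + _ = _]/(spokes j k); lia.
Qed.

Lemma vrE j k : vr D j k =
  \sum_(t <- spoke_lines) \sum_(0 <= u < 6) sl D 0 t u j k
  + \sum_(p <- sides) \sum_(0 <= u < 6) rl D p u j k.
Proof.
pose G e := \sum_(0 <= u < 6) crossD D e (rail u k).
rewrite -[LHS]/(\sum_(e <- edges110) G (vert e j)) sum_edges110.
  by congr addn; apply: eq_bigr => p _; rewrite exchange_big.
by move=> u v; apply: eq_bigr => f _; apply: crossn_revl.
Qed.

Lemma sym_weigh (F : nat -> nat -> nat) (P : nat -> nat -> bool) :
  (forall j k, F j k = F k j) -> (forall j k, P j k = P k j) ->
  2 * weigh N (fun j k => (j < k) && P j k) F <= weigh N (fun j k => P j k) F.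
Proof.
move=> Fc Pc; have E : weigh N (fun j k => (j < k) && P j k) F = weigh N (fun j k => (k < j)
    && P j k) F.
  rewrite /weigh exchange_big; apply: eq_bigr => j _; apply: eq_bigr => k _.
  by rewrite Fc Pc.
rewrite mul2n -addnn {2}E weighD; apply: leq_weigh => j k _ _.
by case: (P j k); case: ltngtP.
Qed.

Lemma weigh_mono A (F F' : nat -> nat -> nat) :
  (forall j k, F j k <= F' j k) -> weigh N A F <= weigh N A F'.
Proof. by move=> FF; apply: leq_sum => j _; apply: leq_sum => k _; rewrite leq_mul2l FF orbT. Qed.

Lemma weighDr A (F F' : nat -> nat -> nat) :
  weigh N A (fun j k => F j k + F' j k) = weigh N A F + weigh N A F'.
Proof.
rewrite /weigh -big_split; apply: eq_bigr => j _ /=; rewrite -big_split.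
by apply: eq_bigr => k _; rewrite mulnDr.
Qed.

Lemma spokes_ge j k : SSa j k + SSo j k <= spokes j k.
Proof.
rewrite /SSa /SSo /agg /spokes; move: (ss D 0 0) => f.
rewrite /adjacent_lines /opposite_lines /spoke_lines !big_cons !big_nil /=; clear; lia.
Qed.

Lemma rims_ge i : 2 * RR D i <= rims i i.
Proof.
have C p q : rr D p q i i = rr D q p i i by apply: cwalkC.
rewrite /RR /rims /sides !big_cons !big_nil /= (C (4, 5) (1, 2)) (C (5, 1) (2, 4)).
by move: (rr D) => f; clear; lia.
Qed.

Lemma vr_ge j k : SLa j k + SLo j k + ZS k j + rim_rails j k + RZ D j k <= vr D j k.
Proof.
have -> : ZS k j = \sum_(t <- spoke_lines) sl D 0 t 0 j k.
  by apply: eq_bigr => t _; apply: crossDC.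
rewrite vrE /SLa /SLo /agg /rim_rails /RZ; move: (sl D 0) (rl D) => f g.
rewrite /adjacent_lines /opposite_lines /spoke_lines /sides !big_cons !big_nil /=.
by clear; lia.
Qed.

Lemma hh_ge j k : LLa j k + LLo j k + ZL j k + ZL k j <= hh D j k.
Proof.
have -> : ZL k j = \sum_(t <- spoke_lines) ll D t 0 j k.
  by apply: eq_bigr => t _; apply: crossDC.
rewrite -[hh D j k]/(\sum_(0 <= t < 6) \sum_(0 <= u < 6) ll D t u j k) /LLa /LLo /agg /ZL; move:
    (ll D) => f.
rewrite /adjacent_lines /opposite_lines /spoke_lines !big_cons !big_nil /=.
by clear; lia.
Qed.

(** The classes of crossings in [wheel_crossings] do not overlap, so twice their sum fits into the
    sum over ordered pairs bounded by [prism_total]. *)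
Lemma wheel_lower m : drawing_crossings D m -> 3 * n - 1 <= m.
Proof.
move=> Dm; rewrite subn1.
have /leq_trans : (3 * n).-1 <= weigh N (fun j k => j < k) SSa + weigh N (fun j k => j < k) SSo
  + weigh N (fun j k => k < n) SLa + weigh N (fun j k => k < n) SLo
  + weigh N (fun j k => j < k < n) LLa + weigh N (fun j k => j < k < n) LLo
  + weigh N (fun j k => j < n) ZS + weigh N (fun j k => (j < n) && (k < n)) ZL
  + weigh N (fun j k => k < n) (RZ D)
  + \sum_(0 <= i < N) RS D i + \sum_(0 <= i < N) RL D i + \sum_(0 <= i < N) RR D i + RR01 D.
  apply: wheel_crossings => //.
  - move=> i /andP[i0 iN].
    have := @star_K34 edges110 n isT D 0 0 0 i.-1 i n (leq_pred _) (ltnW iN) (leqnn _).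
    have [n1 n2 n3] : [/\ i.-1 != i, i.-1 != n & i != n] by split; lia.
    rewrite !xpair_eqE /= n1 n2 n3 => /(_ isT isT isT isT);
        rewrite /star_sum -/SSa -/SSo -/SLa -/SLo -/LLa -/LLo !prednK //.
    lia.
  - move=> i /andP[i0 iN]; have := hub_agg n_gt0 D (leq0n i) (leqnn i) i0 iN.
    by rewrite !rect_nilr -/SSa -/SLa; lia.
  - move=> i /andP[i0 iN]; have := hub_agg n_gt0 D (leqnn i) (leqnSn i) (ltnSn i) iN.
    by rewrite !rect_nilr !rect_nill -/SSa -/SLa; lia.
  - move=> i /andP[i0 iN]; have := middle_agg n_gt0 D i0 (ltnSn i) iN.
    by rewrite -/SSa -/SLa -/SSo -/SLo -/LLo -/ZS -/ZL; lia.
  - exact: first_agg.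
apply; rewrite -(leq_pmul2l (m := 2)) //; apply: leq_trans (prism_total _ _ Dm) => //.
have one (A : nat -> nat -> nat) F : weigh N (fun j k => A j k) (fun j k => F k j) = weigh N (fun
    j k => A k j) F.
  by rewrite /weigh exchange_big.
have A1 : 2 * weigh N (fun j k => j < k) SSa + 2 * weigh N (fun j k => j < k) SSo
    <= weigh N (fun _ _ => 1) spokes.
  rewrite -mulnDr -weighDr; apply: leq_trans (sym_weigh (F := spokes) (P := fun _ _ => true) _ _)
      => //.
    rewrite leq_mul2l /=; apply: leq_trans (weigh_mono _ spokes_ge) _.
    by apply: leq_weigh => j k _ _; rewrite andbT.
  move=> j k; rewrite /spokes exchange_big; apply: eq_bigr => t _; apply: eq_bigr => u _.
  exact: crossDC.
have A2 : \sum_(0 <= i < N) RS D i = weigh N (fun _ _ => 1) rim_spokes.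
  apply: eq_bigr => i _; rewrite /RS /rim_spokes.
  under [RHS]eq_bigr => j _ do rewrite mul1n.
  rewrite [RHS]exchange_big; apply: eq_bigr => p _.
  by rewrite [RHS]exchange_big.
have A3 : 2 * \sum_(0 <= i < N) RR D i + 2 * RR01 D <= weigh N (fun _ _ => 1) rims.
  have rimsC j k : rims j k = rims k j.
    by rewrite /rims exchange_big; apply: eq_bigr => p _; apply: eq_bigr => q _; apply: cwalkC.
  have -> : 2 * RR01 D = rect rims 1 2 0 1 + rect rims 0 1 1 2.
    by rewrite !rect1 (rimsC 0 1) -/(RR01 D) mul2n addnn.
  (* [RR] sits on the diagonal and [RR01] on the entries [(1, 0)] and [(0, 1)], so the weights add
     up to at most 1. *)
  apply: (@leq_trans (weigh N (fun j k => j == k) rims + (rect rims 1 2 0 1 + rect rims 0 1 1 2))).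
    rewrite leq_add2r big_distrr /weigh /= !big_nat; apply: leq_sum => i iN.
    rewrite (big_rem i) ?mem_index_iota //= eqxx mul1n.
    by apply: leq_trans (rims_ge i) (leq_addr _ _).
  rewrite !(rectE (N := N)) // !weighD; apply: leq_weigh => j k _ _; lia.
have V : 2 * weigh N (fun j k => j < k) SSa + 2 * weigh N (fun j k => j < k) SSo
    + 2 * \sum_(0 <= i < N) RS D i + (2 * \sum_(0 <= i < N) RR D i + 2 * RR01 D)
    <= weigh N (fun _ _ => 1) (vv D).
  apply: (@leq_trans (weigh N (fun _ _ => 1) (fun j k => spokes j k + rim_spokes j k
      + rim_spokes k j + rims j k))).
    by rewrite !weighDr (one (fun _ _ => 1) rim_spokes) -A2; lia.
  by apply: weigh_mono => j k; rewrite vvE.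
have R : weigh N (fun j k => k < n) SLa + weigh N (fun j k => k < n) SLo
    + weigh N (fun j k => j < n) ZS + \sum_(0 <= i < N) RL D i
    + weigh N (fun j k => k < n) (RZ D) <= weigh N (fun _ k => k < n) (vr D).
  have -> : \sum_(0 <= i < N) RL D i = weigh N (fun j k => k < n) rim_rails.
    apply: eq_bigr => i _; rewrite /RL /rim_rails.
    rewrite -(sum_nat_widen (N := N) (fun k => \sum_(p <- sides)
        \sum_(t <- spoke_lines) rl D p t i k) 0 (b := n)) //.
    by rewrite [RHS]exchange_big; apply: eq_bigr => p _; rewrite [RHS]exchange_big.
  rewrite -(one (fun j k => k < n) ZS) -!weighDr; apply: weigh_mono => j k; exact: vr_ge.
have H : 2 * weigh N (fun j k => j < k < n) LLa + 2 * weigh N (fun j k => j < k < n) LLo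
    + 2 * weigh N (fun j k => (j < n) && (k < n)) ZL
    <= weigh N (fun j k => (j < n) && (k < n)) (hh D).
  have LC F : (forall t u j k, F t u j k = F u t k j) -> forall P, perm_eq (flipped P) P ->
      2 * weigh N (fun j k => j < k < n) (agg P F) <= weigh N (fun j k => (j < n)
          && (k < n)) (agg P F).
    move=> FC P PP; apply: leq_trans (sym_weigh (P := fun j k => (j < n) && (k < n)) _ _).
    - by rewrite leq_mul2l /=; apply: leq_weigh => j k _ _; lia.
    - by move=> j k; rewrite /agg -(perm_big _ PP) /= big_map; apply: eq_bigr => p _; apply: FC.
    - by move=> j k; rewrite andbC.
  have llC t u j k : ll D t u j k = ll D u t k j by apply: crossDC.
  have ZZ : 2 * weigh N (fun j k => (j < n) && (k < n)) ZL =
      weigh N (fun j k => (j < n) && (k < n)) ZL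
      + weigh N (fun j k => (j < n) && (k < n)) (fun j k => ZL k j).
    rewrite (one (fun j k => (j < n) && (k < n)) ZL) mul2n -addnn; congr addn.
    by apply: eq_bigr => j _; apply: eq_bigr => k _; rewrite andbC.
  rewrite ZZ; apply: leq_trans (leq_add (leq_add (LC _ llC adjacent_lines isT)
    (LC _ llC opposite_lines isT)) (leqnn _)) _.
  by rewrite !addnA -!weighDr; apply: weigh_mono => j k; apply: hh_ge.
apply: leq_trans (leq_add (leq_add V (leq_mul (leqnn 2) R)) H); clear; lia.
Qed.
End WheelTotal.

(** * Lower bound for the second graph *)

Definition edges137 : seq (nat * nat) :=
  [:: (0,1); (1,2); (2,3); (3,4); (4,5); (5,0); (0,2); (0,4); (1,3); (3,5)].

Section TwoHubs.
Variable n : nat.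
Hypothesis n_gt0 : 0 < n.
Variable D : drawing (cartesian (list_graph 6 edges137) (path_graph n)).
Let N := n.+1.

Let P := adjacent_lines ++ opposite_lines.
(** Each level holds the hubs 0 and 3, in this order. The hub copies form a chain numbered from 0 to
    2n + 1, in which [j./2] is the level of member [j]. *)
Let hub j := if odd j then 3 else 0.
Let SS j k := agg P (ss D (hub j) (hub k)) j./2 k./2.
(** Two hubs of one level have no rail between them: the rails between consecutive levels are placed
    after the odd member [k], and even places are empty. *)
Let SL j k := if odd k then agg P (sl D (hub j)) j./2 k./2 else 0.
Let LL j k := if odd j && odd k then agg P (ll D) j./2 k./2 else 0.

(** Halving maps the odd numbers of [[a, b)] bijectively onto [[a./2, b./2)]. *)
Lemma half_sum (g : nat -> nat) a b : a <= b ->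
  \sum_(a <= k < b) (if odd k then g k./2 else 0) = \sum_(a./2 <= k < b./2) g k.
Proof.
elim: b => [|b IH]; first by rewrite leqn0 => /eqP->; rewrite !big_geq.
rewrite leq_eqVlt => /predU1P[->|]; first by rewrite !big_geq.
rewrite ltnS => ab; rewrite big_nat_recr //= IH // uphalf_half.
case: (odd b); last by rewrite addn0.
by rewrite add1n big_nat_recr // half_leq.
Qed.

Lemma double_sum (g : nat -> nat) m :
  \sum_(0 <= j < m.*2) g j = \sum_(0 <= a < m) (g a.*2 + g a.*2.+1).
Proof.
elim: m => [|m IH]; first by rewrite !big_geq.
by rewrite doubleS !big_nat_recr //= IH addnA.
Qed.

Lemma rect_aggP F a b c d :
  rect (agg P F) a b c d = rect (agg adjacent_lines F) a b c d
      + rect (agg opposite_lines F) a b c d.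
Proof. by rewrite !rect_agg big_cat. Qed.

Lemma rectSL j a b : a <= b ->
  rect SL j j.+1 a b = rect (agg P (sl D (hub j))) j./2 j./2.+1 a./2 b./2.
Proof. by move=> ab; rewrite /rect !big_nat1 (half_sum (agg P (sl D (hub j)) j./2)). Qed.

Lemma rectLL a b c d : a <= b -> c <= d ->
  rect LL a b c d = rect (agg P (ll D)) a./2 b./2 c./2 d./2.
Proof.
move=> ab cd; rewrite /rect -(half_sum (fun j => \sum_(c./2 <= k < d./2) agg P (ll D) j k)) //.
apply: eq_bigr => j _; rewrite /LL; case: (odd j); last by rewrite big1.
exact: half_sum.
Qed.

(** Two of the three hubs may lie on one level, where they are different vertices; [star_K34] allows
    equal levels for this reason. *)
Lemma star_chain l h r : l < h -> h < r -> r <= n.*2.+1 ->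
  2 <= rect SS l l.+1 h h.+1 + rect SS h h.+1 r r.+1 + rect SS l l.+1 r r.+1
     + (rect SL h h.+1 l h + rect SL r r.+1 l h)
     + (rect SL h h.+1 h r + rect SL l l.+1 h r)
     + rect LL l h h r.
Proof.
move=> lh hr rm; have [wl wr] := (ltnW lh, ltnW hr).
have rn : r./2 <= n by lia.
have neq a b : a < b -> (hub a, a./2) != (hub b, b./2).
  move=> ab; apply/eqP => -[E H]; have : odd a = odd b.
    by move: E; rewrite /hub; case: (odd a); case: (odd b).
  by move: H ab; clear; lia.
have := @star_K34 edges137 n isT D (hub l) (hub h) (hub r) l./2 h./2 r./2
  (half_leq wl) (half_leq wr) rn (neq _ _ lh) (neq _ _ (ltn_trans lh hr)) (neq _ _ hr).
have -> : all (fun h => all (linked edges137 h) [:: 1; 2; 4; 5] && (h \notin [:: 1; 2; 4; 5]))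
    [:: hub l; hub h; hub r].
  by rewrite /hub; case: (odd l); case: (odd h); case: (odd r).
move=> /(_ isT) H; apply: leq_trans H _.
have E F a b : agg P F a b =
    rect (agg adjacent_lines F) a a.+1 b b.+1 + rect (agg opposite_lines F) a a.+1 b b.+1.
  by rewrite !rect1; apply: big_cat.
rewrite !rectSL // rectLL // !rect1 /SS /star_sum.
move: (ss D) (sl D) (ll D) => f g k; rewrite !E !rect_aggP; clear; lia.
Qed.

Let spokes (F : vtx * vtx -> nat) j :=
  \sum_(t <- spoke_lines) F (spoke 0 t j) + \sum_(t <- spoke_lines) F (spoke 3 t j).

Lemma sum_edges137 (F : vtx * vtx -> nat) j : (forall u v, F (u, v) = F (v, u)) ->
  spokes F j <= \sum_(e <- edges137) F (vert e j).
Proof.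
move=> Fc; rewrite /spokes /edges137 /spoke_lines /= !big_cons !big_nil /= /vert /spoke /=.
by rewrite (Fc (5, j) (0, j)) (Fc (1, j) (3, j)) (Fc (2, j) (3, j)); clear; lia.
Qed.

Lemma agg_spoke_lines F j k :
  agg P F j k <= \sum_(t <- spoke_lines) \sum_(u <- spoke_lines) F t u j k.
Proof.
rewrite /agg /P /adjacent_lines /opposite_lines /spoke_lines !big_cons !big_nil /=.
by clear; lia.
Qed.

Lemma spoke_pairs a b :
  SS a.*2 b.*2 + SS a.*2.+1 b.*2 + (SS a.*2 b.*2.+1 + SS a.*2.+1 b.*2.+1) <= vv D a b.
Proof.
apply: (@leq_trans (spokes (fun e => spokes (crossD D e) b) a)).
  rewrite addnACA /SS /hub /= !odd_double /= !doubleK !uphalf_double.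
  apply: leq_trans (leq_add (leq_add (agg_spoke_lines _ _ _) (agg_spoke_lines _ _ _))
    (leq_add (agg_spoke_lines _ _ _) (agg_spoke_lines _ _ _))) _.
  by rewrite /spokes -!big_split.
apply: leq_trans (sum_edges137 _ _) _ => [u v|].
  by rewrite /spokes; congr addn; apply: eq_bigr => t _; apply: crossn_revl.
by apply: leq_sum => e _; apply: sum_edges137 => u v; apply: crossn_revr.
Qed.

Lemma agg_lines F j k :
  agg P F j k <= \sum_(0 <= t < 6) \sum_(0 <= u < 6) F t u j k.
Proof.
apply: leq_trans (agg_spoke_lines _ _ _) _.
rewrite /spoke_lines -[leqRHS]/(\sum_(t <- [:: 0; 1; 2; 3; 4; 5])
    \sum_(u <- [:: 0; 1; 2; 3; 4; 5]) F t u j k).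
have sub (g : nat -> nat) : \sum_(t <- [:: 1; 2; 4; 5]) g t <=
    \sum_(t <- [:: 0; 1; 2; 3; 4; 5]) g t.
  by rewrite !big_cons !big_nil; clear; lia.
by apply: leq_trans (sub _); apply: leq_sum => t _; apply: sub.
Qed.

Lemma rail_pairs a b :
  agg P (sl D 0) a b + agg P (sl D 3) a b <= vr D a b.
Proof.
apply: (@leq_trans (spokes (fun e => \sum_(0 <= u < 6) crossD D e (rail u b)) a)).
  have E h : agg P (sl D h) a b <= \sum_(t <- spoke_lines) \sum_(0 <= u < 6) sl D h t u a b.
    apply: leq_trans (agg_spoke_lines _ _ _) _; apply: leq_sum => t _.
    rewrite -[leqRHS]/(\sum_(u <- [:: 0; 1; 2; 3; 4; 5]) sl D h t u a b) /spoke_lines !big_cons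
        !big_nil.
    by clear; lia.
  exact: leq_add (E 0) (E 3).
by apply: sum_edges137 => u v; apply: eq_bigr => t _; apply: crossn_revl.
Qed.

(** The last member of the chain has number 2n + 1, so [chain_crossings] gives twice 2n. *)
Lemma double_hub_lower m : drawing_crossings D m -> 4 * n <= m.
Proof.
move=> Dm; pose M := n.*2.+2.
have C : 2 * n.*2 <= weigh M (fun j k => j < k) SS
    + weigh M (fun j k => k < n.*2.+1) SL + weigh M (fun j k => j < k < n.*2.+1) LL.
  by apply: (@chain_crossings n.*2.+1 SS SL LL) => // l h r; apply: star_chain.
rewrite -(leq_pmul2l (m := 2)) //; apply: leq_trans (prism_total _ _ Dm) => //.
have aggC F a b : (forall t u, F t u a b = F u t b a) -> agg P F a b = agg P F b a.
  have PP : perm_eq (flipped P) P by [].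
  by move=> FC; rewrite /agg -[RHS](perm_big _ PP) big_map; apply: eq_bigr => p _; apply: FC.
have V : 2 * weigh M (fun j k => j < k) SS <= weigh N (fun _ _ => 1) (vv D).
  apply: (@leq_trans (weigh M (fun _ _ => 1) SS)).
    apply: leq_trans (sym_weigh _ (P := fun _ _ => true) _ _) => //.
      by rewrite leq_mul2l /=; apply: leq_weigh => j k _ _; rewrite andbT.
    move=> j k; rewrite /SS /agg; have PP : perm_eq (flipped P) P by [].
    by rewrite -[RHS](perm_big _ PP) big_map; apply: eq_bigr => p _; apply: crossDC.
  have one K f : weigh K (fun _ _ => 1) f = \sum_(0 <= j < K) \sum_(0 <= k < K) f j k.
    by apply: eq_bigr => j _; apply: eq_bigr => k _; apply: mul1n.
  rewrite !one -[M]/N.*2 double_sum; apply: leq_sum => a _.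
  by rewrite -big_split double_sum; apply: leq_sum => b _; apply: spoke_pairs.
have H : 2 * weigh M (fun j k => j < k < n.*2.+1) LL <= weigh N (fun j k => (j < n)
    && (k < n)) (hh D).
  apply: (@leq_trans (weigh M (fun j k => (j < n.*2.+1) && (k < n.*2.+1)) LL)).
    apply: leq_trans (sym_weigh _ (P := fun j k => (j < n.*2.+1) && (k < n.*2.+1)) _ _).
    - by rewrite leq_mul2l /=; apply: leq_weigh => j k _ _; lia.
    - move=> j k; rewrite /LL andbC; case: (odd k && odd j) => //.
      by apply: aggC => t u; apply: crossDC.
    - by move=> j k; rewrite andbC.
  have wE K f b d : b <= K -> d <= K -> weigh K (fun j k => (j < b) && (k < d)) f = rect f 0 b 0 d.
    by move=> bK dK; rewrite (rectE (N := K)).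
  rewrite !wE // rectLL //=.
  by rewrite uphalf_double; apply: leq_sum => j _; apply: leq_sum => k _; apply: agg_lines.
have R : weigh M (fun j k => k < n.*2.+1) SL <= weigh N (fun _ k => k < n) (vr D).
  have wE K f b d : b = K -> d <= K -> weigh K (fun _ k => k < d) f = rect f 0 b 0 d.
    move=> -> dK; rewrite (rectE (N := K)) // /weigh !big_nat.
    by apply: eq_bigr => j jK; rewrite jK.
  rewrite (wE _ _ N.*2) // (wE _ _ N) // /rect double_sum; apply: leq_sum => a _.
  rewrite /SL /hub /= odd_double !half_sum //= doubleK !uphalf_double -big_split.
  by apply: leq_sum => b _; apply: rail_pairs.
apply: leq_trans (leq_add (leq_add V (leq_mul (leqnn 2) R)) H).
by move: C; rewrite -mul2n; clear; lia.
Qed.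
End TwoHubs.

(** * Straight-line drawings *)

Section StraightLines.
Import Order.TTheory GRing.Theory Num.Theory numFieldNormedType.Exports.
Local Open Scope ring_scope.

(** * Separated and straddling segments *)

Section SegmentPairs.
Variable F : realFieldType.
Implicit Types (g p q r s : F * F) (a b : F).

Definition dot g p := g.1 * p.1 + g.2 * p.2.

(** The separation is weak, so that segments may share an end or one may be a point; one strict
    inequality keeps the interiors apart. *)
Definition separates g p q r s :=
  [/\ dot g p <= dot g r, dot g p <= dot g s, dot g q <= dot g r, dot g q <= dot g s
    & dot g p < dot g r \/ dot g q < dot g s].

Lemma separates_on_seg g p q r s a b : separates g p q r s ->
  0 < a < 1 -> 0 < b < 1 -> on_seg p q a <> on_seg r s b.
Proof.
move=> [pr ps qr qs strict] /andP[a0 a1] /andP[b0 b1] [E1 E2].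
(* The sum is the difference between the values of [g] at the two interior points, written as a
   combination of differences at the ends with positive weights. *)
have : (1 - a) * (1 - b) * (dot g r - dot g p) + (1 - a) * b * (dot g s - dot g p)
     + a * (1 - b) * (dot g r - dot g q) + a * b * (dot g s - dot g q) = 0.
  transitivity (g.1 * (r.1 + b * (s.1 - r.1)) + g.2 * (r.2 + b * (s.2 - r.2))
      - (g.1 * (p.1 + a * (q.1 - p.1)) + g.2 * (p.2 + a * (q.2 - p.2)))).
    by rewrite /dot; ring.
  by rewrite E1 E2 subrr.
have [a' b'] : 0 < 1 - a /\ 0 < 1 - b by lra.
have w1 := mulr_gt0 a' b'; have w2 := mulr_gt0 a' b0.
have w3 := mulr_gt0 a0 b'; have w4 := mulr_gt0 a0 b0.
move: pr ps qr qs; rewrite -subr_ge0 -(subr_ge0 (dot g p)) -(subr_ge0 (dot g q)) -(subr_ge0 (dot g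
    q)).
move=> pr ps qr qs.
have z1 := mulr_ge0 (ltW w1) pr; have z2 := mulr_ge0 (ltW w2) ps.
have z3 := mulr_ge0 (ltW w3) qr; have z4 := mulr_ge0 (ltW w4) qs.
by case: strict => [|]; rewrite -subr_gt0 => S; [have := mulr_gt0 w1 S |
    have := mulr_gt0 w4 S]; lra.
Qed.

Definition straddles p q r s :=
  (orient p q r * orient p q s < 0) && (orient r s p * orient r s q < 0).

Lemma straddles_on_seg p q r s : straddles p q r s -> exists z, forall z',
  z' = z <-> exists a b, [/\ 0 < a < 1, 0 < b < 1, on_seg p q a = z' & on_seg r s b = z'].
Proof.
move=> /andP[pq rs].
have opp (x y : F) : x * y < 0 -> [/\ x - y != 0, 0 < x / (x - y) & x / (x - y) < 1].
  move=> xy; have xy0 : x - y != 0.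
    apply/eqP => E; have Exy : y = x by lra.
    by have := sqr_ge0 x; move: xy; rewrite Exy expr2; lra.
  have d2 : 0 < (x - y) ^+ 2 by rewrite exprn_even_gt0.
  split=> //.
    have -> : x / (x - y) = (x ^+ 2 - x * y) / (x - y) ^+ 2 by field.
    by apply: divr_gt0 => //; have := sqr_ge0 x; lra.
  rewrite -subr_gt0 (_ : _ - _ = (y ^+ 2 - x * y) / (x - y) ^+ 2); last by field.
  by apply: divr_gt0 => //; have := sqr_ge0 y; lra.
have [b_nz b0 b1] := opp _ _ pq; have [a_nz a0 a1] := opp _ _ rs.
(* Along [pq] the function [orient r s] is affine and changes sign; [a] is the parameter of its
   zero, and [b] is obtained likewise on [rs]. *)
set a := orient r s p / _ in a0 a1; set b := orient p q r / _ in b0 b1.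
have E : on_seg p q a = on_seg r s b.
  by rewrite /on_seg /a /b; move: a_nz b_nz; rewrite /orient => a_nz b_nz; congr pair; field;
      apply/andP.
exists (on_seg p q a) => z'; split=> [->|[a' [b' [_ _ <- E']]]].
  by exists a, b; rewrite a0 a1 b0 b1.
suff -> : a' = a by [].
apply: (mulIf a_nz); rewrite /a divfK //.
have -> : a' * (orient r s p - orient r s q) = orient r s p - orient r s (on_seg p q a').
  by rewrite /orient /=; ring.
by rewrite -E' (_ : orient r s (on_seg r s b') = 0) ?subr0 // /orient /=; ring.
Qed.
End SegmentPairs.

Lemma affine_continuous (K : realType) (c d : K) : continuous (fun t : K => c + t * d).
Proof.
by move=> t; apply: cvgD; [exact: cvg_cst | exact: mulrr_continuous].
Qed.

Section StraightDrawing.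
Variables (G : graph) (pos : gV G -> R * R).

Definition separated (p q r s : R * R) := exists g, separates g p q r s \/ separates g r s p q.

Hypothesis pos_inj : injective pos.
Hypothesis vertex_clear : forall e, dedge e -> forall w, separated (pos e.1) (pos e.2) (pos w)
    (pos w).
Hypothesis edge_pairs : forall e f, dedge e -> dedge f -> e != f ->
  straddles (pos e.1) (pos e.2) (pos f.1) (pos f.2) \/
  separated (pos e.1) (pos e.2) (pos f.1) (pos f.2).

Let arc e := on_seg (pos e.1) (pos e.2).

Lemma separated_on_seg p q r s (a b : R) : separated p q r s ->
  0 < a < 1 -> 0 < b < 1 -> on_seg p q a <> on_seg r s b.
Proof.
move=> [g [] sep a01 b01]; first exact: separates_on_seg sep a01 b01.
by move/esym; apply: separates_on_seg sep b01 a01.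
Qed.

Lemma on_seg_diag (p : R * R) b : on_seg p p b = p.
Proof. by rewrite /on_seg !subrr !mulr0 !addr0; case: p. Qed.

Lemma arc_cont e : dedge e ->
  continuous (fun t => (arc e t).1) /\ continuous (fun t => (arc e t).2).
Proof.
by move=> _; split; apply: affine_continuous.
Qed.

Lemma arc_end0 e : dedge e -> arc e 0 = pos e.1.
Proof. by rewrite /arc /on_seg !mul0r !addr0; case: (pos e.1). Qed.

Lemma arc_end1 e : dedge e -> arc e 1 = pos e.2.
Proof. by rewrite /arc /on_seg !mul1r ![_ + (_ - _)]addrC !subrK; case: (pos e.2). Qed.

Lemma arc_inj e : dedge e -> forall a b : R,
  0 <= a <= 1 -> 0 <= b <= 1 -> arc e a = arc e b -> a = b.
Proof.
move=> de a b _ _ [/addrI E1 /addrI E2].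
have : pos e.1 != pos e.2.
  apply/eqP => /pos_inj E; move: de; rewrite /dedge E gE_irr //.
have K (x y : R) : a * (y - x) = b * (y - x) -> x != y -> a = b.
  by move=> E xy; apply: (mulIf _ E); rewrite subr_eq0 eq_sym.
move: E1 E2; case: (pos e.1) (pos e.2) => x y [x' y'] /= /K E1 /K E2.
by rewrite xpair_eqE negb_and => /orP[].
Qed.

Lemma arc_novert e : dedge e -> forall t : R, 0 < t < 1 -> forall w, arc e t <> pos w.
Proof.
move=> de t t01 w; rewrite -(on_seg_diag (pos w) t).
exact: (separated_on_seg (vertex_clear de w) t01 t01).
Qed.

Definition straight : drawing G := Drawing pos_inj arc_cont arc_end0 arc_end1 arc_inj arc_novert.

Definition straddle e f := straddles (pos e.1) (pos e.2) (pos f.1) (pos f.2).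

(** A straddling pair meets in exactly one point, and by [edge_pairs] every other pair of edges is
    separated, so it has none. *)
Lemma straight_crossings k :
  (\sum_(e | dedge e) \sum_(f | dedge f && (f != e)) straddle e f = k.*2)%N ->
  drawing_crossings straight k.
Proof.
move=> total.
pose pt e f := if pselect (exists z, forall z', z' = z <-> crossings straight e f z') is left H
  then [:: sval (cid H)] else [::].
have ptP e f : straddle e f -> size (pt e f) = 1%N /\ (uniq (pt e f) /\ forall z, z \in pt e f <->
    crossings straight e f z).
  move/straddles_on_seg => H; rewrite /pt; case: pselect => // H'.
  by case: cid => z zP /=; split=> //; split=> // z'; rewrite inE -zP; split=> /eqP.
exists (fun e f => if straddle e f then pt e f else [::]); split.
- move=> e f de df ef; case: ifP => [/ptP[] //|] nst; split=> // z; split=> // -[a [b [a01 b01 Ea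
    Eb]]].
  have [|sep] := edge_pairs de df ef; first by rewrite -/(straddle e f) nst.
  by case: (separated_on_seg sep a01 b01); rewrite -[LHS]/(arc e a) -[RHS]/(arc f b) [LHS]Ea.
- rewrite -total; apply: eq_bigr => e de; apply: eq_bigr => f _.
  by case: ifP => // /ptP[].
Qed.
End StraightDrawing.
End StraightLines.

Import Order.TTheory GRing.Theory Num.Theory.

(** * Computable tests on integer points *)

Section IntegerPoints.
Local Open Scope Z_scope.
Implicit Types (g p q r s : Z * Z).

Definition dotZ g p := g.1 * p.1 + g.2 * p.2.

Definition separatesZ g p q r s :=
  [&& dotZ g p <=? dotZ g r, dotZ g p <=? dotZ g s, dotZ g q <=? dotZ g r, dotZ g q <=? dotZ g s
    & (dotZ g p <? dotZ g r) || (dotZ g q <? dotZ g s)].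

Definition orientZ p q r := (q.1 - p.1) * (r.2 - p.2) - (q.2 - p.2) * (r.1 - p.1).

Definition straddlesZ p q r s :=
  (orientZ p q r * orientZ p q s <? 0) && (orientZ r s p * orientZ r s q <? 0).

Definition axes p q : seq (Z * Z) :=
  let: (x, y) := (q.1 - p.1, q.2 - p.2) in [:: (x, y); (- x, - y); (- y, x); (y, - x)].

(** This is a sufficient test with twelve candidate functionals: the directions and normals, with
    both signs, of the two segments and of the line from [p] to [r]. *)
Definition separableZ p q r s :=
  has (fun g => separatesZ g p q r s || separatesZ g r s p q) (axes p q ++ axes r s ++ axes p r).

Definition scaleZ k p := (k * p.1, k * p.2).

Definition embZ p : R * R := (IZR p.1, IZR p.2).

Lemma leIZR a b : (IZR a <= IZR b)%R = (a <=? b).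
Proof. by apply/RleP/Z.leb_spec0 => [/le_IZR|/IZR_le]. Qed.

Lemma ltIZR a b : (IZR a < IZR b)%R = (a <? b).
Proof. by apply/RltP/Z.ltb_spec0 => [/lt_IZR|/IZR_lt]. Qed.

Lemma dot_embZ g p : dot (embZ g) (embZ p) = IZR (dotZ g p).
Proof. by rewrite /dotZ plus_IZR !mult_IZR. Qed.

Lemma separatesZ_emb g p q r s : separatesZ g p q r s ->
  separates (embZ g) (embZ p) (embZ q) (embZ r) (embZ s).
Proof.
rewrite /separatesZ -!leIZR -!ltIZR -!dot_embZ => /and5P[? ? ? ? /orP S]; exact: And5.
Qed.

Lemma straddles_embZ p q r s :
  straddles (embZ p) (embZ q) (embZ r) (embZ s) = straddlesZ p q r s.
Proof.
have E p' q' r' : orient (embZ p') (embZ q') (embZ r') = IZR (orientZ p' q' r').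
  by rewrite /orientZ minus_IZR !mult_IZR !minus_IZR.
rewrite /straddles /straddlesZ -!ltIZR !E !mult_IZR //.
Qed.

Lemma ltb_scale k a b : 0 < k -> (k * a <? k * b) = (a <? b).
Proof. by move=> k0; apply/Z.ltb_spec0/Z.ltb_spec0; rewrite -Z.mul_lt_mono_pos_l. Qed.

Lemma leb_scale k a b : 0 < k -> (k * a <=? k * b) = (a <=? b).
Proof. by move=> k0; apply/Z.leb_spec0/Z.leb_spec0; rewrite -Z.mul_le_mono_pos_l. Qed.

Lemma dotZ_scale k g p : dotZ g (scaleZ k p) = k * dotZ g p.
Proof. rewrite /dotZ /=; lia. Qed.

Lemma separatesZ_scale k g p q r s : 0 < k ->
  separatesZ g (scaleZ k p) (scaleZ k q) (scaleZ k r) (scaleZ k s) = separatesZ g p q r s.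
Proof. by move=> k0; rewrite /separatesZ !dotZ_scale !leb_scale ?ltb_scale. Qed.

Lemma straddlesZ_scale k p q r s : 0 < k ->
  straddlesZ (scaleZ k p) (scaleZ k q) (scaleZ k r) (scaleZ k s) = straddlesZ p q r s.
Proof.
move=> k0; have E p' q' r' s' : orientZ (scaleZ k p') (scaleZ k q') (scaleZ k r') * orientZ
    (scaleZ k p') (scaleZ k q') (scaleZ k s')
    = (k * k * (k * k)) * (orientZ p' q' r' * orientZ p' q' s').
  by rewrite /orientZ /=; lia.
rewrite /straddlesZ !E -{1 3}(Z.mul_0_r (k * k * (k * k))) !ltb_scale //; lia.
Qed.
Lemma separableZ_emb k p q r s : 0 < k -> separableZ p q r s ->
  separated (embZ (scaleZ k p)) (embZ (scaleZ k q)) (embZ (scaleZ k r)) (embZ (scaleZ k s)).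
Proof.
move=> k0; rewrite /separableZ; elim: (_ ++ _) => //= g l IH /orP[|/IH//].
by rewrite -(separatesZ_scale g p q r s k0) -(separatesZ_scale g r s p q k0) => /orP[]
    /separatesZ_emb S; exists (embZ g); [left | right].
Qed.
End IntegerPoints.

(** * Prism drawings scaled by level *)

Section PrismDrawing.
Variables (l6 : seq (nat * nat)) (base : bool -> nat -> Z * Z).

(** The value is well above the coordinates of the layouts, which are at most 20 in absolute value,
    so that the finite checks on both layouts succeed. *)
Definition ratio : Z := Zpos 100.

(** [base] is told whether the level is the last one. As this depends on [n - v.2], the levels from
    [i] on are a scaled copy of a shorter prism; this is [pos_shift]. *)
Definition pos n (v : vtx) := scaleZ (Z.pow ratio (Z.of_nat v.2)) (base (n - v.2 == 0) v.1).

Definition edges_at n i : seq (vtx * vtx) :=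
  [seq vert e i | e <- l6] ++ (if i < n then [seq rail t i | t <- iota 0 6] else [::]).

(** Vertices are added as degenerate edges. One check then covers distinct positions of vertices,
    edges avoiding vertices, and pairs of edges. *)
Definition items_at n i := edges_at n i ++ [seq ((t, i), (t, i)) | t <- iota 0 6].

Definition straddle_at n (x y : vtx * vtx) :=
  straddlesZ (pos n x.1) (pos n x.2) (pos n y.1) (pos n y.2).

Definition separable_at n (x y : vtx * vtx) :=
  separableZ (pos n x.1) (pos n x.2) (pos n y.1) (pos n y.2).

Definition near_ok n := all (fun x => all (fun y => [|| x == y, straddle_at n x y | separable_at n
    x y])
  (items_at n 0 ++ if 0 < n then items_at n 1 else [::])) (items_at n 0).

(** Because of the maximum with 0 the inequality survives multiplication of its right side by
    further powers of [ratio], so a check against the level just below extends to all lower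
    levels. *)
Definition beyond n v g := all (fun t =>
  Z.ltb (Z.max 0 (dotZ g (base false t))) (Z.mul ratio (dotZ g (pos n v)))) (iota 0 6).

Definition far_ok n := all (fun y => has (fun g => beyond n y.1 g && beyond n y.2 g)
  (pos n y.1 :: axes (pos n y.1) (pos n y.2))) (items_at n 0).

Definition straddle_count n i j :=
  sumn [seq count (straddle_at n x) (edges_at n j) | x <- edges_at n i].

(** Ordered pairs are counted, so each crossing appears twice; pairs of levels further apart
    contribute nothing by [far_ok]. *)
Definition level_count n := straddle_count n 0 0 + 2 * (if 0 < n then straddle_count n 0 1 else 0).

Hypothesis l6_ok : all (fun e => [&& e.1 < 6, e.2 < 6 & e.1 != e.2]) l6.
Hypothesis near_all : all near_ok (iota 0 4).
Hypothesis far_all : all far_ok (iota 0 4).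

Definition shift i (x : vtx * vtx) : vtx * vtx := ((x.1.1, i + x.1.2), (x.2.1, i + x.2.2)).

Lemma ratio_pow_gt0 i : Z.lt 0 (Z.pow ratio (Z.of_nat i)).
Proof. by apply: Z.pow_pos_nonneg; rewrite /ratio; lia. Qed.

Lemma pos_shift n i t j : pos (i + n) (t, i + j) = scaleZ (Z.pow ratio (Z.of_nat i)) (pos n (t, j)).
Proof.
rewrite /pos /= subnDl Nat2Z.inj_add Z.pow_add_r; [|lia..].
by rewrite /scaleZ /= !Z.mul_assoc.
Qed.

(* On the levels up to 2, only [minn n 3] matters, as [base] only tests for the top level. *)
Lemma pos_cap n t j : j <= 2 -> pos (minn n 3) (t, j) = pos n (t, j).
Proof. by move=> j2; rewrite /pos /=; congr (scaleZ _ (base _ _)); apply/eqP/eqP; lia. Qed.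

Lemma edges_shift n i j : edges_at (i + n) (i + j) = [seq shift i x | x <- edges_at n j].
Proof.
rewrite /edges_at ltn_add2l map_cat -map_comp; congr cat; case: (j < n) => //.
by rewrite -map_comp; apply: eq_map => t; rewrite /rail /shift /= addnS.
Qed.

Lemma items_shift n i j : items_at (i + n) (i + j) = [seq shift i x | x <- items_at n j].
Proof. by rewrite /items_at edges_shift map_cat -map_comp. Qed.

Lemma straddle_shift n i x y : straddle_at (i + n) (shift i x) (shift i y) = straddle_at n x y.
Proof.
rewrite /straddle_at !pos_shift straddlesZ_scale; last exact: ratio_pow_gt0.
by case: x y => [[? ?] [? ?]] [[? ?] [? ?]].
Qed.
Definition low (x : vtx * vtx) := (x.1.2 <= 2) && (x.2.2 <= 2).

Lemma straddle_cap n x y : low x -> low y -> straddle_at (minn n 3) x y = straddle_at n x y.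
Proof.
by case: x y => [[? ?] [? ?]] [[? ?] [? ?]] /andP[? ?] /andP[? ?]; rewrite /straddle_at !pos_cap.
Qed.

Lemma separable_cap n x y : low x -> low y -> separable_at (minn n 3) x y = separable_at n x y.
Proof.
by case: x y => [[? ?] [? ?]] [[? ?] [? ?]] /andP[? ?] /andP[? ?]; rewrite /separable_at !pos_cap.
Qed.

Lemma items_cap n j : j <= 1 -> items_at (minn n 3) j = items_at n j.
Proof.
by move=> j1; rewrite /items_at /edges_at (_ : (j < minn n 3) = (j < n)) //; lia.
Qed.

Lemma edges_cap n j : j <= 1 -> edges_at (minn n 3) j = edges_at n j.
Proof. by move=> j1; rewrite /edges_at (_ : (j < minn n 3) = (j < n)) //; lia. Qed.

Lemma items_atP n j x : x \in items_at n j ->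
  exists t u d, [/\ t < 6, u < 6, d <= 1, j + d <= maxn n j & x = ((t, j), (u, j + d))].
Proof.
rewrite /items_at /edges_at !mem_cat => /orP[/orP[]|] => [/mapP[e el ->]||/mapP[t tI ->]].
- exists e.1, e.2, 0; rewrite addn0 leq_maxr; have /and3P[? ? _] := allP l6_ok e el; exact: And5.
- case: ltnP => // jn /mapP[t tI ->]; exists t, t, 1; rewrite addn1 /rail; split=> //; try lia.
    by rewrite mem_iota in tI.
  by rewrite mem_iota in tI.
- by rewrite mem_iota in tI; exists t, t, 0; rewrite addn0 leq_maxr; exact: And5.
Qed.

Lemma items_low n j x : j <= 1 -> x \in items_at n j -> low x.
Proof. by rewrite /low => j1 /items_atP[t [u [d [_ _ d1 _ ->]]]] /=; lia. Qed.

Definition posR n v := embZ (pos n v).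

Definition compatible n (x y : vtx * vtx) :=
  straddle_at n x y \/ separated (posR n x.1) (posR n x.2) (posR n y.1) (posR n y.2).

Lemma near_pairs n x y : x \in items_at n 0 ->
  y \in items_at n 0 ++ (if 0 < n then items_at n 1 else [::]) -> x != y ->
  straddle_at n x y || separable_at n x y.
Proof.
move=> xI yI /negPf xy; have lx := items_low (leq0n 1) xI.
have ly : low y.
  by move: yI; rewrite mem_cat => /orP[/items_low->//|]; case: ifP => // _ /items_low->.
have /(allP near_all)/allP : minn n 3 \in iota 0 4 by rewrite mem_iota; lia.
rewrite items_cap // => /(_ x xI)/allP; rewrite leq_min andbT items_cap // => /(_ y yI).
by rewrite xy straddle_cap // separable_cap.
Qed.

Lemma near_compatible n i x y : i <= n -> x \in items_at n i ->
  y \in items_at n i ++ (if i < n then items_at n i.+1 else [::]) -> x != y -> compatible n x y.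
Proof.
move=> /subnKC<-; move: (n - i) => n0.
have -> : (if i < i + n0 then items_at (i + n0) i.+1 else [::]) =
    [seq shift i y0 | y0 <- if 0 < n0 then items_at n0 1 else [::]].
  by rewrite -{1}(addn0 i) ltn_add2l -(addn1 i) items_shift; case: ifP.
have Ei : items_at (i + n0) i = [seq shift i y0 | y0 <- items_at n0 0] by
    rewrite -items_shift addn0.
rewrite !Ei -map_cat => /mapP[x0 xI ->] /mapP[y0 yI ->] xy.
have {}xy : x0 != y0 by apply: contraNneq xy => ->.
case/orP: (near_pairs xI yI xy) => [st|sep]; first by left; rewrite straddle_shift.
right; have := separableZ_emb (ratio_pow_gt0 i) sep.
by rewrite -!pos_shift; case: (x0) (y0) => [[? ?] [? ?]] [[? ?] [? ?]].
Qed.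

Lemma far_compatible n i j x y : i.+1 < j -> j <= n -> x \in items_at n i -> y \in items_at n j ->
  separated (posR n x.1) (posR n x.2) (posR n y.1) (posR n y.2).
Proof.
move=> ij /subnKC<-; move: (n - j) => n0.
have -> : items_at (j + n0) j = [seq shift j y0 | y0 <- items_at n0 0] by
    rewrite -items_shift addn0.
move=> xI /mapP[y0 yI ->].
have : minn n0 3 \in iota 0 4 by rewrite mem_iota; lia.
move=> /(allP far_all)/allP; rewrite items_cap // => /(_ y0 yI).
have ly := items_low (leq0n 1) yI.
have sep g : beyond (minn n0 3) y0.1 g && beyond (minn n0 3) y0.2 g ->
    separates (embZ g) (posR (j + n0) x.1) (posR (j + n0) x.2)
    (posR (j + n0) (shift j y0).1) (posR (j + n0) (shift j y0).2).
  have [t [u [d [t6 u6 d1 _ ->]]]] := items_atP xI.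
  move: ly; rewrite /shift; case: (y0) => [[a p] [b q]] /andP[/= p2 q2].
  rewrite /beyond !pos_cap // => /andP[/allP A /allP B].
  (* The vertex [(t', l)] lies at a level [l < j]. After division by [ratio ^ l] the claim reads
     [P < ratio ^ (j - l) * Q], and it follows from [max 0 P < ratio * Q] since [j - l] is
     positive. *)
  have L t' l v : t' < 6 -> l <= i.+1 ->
      Z.lt (Z.max 0 (dotZ g (base false t'))) (Z.mul ratio (dotZ g (pos n0 v))) ->
      (dot (embZ g) (posR (j + n0) (t', l)) < dot (embZ g) (posR (j + n0) (v.1, j + v.2)))%R.
    move=> t'6 li H; rewrite !dot_embZ ltIZR pos_shift dotZ_scale -surjective_pairing.
    rewrite {1}/pos /= (_ : (_ == 0) = false); last by lia.
    rewrite dotZ_scale; apply/Z.ltb_spec0.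
    move: (dotZ g (base false t')) (dotZ g (pos n0 v)) H => P Q H.
    have -> : j = l + (j - l) by lia.
    rewrite Nat2Z.inj_add Z.pow_add_r; [|lia..].
    rewrite -Z.mul_assoc -Z.mul_lt_mono_pos_l; last exact: ratio_pow_gt0.
    have -> : j - l = (j - l).-1.+1 by lia.
    rewrite Nat2Z.inj_succ Z.pow_succ_r; last by lia.
    have := ratio_pow_gt0 (j - l).-1; move: (Z.pow _ _) => w w0.
    have : Z.le (Z.mul ratio Q) (Z.mul w (Z.mul ratio Q)) by move: H; rewrite /ratio; nia.
    by lia.
  have M v : (forall t', t' \in iota 0 6 -> Z.ltb (Z.max 0 (dotZ g (base false t'))) (Z.mul ratio
      (dotZ g (pos n0 v)))) ->
      forall t' l, t' < 6 -> l <= i.+1 ->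
      (dot (embZ g) (posR (j + n0) (t', l)) < dot (embZ g) (posR (j + n0) (v.1, j + v.2)))%R.
    by move=> H t' l t'6 li; apply: L => //; apply/Z.ltb_spec0/H; rewrite mem_iota.
  have [id1 i1] : i <= i.+1 /\ i + d <= i.+1 by lia.
  by split; last left; try apply: ltW; (apply: (M (a, p)) || apply: (M (b, q))).
elim: (_ :: _) => //= g s IH /orP[/sep S|/IH//]; by exists (embZ g); left.
Qed.

Lemma straddlesC (p q r s : R * R) : straddles p q r s = straddles r s p q.
Proof. by rewrite /straddles andbC. Qed.

Lemma separatedC (p q r s : R * R) : separated p q r s -> separated r s p q.
Proof. by case=> g S; exists g; case: S; [right | left]. Qed.

Lemma compatibleC n x y : compatible n x y -> compatible n y x.
Proof. by case=> [|/separatedC]; [left; rewrite /straddle_at -straddles_embZ straddlesC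
    straddles_embZ | right]. Qed.

Lemma items_compatible n i j x y : i <= n -> j <= n -> x \in items_at n i -> y \in items_at n j ->
  x != y -> compatible n x y.
Proof.
wlog ij : i j x y / i <= j => [H|] i_n jn xI yI xy.
  have [ij|/ltnW ji] := leqP i j; first exact: (H i j).
  by apply: compatibleC; apply: (H j i); rewrite // eq_sym.
have [ij1|ij1] := leqP j i.+1; last by right; apply: far_compatible ij1 jn xI yI.
apply: near_compatible i_n xI _ xy; rewrite mem_cat.
move: ij; rewrite leq_eqVlt => /predU1P[->|ij]; first by rewrite yI.
have E : j = i.+1 by lia.
by rewrite E in jn yI *; rewrite jn yI orbT.
Qed.

Section Level.
Variable n : nat.
Let G := cartesian (list_graph 6 l6) (path_graph n).
Implicit Types (e f : gV G * gV G) (w : gV G).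

Definition label w : vtx := (val w.1, val w.2).

Let place w := posR n (label w).

(** [dedge] directs an edge by the enumeration of the vertices; this is the direction in which the
    edge occurs in [edges_at]. *)
Definition prism_code e : vtx * vtx :=
  let x := (label e.1, label e.2) in
  if has (fun i => x \in edges_at n i) (iota 0 n.+1) then x else (x.2, x.1).

Lemma label_inj : injective label.
Proof. by move=> [t i] [u j] [/val_inj-> /val_inj->]. Qed.

Lemma prism_code_at e : dedge e -> exists2 i, i <= n & prism_code e \in edges_at n i.
Proof.
rewrite /dedge => /andP[ge _]; rewrite /prism_code.
case: ifPn => [/hasP[i]|/hasPn no]; first by rewrite mem_iota => ? ?; exists i.
have {}no i : i <= n -> (label e.1, label e.2) \notin edges_at n i.
  by move=> i_n; apply: no; rewrite mem_iota.
case: e ge no => [[t i] [u j]]; rewrite /= /cart_rel /= /list_rel /label /=.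
have ti := ltn_ord i; have tj := ltn_ord j.
case/orP => /andP[/eqP->] /andP[_ /orP[]].
- move=> /mapP[k]; rewrite mem_iota => /= kn [-> ->] /(_ k);
    rewrite mem_cat kn => /(_ (ltnW kn))/norP[_] /negP[].
  by apply: (map_f (rail^~ k)); rewrite mem_iota; apply: ltn_ord.
- move=> /mapP[k]; rewrite mem_iota => /= kn [-> ->] _; exists k; first exact: ltnW.
  by rewrite mem_cat kn orbC (map_f (rail^~ k)) // mem_iota; apply: ltn_ord.
- by move=> tu /(_ j tj)/negP[]; rewrite mem_cat (map_f (vert^~ j) tu).
- by move=> ut _; exists (nat_of_ord j) => //; rewrite mem_cat (map_f (vert^~ j) ut).
Qed.

Lemma prism_code_ends e : prism_code e = (label e.1, label e.2) \/ prism_code e = (label e.2,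
    label e.1).
Proof. by rewrite /prism_code; case: ifP; [left | right]. Qed.

Lemma prism_code_inj e f : dedge e -> dedge f -> prism_code e = prism_code f -> e = f.
Proof.
move=> /andP[_ re] /andP[_ rf] E; have : e = f \/ e = (f.2, f.1).
  case: e f {re rf} E => [a b] [c d].
  case: (prism_code_ends (a, b)) => ->; case: (prism_code_ends (c, d)) => -> /= E;
    have /label_inj -> := congr1 fst E; have /label_inj -> := congr1 snd E; by [left | right].
by case=> // E'; move: re; rewrite E' /= ltnNge ltnW.
Qed.

(** Distinct vertices are compatible as degenerate edges. A point straddles nothing, and a strict
    separation excludes equal positions. *)
Lemma place_inj : injective place.
Proof.
move=> v w E; apply/eqP/negPn/negP => vw.
have [i j] : val v.2 <= n /\ val w.2 <= n by split; rewrite -ltnS ltn_ord.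
have I w' : (label w', label w') \in items_at n (val w'.2).
  by rewrite mem_cat orbC (map_f (fun t => ((t, val w'.2), (t, val w'.2)))) // mem_iota /= ltn_ord.
have [|st|] := items_compatible i j (I v) (I w).
- by apply: contraNneq vw => /(congr1 fst)/label_inj->.
- by move: st; rewrite /straddle_at -!straddles_embZ /straddles /orient;
    rewrite !subrr !mul0r subrr mul0r ltxx.
case=> g []; rewrite -/(place v) -/(place w) E => -[_ _ _ _ []]; by rewrite ltxx.
Qed.

Lemma straddlesCl (p q r s : R * R) : straddles p q r s = straddles q p r s.
Proof.
have E (x y z : R * R) : orient y x z = (- orient x y z)%R by rewrite /orient; ring.
by rewrite /straddles (E p q r) (E p q s) mulrNN [X in _ && (X < 0)%R]mulrC.
Qed.

Lemma straddlesCr (p q r s : R * R) : straddles p q r s = straddles p q s r.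
Proof. by rewrite straddlesC straddlesCl straddlesC. Qed.

Lemma separatedCl (p q r s : R * R) : separated p q r s -> separated q p r s.
Proof.
case=> g S; exists g; case: S => -[a b c d e]; [left | right]; split=> //.
  by case: (ltP (dot g q) (dot g r)) => [|h]; [left | right; case: e; lra].
by case: (ltP (dot g r) (dot g q)) => [|h]; [left | right; case: e; lra].
Qed.

Lemma separatedCr (p q r s : R * R) : separated p q r s -> separated p q s r.
Proof. by move/separatedC/separatedCl/separatedC. Qed.

Lemma vertex_clear e : dedge e -> forall w, separated (place e.1) (place e.2) (place w) (place w).
Proof.
move=> de w; have [i i_n eI] := prism_code_at de.
have wI : (label w, label w) \in items_at n (val w.2).
  by rewrite mem_cat orbC (map_f (fun t => ((t, val w.2), (t, val w.2)))) // mem_iota /= ltn_ord.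
have wn : val w.2 <= n by rewrite -ltnS ltn_ord.
have eI' : prism_code e \in items_at n i by rewrite mem_cat eI.
have [|st|] := items_compatible i_n wn eI' wI.
- apply/eqP => E; have E12 : e.1 = e.2.
    by apply: label_inj; case: (prism_code_ends e) E => -> E; have /= -> := congr1 fst E;
        have /= -> := congr1 snd E.
  by move: de; rewrite /dedge E12 ltnn andbF.
- move: st; rewrite /straddle_at -!straddles_embZ /straddles andbC /orient.
  by rewrite !subrr !mul0r subrr mul0r ltxx.
by case: (prism_code_ends e) => -> //; apply: separatedCl.
Qed.

Lemma place_pairs e f : dedge e -> dedge f -> e != f ->
  straddles (place e.1) (place e.2) (place f.1) (place f.2) \/
  separated (place e.1) (place e.2) (place f.1) (place f.2).
Proof.
move=> de df ef; have [i i_n eI] := prism_code_at de; have [j jn fJ] := prism_code_at df.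
have [||||] := items_compatible i_n jn (x := prism_code e) (y := prism_code f).
- by rewrite mem_cat eI.
- by rewrite mem_cat fJ.
- by apply: contraNneq ef => /(prism_code_inj de df)->.
- rewrite /straddle_at -!straddles_embZ; case: (prism_code_ends e) => ->; case: (prism_code_ends
    f) => -> /= st; left => //.
  + by rewrite straddlesCr.
  + by rewrite straddlesCl.
  + by rewrite straddlesCl straddlesCr.
- case: (prism_code_ends e) => ->; case: (prism_code_ends f) => -> /= st; right => //.
  + exact: separatedCr.
  + exact: separatedCl.
  + exact/separatedCl/separatedCr.
Qed.

Lemma place_straddle e f :
  straddle place e f = straddle_at n (prism_code e) (prism_code f).
Proof.
rewrite /straddle_at -!straddles_embZ /straddle.
case: (prism_code_ends e) => ->; case: (prism_code_ends f) => -> //=.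
- by rewrite straddlesCr.
- by rewrite straddlesCl.
- by rewrite straddlesCl straddlesCr.
Qed.

Lemma sum_dedge_le (F : vtx * vtx -> nat) :
  \sum_(e | dedge e) F (prism_code e) <= \sum_(0 <= i < n.+1) \sum_(x <- edges_at n i) F x.
Proof.
rewrite -big_filter -(big_map prism_code xpredT) -(big_allpairs_dep (h := fun _ x => x)).
set s := map _ _; apply: (sub_le_big_seq (op := addn) (le := leq) leqnn (fun a b => leq_addr b a))
    => x.
have us : uniq s.
  rewrite map_inj_in_uniq ?filter_uniq ?index_enum_uniq // => e f.
  by rewrite !mem_filter => /andP[de _] /andP[df _]; apply: prism_code_inj.
rewrite count_uniq_mem //; case: (boolP (x \in s)) => // xs; rewrite -has_count has_pred1.
move: xs => /mapP[e]; rewrite mem_filter => /andP[/prism_code_at[i i_n eI] _] ->.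
by apply/allpairsPdep; exists i, (prism_code e); rewrite mem_index_iota ltnS.
Qed.

Lemma straddle_countE i j : straddle_count n i j =
  \sum_(x <- edges_at n i) \sum_(y <- edges_at n j) straddle_at n x y.
Proof.
by rewrite /straddle_count sumnE big_map; apply: eq_bigr => x _; rewrite -sum1_count big_mkcond.
Qed.

Lemma sum_straddle_le :
  \sum_(e | dedge e) \sum_(f | dedge f && (f != e)) straddle place e f
  <= \sum_(0 <= i < n.+1) \sum_(0 <= j < n.+1) straddle_count n i j.
Proof.
apply: (@leq_trans (\sum_(e | dedge e) \sum_(0 <= j < n.+1)
    \sum_(y <- edges_at n j) straddle_at n (prism_code e) y)).
  apply: leq_sum => e _; apply: leq_trans (sum_dedge_le _).
  rewrite big_mkcondr; apply: leq_sum => f _; rewrite place_straddle.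
  by case: ifP.
apply: leq_trans (sum_dedge_le (fun x => \sum_(0 <= j < n.+1)
    \sum_(y <- edges_at n j) straddle_at n x y)) _.
apply: leq_sum => i _; rewrite exchange_big; apply: leq_sum => j _.
by rewrite straddle_countE.
Qed.

Lemma straddle_countC i j : straddle_count n i j = straddle_count n j i.
Proof.
rewrite !straddle_countE exchange_big; apply: eq_bigr => x _; apply: eq_bigr => y _.
by rewrite /straddle_at -!straddles_embZ straddlesC.
Qed.

Lemma separated_straddle (p q r s : R * R) : separated p q r s -> straddles p q r s = false.
Proof.
move=> sep; apply/negP => /straddles_on_seg[z /(_ z)[+ _]] => /(_ erefl)[a [b [a01 b01 <- E]]].
exact: (separated_on_seg sep a01 b01 (esym E)).
Qed.

Lemma straddle_count_far i j : i.+1 < j -> j <= n -> straddle_count n i j = 0.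
Proof.
move=> ij jn; rewrite /straddle_count sumnE big_map big1_seq // => x /andP[_ xI].
apply/eqP; rewrite -leqn0 leqNgt -has_count; apply/hasPn => y yI.
rewrite /straddle_at -straddles_embZ separated_straddle //.
by apply: (far_compatible ij jn); rewrite mem_cat ?xI ?yI.
Qed.
End Level.

Lemma straddle_count_shift n i j k : straddle_count (k + n) (k + i) (k + j) = straddle_count n i j.
Proof.
rewrite /straddle_count !edges_shift -map_comp; congr sumn; apply: eq_map => x /=.
by rewrite count_map; apply: eq_count => y; apply: straddle_shift.
Qed.

Lemma level_count_cap n : level_count (minn n 3) = level_count n.
Proof.
have E j : j <= 1 -> straddle_count (minn n 3) 0 j = straddle_count n 0 j.
  move=> j1; rewrite /straddle_count !edges_cap //; congr sumn; apply/eq_in_map => x xI.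
  apply/eq_in_count => y yI; apply: straddle_cap.
    by apply: (@items_low n 0) => //; rewrite mem_cat xI.
  by apply: (@items_low n j) => //; rewrite mem_cat yI.
by rewrite /level_count leq_min andbT !E.
Qed.

Lemma sum_tridiagonal (W : nat -> nat -> nat) N : (forall i j, W i j = W j i) ->
  (forall i j, i.+1 < j -> j < N.+1 -> W i j = 0) ->
  \sum_(0 <= i < N.+1) \sum_(0 <= j < N.+1) W i j
  = \sum_(0 <= i < N.+1) (W i i + 2 * (if i < N then W i i.+1 else 0)).
Proof.
move=> WC; elim: N => [|N IH] W0; first by rewrite !big_nat1 addn0.
have zero : \sum_(0 <= i < N) W i N.+1 = 0.
  by rewrite big_nat big1 // => i /andP[_ iN]; apply: W0.
have edge : \sum_(0 <= i < N.+1) W i N.+1 = W N N.+1 by rewrite big_nat_recr //= zero.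
rewrite big_nat_recr //=; under eq_bigr => i _ do rewrite big_nat_recr //=.
rewrite big_split /= IH => [|i j ij jN]; last by apply: W0; rewrite // ltnW.
have edge' : \sum_(0 <= j < N.+1) W N.+1 j = W N N.+1.
  by rewrite -edge; apply: eq_bigr => j _; apply: WC.
rewrite edge [X in _ + X]big_nat_recr //= edge' [RHS]big_nat_recr //= ltnn muln0 addn0
    !big_nat_recr //= ltnn ltnSn muln0 addn0.
rewrite (eq_big_nat _ _ (F2 := fun i => W i i + 2 * (if i < N.+1 then W i i.+1 else 0))).
  by lia.
by move=> i /andP[_ iN]; rewrite iN ltnS (ltnW iN).
Qed.

(** The matrix of counts is tridiagonal, and the levels from [i] on are a scaled prism with [n - i]
    steps. Row [i] therefore contributes [level_count (n - i)], and the sum is read backwards. *)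
Lemma sum_straddle_level n :
  \sum_(0 <= i < n.+1) \sum_(0 <= j < n.+1) straddle_count n i j = \sum_(0
      <= r < n.+1) level_count r.
Proof.
rewrite sum_tridiagonal; [|exact: straddle_countC|by move=> i j ij jn; apply: straddle_count_far].
rewrite [RHS]big_nat_rev /= add0n !big_nat; apply: eq_bigr => i /andP[_]; rewrite ltnS => i_n.
rewrite subSS /level_count; move: (n - i) (subnKC i_n) => m <-.
have E j : straddle_count (i + m) i (i + j) = straddle_count m 0 j.
  by rewrite -(straddle_count_shift m 0 j i) addn0.
have := E 0; have := E 1; rewrite addn0 addn1 => -> ->.
by rewrite -[X in X < _]addn0 ltn_add2l.
Qed.

Lemma even_pair_sum (T : finType) (P : pred T) (F : T -> T -> nat) : (forall e f, F e f = F f e) ->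
  exists m, \sum_(e | P e) \sum_(f | P f && (f != e)) F e f = m.*2.
Proof.
move=> FC; pose S := \sum_(e | P e) \sum_(f | P f && (enum_rank f < enum_rank e)) F e f.
exists S; rewrite -addnn.
have SE : S = \sum_(e | P e) \sum_(f | P f && (enum_rank e < enum_rank f)) F e f.
  rewrite /S (exchange_big_dep P) => [|e f _ /andP[]//]; apply: eq_bigr => f Pf.
  by apply: eq_big => [e|e _]; rewrite ?Pf.
rewrite {2}SE -big_split; apply: eq_bigr => e Pe /=.
rewrite (bigID (fun f => enum_rank f < enum_rank e)) /=; congr addn; apply: eq_bigl => f;
  rewrite -andbA; congr andb; rewrite -(inj_eq enum_rank_inj) -val_eqE /=; by case: ltngtP.
Qed.

Lemma sum_level_count a b n : map level_count (iota 0 4) = [:: 0; a; b; b] -> 0 < n ->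
  \sum_(0 <= r < n.+1) level_count r = a + b * n.-1.
Proof.
move=> [c0 c1 c2 c3]; case: n => // n _.
rewrite big_nat_recl // c0 big_nat_recl // c1 add0n /= (eq_bigr (fun _ => b)) => [|r _].
  by rewrite sum_nat_const_nat subn0 mulnC.
rewrite -level_count_cap; case: r => [|r]; first exact: c2.
by rewrite (_ : minn _ 3 = 3) ?c3 //; lia.
Qed.

(** The last level contributes no crossing, the one below it [a] ordered pairs, and each further
    level [b]. This bounds the count [m] of the straight drawing by [k], and the assumed lower bound
    gives [m = k]. *)
Theorem prism_upper a b n k : 0 < n ->
  map level_count (iota 0 4) = [:: 0; a; b; b] -> a + b * n.-1 = k.*2 ->
  (forall (D : drawing (cartesian (list_graph 6 l6) (path_graph n))) m, drawing_crossings D m -> k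
      <= m) ->
  exists D : drawing (cartesian (list_graph 6 l6) (path_graph n)), drawing_crossings D k.
Proof.
move=> n0 counts abk lower.
have [m total] := even_pair_sum (@dedge (cartesian (list_graph 6 l6) (path_graph n)))
  (fun e f => congr1 nat_of_bool (straddlesC _ _ _ _)) (F := straddle (fun w => posR n (label w))).
have Dm := straight_crossings (@place_inj n) (@vertex_clear n) (@place_pairs n) total.
have := sum_straddle_le n; rewrite sum_straddle_level (sum_level_count counts n0) abk [leqLHS]total.
rewrite leq_double => mk; have := lower _ _ Dm => km.
by exists (straight (@place_inj n) (@vertex_clear n)); rewrite (_ : k = m) //; lia.
Qed.
End PrismDrawing.

(** * The two layouts and their finite checks *)

Section Layouts.
Local Open Scope Z_scope.

(* The hub lies between lines 1 and 5 inside the rim of its level, except on the last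
   level, where it lies outside. *)
Definition layout110 (last : bool) (t : nat) : Z * Z :=
  match t with
  | 0%nat => if last then (4, 0) else (1, 0)
  | 1%nat => (2, 2) | 2%nat => (-2, 20) | 3%nat => (-4, 0) | 4%nat => (-2, -20) | _ => (2, -2)
  end.

(* The two hubs lie on opposite sides, in the gaps between lines 5 and 1 and between
   lines 2 and 4. *)
Definition layout137 (last : bool) (t : nat) : Z * Z :=
  match t with
  | 0%nat => (1, 0) | 1%nat => (2, 20) | 2%nat => (-2, 2)
  | 3%nat => (-6, 0) | 4%nat => (-2, -2) | _ => (2, -20)
  end.
End Layouts.

Lemma near110 : all (near_ok edges110 layout110) (iota 0 4). Proof. by vm_compute. Qed.
Lemma far110 : all (far_ok edges110 layout110) (iota 0 4). Proof. by vm_compute. Qed.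
Lemma counts110 : map (level_count edges110 layout110) (iota 0 4) = [:: 0; 4; 6; 6].
Proof. by vm_compute. Qed.

Lemma near137 : all (near_ok edges137 layout137) (iota 0 4). Proof. by vm_compute. Qed.
Lemma far137 : all (far_ok edges137 layout137) (iota 0 4). Proof. by vm_compute. Qed.
Lemma counts137 : map (level_count edges137 layout137) (iota 0 4) = [:: 0; 8; 8; 8].
Proof. by vm_compute. Qed.

Theorem theorem2p1 (n : nat) : (1 <= n)%N ->
  crossing_number_is (cartesian G6_110 (path_graph n)) (3 * n - 1) /\
  crossing_number_is (cartesian G6_137 (path_graph n)) (4 * n).
Proof.
move=> n1.
have U110 : exists D : drawing (cartesian (list_graph 6 edges110) (path_graph n)),
    drawing_crossings D (3 * n - 1).
  apply: (@prism_upper edges110 layout110 isT near110 far110 _ _ _ _ n1 counts110);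
    last exact: wheel_lower.
  (* Here [4 + 6 * (n - 1) = 2 * (3 * n - 1)]. *)
  by clear -n1; lia.
have U137 : exists D : drawing (cartesian (list_graph 6 edges137) (path_graph n)),
    drawing_crossings D (4 * n).
  apply: (@prism_upper edges137 layout137 isT near137 far137 _ _ _ _ n1 counts137);
    last exact: double_hub_lower.
  (* Here [8 + 8 * (n - 1) = 2 * (4 * n)]. *)
  by clear -n1; lia.
by split; split; [exact: U110 | exact: wheel_lower | exact: U137 | exact: double_hub_lower].
Qed.
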